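(* Let $\alpha\in(0,1)$, let $g$ be smooth, and let $f$ be such that $f(g(t))$ is an $L^1$ function of the form $t^{\lambda}\eta(t)$ with $\mathrm{Re}(\lambda)>-1$ and $\eta$ analytic on a domain $R\subset\mathbb{C}$ containing $a$. Then $$ {}^{ABR}D^{\alpha}_{a+}f(g(t))=\frac{B(\alpha)}{1-\alpha}\Bigg[E_{\alpha}\Big(\frac{-\alpha}{1-\alpha}(t-a)^{\alpha}\Big)f(g(t))+\sum_{m=0}^{\infty}\sum_{n=1}^{\infty}\Big(\frac{-\alpha}{1-\alpha}\Big)^m\binom{-m\alpha}{n}\frac{(t-a)^{n+m\alpha}}{\Gamma(n+m\alpha+1)}\sum_{k=1}^n\frac{\mathrm{d}^kf(g(t))}{\mathrm{d}g(t)^k}\sum_{(P_1,\dots,P_n)}\prod_{i=1}^n\frac{i}{P_i!\,(i!)^{P_i}}\Big(\frac{\mathrm{d}^ig(t)}{\mathrm{d}t^i}\Big)^{P_i}\Bigg], $$ where the innermost sum is over all $n$-tuples $(P_1,\dots,P_n)$ of non-negative integers such that $\sum_iP_i=k$ and $\sum_i iP_i=n$.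
   Context: The Mittag-Leffler function is $E_\alpha(x)=\sum_{n=0}^\infty \frac{x^n}{\Gamma(\alpha n+1)}$. $B$ is a fixed normalisation function with real, strictly positive values and $B(0)=B(1)=1$. The ABR fractional derivative is $$ {}^{ABR}D^{\alpha}_{a+}f(t)=\frac{B(\alpha)}{1-\alpha}\frac{\mathrm{d}}{\mathrm{d}t}\int_a^t f(x)E_\alpha\Big(\frac{-\alpha}{1-\alpha}(t-x)^{\alpha}\Big)\,\mathrm{d}x. $$ $\frac{\mathrm{d}^kf(g(t))}{\mathrm{d}g(t)^k}$ denotes the $k$-th derivative $f^{(k)}$ evaluated at $g(t)$, and $\binom{-m\alpha}{n}$ is the generalised binomial coefficient.
   Formalization: The formula is shown for t>a such that the closed disc with centre t and radius t−a lies in the domain of η, and t−a≤|t| unless λ is a natural number; f is assumed infinitely differentiable at g(t). For arbitrary t the n-series can diverge. *)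

(* Defs.v *)
From HB Require Import structures.
From mathcomp Require Import all_boot all_order all_algebra.
From mathcomp Require Export complex.
From mathcomp Require Import all_classical all_reals all_analysis.

Set Implicit Arguments.
Unset Strict Implicit.
Unset Printing Implicit Defensive.

Import Order.TTheory GRing.Theory Num.Theory.
Import numFieldNormedType.Exports.
Local Open Scope classical_set_scope.
Local Open Scope ring_scope.
Local Open Scope complex_scope.

(* The topology used on R[i] is the one induced by its modulus, which the
   library puts on R[i]^o (any numFieldType seen as a module over itself). *)

Section complex_valued.
Context {R : realType}.
Implicit Types (F : R -> R[i]) (A : set R) (x t : R).

Definition cderivable F x : Prop :=
  derivable (fun y => complex.Re (F y)) x 1 /\
  derivable (fun y => complex.Im (F y)) x 1.

Definition cderiven (k : nat) F x : R[i] :=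
  derive1n k (fun y => complex.Re (F y)) x +i*
  derive1n k (fun y => complex.Im (F y)) x.

Definition cintegrable A F : Prop :=
  lebesgue_measure.-integrable A (EFin \o (fun y => complex.Re (F y))) /\
  lebesgue_measure.-integrable A (EFin \o (fun y => complex.Im (F y))).

Definition cintegral A F : R[i] :=
  (\int[lebesgue_measure]_(y in A) complex.Re (F y)) +i*
  (\int[lebesgue_measure]_(y in A) complex.Im (F y)).

(* All derivatives of F exist at x; each one is asked for on a neighbourhood
   so that no iterated derivative is taken of a junk value. *)
Definition csmooth_at F x : Prop :=
  forall k : nat, \forall y \near x, cderivable (cderiven k F) y.

Definition cexp (z : R[i]) : R[i] :=
  (expR (complex.Re z))%:C * (cos (complex.Im z) +i* sin (complex.Im z)).

(* Principal value of x ^ l for real x: the argument of a negative number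
   is pi, 0 ^ 0 = 1, and 0 ^ l = 0 for the other exponents. *)
Definition rcpow x (l : R[i]) : R[i] :=
  if x == 0 then (l == 0)%:R
  else cexp (l * (ln `|x| +i* (if x < 0 then pi else 0))).

(* Sum of the series u n0 + u (n0 + 1) + ... and its convergence. *)
Definition csum_from (n0 : nat) (u : nat -> R[i]) : R[i] :=
  limn (fun N => \sum_(n0 <= n < N) u n : R[i]^o).

Definition csummable_from (n0 : nat) (u : nat -> R[i]) : Prop :=
  cvgn (fun N => \sum_(n0 <= n < N) u n : R[i]^o).

Definition analytic_on (D : set R[i]^o) (eta : R[i] -> R[i]) : Prop :=
  forall z0, D z0 -> exists (c : nat -> R[i]) (r : R), 0 < r /\
    forall z, `|z - z0| < r%:C ->
      ((fun N => \sum_(0 <= k < N) c k * (z - z0) ^+ k : R[i]^o) @ \oo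
         --> (eta z : R[i]^o)).

Definition domain (D : set R[i]^o) : Prop := open D /\ connected D.

End complex_valued.

Section special_functions.
Context {R : realType}.

(* Euler's integral; meant for 0 < s. *)
Definition Gamma (s : R) : R :=
  \int[lebesgue_measure]_(x in `]0, +oo[) (x `^ (s - 1) * expR (- x)).

Definition mittag_leffler (alpha x : R) : R :=
  limn (series (fun n => x ^+ n / Gamma (alpha * n%:R + 1))).

Definition gbinom (x : R) (n : nat) : R :=
  (\prod_(i < n) (x - i%:R)) / n`!%:R.

End special_functions.

Section ABR.
Context {R : realType}.
Implicit Types (B : R -> R) (F : R -> R[i]).

(* The normalisation is used at the orders alpha in [0, 1]. *)
Definition normalisation B : Prop :=
  (forall x, 0 <= x <= 1 -> 0 < B x) /\ B 0 = 1 /\ B 1 = 1.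

Definition ABR_integral (alpha a : R) F (t : R) : R[i] :=
  cintegral `[a, t] (fun x =>
    F x * (mittag_leffler alpha
             (- alpha / (1 - alpha) * (t - x) `^ alpha))%:C).

Definition ABR B (alpha a : R) F (t : R) : R[i] :=
  (B alpha / (1 - alpha))%:C * cderiven 1 (ABR_integral alpha a F) t.

(* The coefficient of the k-th derivative of the outer function in the n-th
   derivative of f \o g.  P i stands for P_(i+1); the constraint on the
   weighted sum bounds every entry by n, hence the finite type 'I_n.+1. *)
Definition faa_di_bruno_coef (g : R -> R) (t : R) (n k : nat) : R :=
  \sum_(P : {ffun 'I_n -> 'I_n.+1}
         | ((\sum_(i < n) P i)%N == k) && ((\sum_(i < n) i.+1 * P i)%N == n))
    \prod_(i < n) (i.+1%:R / ((P i)`!%:R * (i.+1)`!%:R ^+ P i)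
                   * derive1n i.+1 g t ^+ P i).

End ABR.

(* Main.v *)
Require Import Defs.
From HB Require Import structures.
From mathcomp Require Import all_boot all_order all_algebra.
From mathcomp Require Import cyclic separable cyclotomic complex.
From mathcomp Require Import all_classical all_reals all_analysis measurable_realfun.
From mathcomp Require Import ring lra zify.

Set Implicit Arguments.
Unset Strict Implicit.
Unset Printing Implicit Defensive.

Import Order.TTheory GRing.Theory Num.Theory.
Import numFieldNormedType.Exports.
Local Open Scope classical_set_scope.
Local Open Scope ring_scope.
Local Open Scope complex_scope.
Import Normc.

(** Write F = f \o g, c = - alpha / (1 - alpha), r = t - a, and let
K(s) = E_alpha(c s^alpha), with derivative k on ]0, +oo[.

Differentiation.  The kernel satisfies K(0) = 1 and k(s) = O(s^(alpha - 1)) at 0,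
so that K(T - x) - 1 is the integral of k(y - x) over x < y < T.  By Fubini, the
integral of F(x) K(T - x) over ]a, T[ is the integral over ]a, T[ of
F(y) + V(y), where V(y) is the integral of F(x) k(y - x) over ]a, y[
([volterra_fubini]).  Both F and V are continuous at t, hence the derivative
at t exists and is F(t) + V(t) ([volterra_derive]).

Expansion.  Let F_n be the Taylor coefficients of F at t, and
k(s) = sum_m k_m s^(alpha m - 1).  Termwise integration gives
  V(t) = sum_m k_m sum_n F_n (-1)^n r^(n + alpha m) / (n + alpha m)
([volterra_conv_series]).  The terms with n = 0 add up to
(K(r) - 1) F(t), which turns F(t) into K(r) F(t).  In the others, the functional
equation of Gamma gives
  k_m (-1)^n / (n + alpha m) = c^m binom(- m alpha, n) n! / Gamma(n + m alpha + 1)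
([gbinom_Gamma]), and n! F_n is the n-th derivative of f \o g at t, which the
formula of Faà di Bruno expresses through those of f and g ([derive1n_comp]).
For m = 0 both sides vanish because n >= 1.

Convergence.  The interval ]a, t[ is a radius of a disc of convergence of the
Taylor series at t, and F may be singular at a, so sum |F_n| r^n may diverge.
What the termwise integration needs is only that
sum |F_n| r^n / (n + 1) is finite ([summable_div]), and this is where the form
F(x) = x^lambda eta(x) enters.  If r <= |t|, the coefficients of x^lambda are
those of a binomial series, and Re lambda > -1 makes sum |binom(lambda, n)| / (n + 1)
converge ([cbinom_summable]); if lambda is a natural number they are finitely
many.  The factor eta is analytic around every point of the closed disc of
centre t and radius r, so its Taylor series at t converges in a larger disc
([expands_disc]), and the Cauchy product with an absolutely summable series
preserves the finiteness of the weighted sum ([summable_div_cauchy_prod]).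

That theorem on analytic functions is proved without contour integrals.  Averaging
a power series over roots of unity yields Cauchy's estimate
([cauchy_estimate]); applied to all the derivatives at once it enlarges a disc of
convergence by the uniform radius that compactness provides ([expands_step]). *)

(** * Absolutely convergent double series *)

Section series_lemmas.
Context {R : realType}.
Implicit Types (u v : nat -> R) (a : nat -> nat -> R) (l M : R).

Lemma series_le_nondecr u : (forall n, 0 <= u n) ->
  {homo series u : n m / (n <= m)%N >-> n <= m}.
Proof.
move=> u0 n m nm; rewrite /series /= (@big_cat_nat _ _ _ n 0 m)//= lerDl.
by rewrite sumr_ge0.
Qed.

Lemma is_cvg_series_bounded u M : (forall n, 0 <= u n) ->
  (forall N, series u N <= M) -> cvgn (series u).
Proof.
move=> u0 uM; apply: nondecreasing_is_cvgn; first exact: series_le_nondecr.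
by exists M => _ [N _ <-].
Qed.

Lemma is_cvg_series_abs_bounded u M :
  (forall N, \sum_(0 <= n < N) `|u n| <= M) -> cvgn (series u).
Proof.
move=> uM; apply: normed_cvg; apply: (@is_cvg_series_bounded _ M) => //.
by move=> n /=.
Qed.

Lemma limn_le_bound u l M : u @ \oo --> l -> (forall N, u N <= M) -> l <= M.
Proof.
move=> ul uM; rewrite -(cvg_lim _ ul)//; apply: limr_le; first by apply/cvg_ex; exists l.
by near=> n.
Unshelve. all: by end_near. Qed.

Lemma limn_norm_le u l M : u @ \oo --> l -> (forall N, `|u N| <= M) -> `|l| <= M.
Proof. by move=> ul uM; apply: (limn_le_bound (cvg_norm ul)). Qed.

(** Square partial sums of |a i j| are monotone and bounded, and the sum of N rows
(or columns) differs from the square sum of side N by at most the missing mass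
of the absolute square sums; so rows, columns and squares share one limit. *)
Lemma series_exchange a M :
  (forall N, \sum_(0 <= i < N) \sum_(0 <= j < N) `|a i j| <= M) ->
  exists S r s, [/\ forall i, series (a i) @ \oo --> (r i : R),
    forall j, series (a ^~ j) @ \oo --> (s j : R),
    series r @ \oo --> (S : R) & series s @ \oo --> (S : R)].
Proof.
move=> aM.
pose sq (b : nat -> nat -> R) N := \sum_(0 <= i < N) \sum_(0 <= j < N) b i j.
pose A := sq (fun i j => `|a i j|).
have sqC b N : sq (fun i j => b j i) N = sq b N by rewrite /sq exchange_big.
have rect (b : nat -> nat -> R) N J : (forall i j, 0 <= b i j) -> (N <= J)%N ->
    \sum_(0 <= i < N) \sum_(N <= j < J) b i j <= sq b J - sq b N.
  move=> b0 NJ; rewrite lerBrDl /sq -big_split /=.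
  under eq_bigr do rewrite -big_cat_nat//.
  rewrite [leRHS](@big_cat_nat _ _ _ N 0 J)//= lerDl.
  by apply: sumr_ge0 => i _; apply: sumr_ge0.
have A_nd : {homo A : n m / (n <= m)%N >-> n <= m}.
  move=> n m nm; rewrite -subr_ge0 (le_trans _ (rect _ _ _ _ nm))//.
  by apply: sumr_ge0 => i _; apply: sumr_ge0.
have A_cvg : cvgn A.
  by apply: nondecreasing_is_cvgn => //; exists M => _ [N _ <-]; exact: aM.
have A_le := nondecreasing_cvgn_le A_nd A_cvg.
have rows (b : nat -> nat -> R) :
    (forall N, sq (fun i j => `|b i j|) N = A N) ->
    exists r : nat -> R, (forall i, series (b i) @ \oo --> r i) /\
    forall N, `|series r N - sq b N| <= limn A - A N.
  move=> bA.
  have row i : cvgn (series (b i)).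
    apply: (@is_cvg_series_abs_bounded _ (limn A)) => N.
    pose m := maxn i.+1 N.
    rewrite (le_trans _ (A_le m))// -bA /sq.
    rewrite (@big_cat_nat _ _ _ i.+1 0 m) ?leq_max ?leqnn//= ler_wpDr//.
      by apply: sumr_ge0 => k _; apply: sumr_ge0.
    rewrite big_nat_recr//= ler_wpDl//.
      by apply: sumr_ge0 => k _; apply: sumr_ge0.
    rewrite (@big_cat_nat _ _ _ N 0 m) ?leq_max ?leqnn ?orbT//= ler_wpDr//.
    exact: sumr_ge0.
  exists (fun i => limn (series (b i))); split => // N.
  (* The columns beyond N, cut at N + J, before J tends to infinity. *)
  pose T J := \sum_(0 <= i < N) series (b i) (N + J)%N - sq b N.
  apply: (@limn_norm_le T).
    apply: cvgB; last exact: cvg_cst.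
    apply: cvg_big => [|i _]; first exact: add_continuous.
    have := row i; rewrite -(cvg_shiftn N) => h; apply: cvg_trans h; apply: near_eq_cvg; near=> k; by rewrite /= addnC.
  move=> J; rewrite /T /sq -sumrB.
  rewrite (eq_bigr (fun i => \sum_(N <= j < N + J) b i j)); last first.
    move=> i _; rewrite /series/= (@big_cat_nat _ _ _ N 0 (N + J))//= ?leq_addr//.
    by rewrite addrAC subrr add0r.
  rewrite (le_trans (ler_norm_sum _ _ _))//.
  rewrite (le_trans (y := \sum_(0 <= i < N) \sum_(N <= j < N + J) `|b i j|))//.
    by apply: ler_sum => i _; exact: ler_norm_sum.
  rewrite (le_trans (rect _ _ _ _ (leq_addr J N)))//.
  by rewrite !bA lerD2r.
have A0 : limn A - A N @[N --> \oo] --> 0.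
  by rewrite -(subrr (limn A)); apply: cvgB => //; exact: cvg_cst.
have sq_cvg : cvgn (sq a).
  (* A difference of two monotone bounded sequences. *)
  have -> : sq a = (fun N => sq (fun i j => a i j + `|a i j|) N - A N).
    apply/funext => N; rewrite /A /sq -sumrB; apply: eq_bigr => i _.
    by rewrite -sumrB; apply: eq_bigr => j _; rewrite addrK.
  apply: is_cvgB => //; apply: nondecreasing_is_cvgn.
    have p0 i j : 0 <= a i j + `|a i j| by rewrite -lerBlDl sub0r ler_normr lexx orbT.
    move=> n m nm; rewrite -subr_ge0 (le_trans _ (rect _ _ _ p0 nm))//.
    by apply: sumr_ge0 => i _; apply: sumr_ge0.
  exists (M + M) => _ [N _ <-].
  apply: (le_trans _ (lerD (aM N) (aM N))); rewrite -big_split/=.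
  by apply: ler_sum => i _; rewrite -big_split/=; apply: ler_sum => j _; rewrite lerD2r ler_norm.
have [r [rP rA]] := rows a (fun=> erefl).
have [|s [sP sA]] := rows (fun i j => a j i).
  by move=> N; exact: (sqC (fun i j => `|a i j|)).
exists (limn (sq a)), r, s; split => //.
  have -> : series r = (fun N => (series r N - sq a N) + sq a N).
    by apply/funext => N; rewrite subrK.
  rewrite -[X in _ --> X]add0r; apply: cvgD => //.
  apply/norm_cvg0P; apply: squeeze_cvgr A0; last exact: cvg_cst.
  by near=> N; rewrite normr_ge0 rA.
have -> : series s = (fun N => (series s N - sq (fun i j => a j i) N) + sq a N).
  by apply/funext => N; rewrite sqC subrK.
rewrite -[X in _ --> X]add0r; apply: cvgD => //.
apply/norm_cvg0P; apply: squeeze_cvgr A0; last exact: cvg_cst.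
by near=> N; rewrite normr_ge0 sA.
Unshelve. all: by end_near. Qed.

End series_lemmas.

(** * Complex series *)

Section modulus.
Context {R : realType}.
Implicit Types z w : R[i].

Lemma normc_ge0 z : 0 <= normc z.
Proof. by case: z => x y; exact: sqrtr_ge0. Qed.

Lemma normcD z w : normc (z + w) <= normc z + normc w.
Proof. exact: le_normcD. Qed.

Lemma normc_sum I (s : seq I) (P : pred I) (F : I -> R[i]) :
  normc (\sum_(i <- s | P i) F i) <= \sum_(i <- s | P i) normc (F i).
Proof.
elim/big_ind2 : _ => //; first by rewrite normc0.
by move=> z x w y zx wy; rewrite (le_trans (normcD _ _))// lerD.
Qed.

Lemma normcX z n : normc (z ^+ n) = normc z ^+ n.
Proof. by elim: n => [|n IH]; rewrite ?expr0 ?normc1// !exprS normcM IH. Qed.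

Lemma normc_real (x : R) : normc x%:C = `|x|.
Proof. by rewrite /= expr0n addr0 sqrtr_sqr. Qed.

Lemma normc_nat n : normc (n%:R : R[i]) = n%:R.
Proof. by rewrite -(rmorph_nat (real_complex R)) normc_real normr_nat. Qed.

Lemma normc_eq0 z : (normc z == 0) = (z == 0).
Proof.
by apply/eqP/eqP => [/eq0_normc//|->]; rewrite normc0.
Qed.

Lemma Re_le_normc z : `|complex.Re z| <= normc z.
Proof.
case: z => x y /=; rewrite -sqrtr_sqr ler_sqrt ?addr_ge0 ?sqr_ge0//.
by rewrite lerDl sqr_ge0.
Qed.

Lemma Im_le_normc z : `|complex.Im z| <= normc z.
Proof.
case: z => x y /=; rewrite -sqrtr_sqr ler_sqrt ?addr_ge0 ?sqr_ge0//.
by rewrite lerDr sqr_ge0.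
Qed.

Lemma normc_le_ReIm z : normc z <= `|complex.Re z| + `|complex.Im z|.
Proof.
have i1 : normc 'i%C = 1 :> R by rewrite /= expr0n expr1n add0r sqrtr1.
rewrite {1}(complexE z) (le_trans (normcD _ _))//.
by rewrite normcM !normc_real i1 mul1r.
Qed.

Lemma ReD z w : complex.Re (z + w) = complex.Re z + complex.Re w.
Proof. by case: z; case: w. Qed.
Lemma ImD z w : complex.Im (z + w) = complex.Im z + complex.Im w.
Proof. by case: z; case: w. Qed.
Lemma ReB z w : complex.Re (z - w) = complex.Re z - complex.Re w.
Proof. by case: z; case: w. Qed.
Lemma ImB z w : complex.Im (z - w) = complex.Im z - complex.Im w.
Proof. by case: z; case: w. Qed.
Lemma ReM z w : complex.Re (z * w) =
  complex.Re z * complex.Re w - complex.Im z * complex.Im w.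
Proof. by case: z; case: w. Qed.
Lemma ImM z w : complex.Im (z * w) =
  complex.Re z * complex.Im w + complex.Im z * complex.Re w.
Proof. by case: z => a b; case: w => c d. Qed.
Lemma ReMr z (x : R) : complex.Re (z * x%:C) = complex.Re z * x.
Proof. by rewrite ReM/= mulr0 subr0. Qed.
Lemma ImMr z (x : R) : complex.Im (z * x%:C) = complex.Im z * x.
Proof. by rewrite ImM/= mulr0 add0r. Qed.
Lemma Re_sum I (s : seq I) (P : pred I) (F : I -> R[i]) :
  complex.Re (\sum_(i <- s | P i) F i) = \sum_(i <- s | P i) complex.Re (F i).
Proof. by apply: (big_morph _ ReD). Qed.
Lemma Im_sum I (s : seq I) (P : pred I) (F : I -> R[i]) :
  complex.Im (\sum_(i <- s | P i) F i) = \sum_(i <- s | P i) complex.Im (F i).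
Proof. by apply: (big_morph _ ImD). Qed.
Lemma complex_ext z w : complex.Re z = complex.Re w ->
  complex.Im z = complex.Im w -> z = w.
Proof. by case: z => a b; case: w => c d /= -> ->. Qed.

End modulus.

Section csums.
Context {R : realType}.
Implicit Types (u v : nat -> R[i]) (l : R[i]) (M : R).

(** The statement concerns the topology that the modulus induces on R[i]; everything
below works with real and imaginary parts. *)
Lemma cvg_complexP u l :
  ((u : nat -> R[i]^o) @ \oo --> (l : R[i]^o)) <->
  (complex.Re (u n) @[n --> \oo] --> complex.Re l /\ complex.Im (u n) @[n --> \oo] --> complex.Im l).
Proof.
split.
  move=> /cvgrPdist_le ul; split; apply/cvgrPdist_le => e e0.
    have := ul e%:C; rewrite ltcR => /(_ e0) ule; near=> n.
    have : `|l - u n| <= e%:C by near: n.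
    rewrite lecR => h; apply: le_trans h; rewrite /= -ReB; exact: Re_le_normc.
  have := ul e%:C; rewrite ltcR => /(_ e0) ule; near=> n.
  have : `|l - u n| <= e%:C by near: n.
  rewrite lecR => h; apply: le_trans h; rewrite /= -ImB; exact: Im_le_normc.
move=> [/cvgrPdist_le ur /cvgrPdist_le ui]; apply/cvgrPdist_le => -[e e'].
rewrite ltcE/= => /andP[/eqP-> e0]; near=> n.
rewrite lecR (le_trans (normc_le_ReIm _))// (splitr e) lerD// ?ReB ?ImB.
  by near: n; apply: ur; rewrite divr_gt0.
by near: n; apply: ui; rewrite divr_gt0.
Unshelve. all: by end_near. Qed.

(** Convergence of a complex series by components, so that the real theory
applies; [csumsP] relates it to the topology of the modulus. *)
Definition csums u l :=
  series (fun n => complex.Re (u n)) @ \oo --> complex.Re l /\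
  series (fun n => complex.Im (u n)) @ \oo --> complex.Im l.

Lemma csumsP u l :
  csums u l <-> ((fun N => \sum_(0 <= n < N) u n : R[i]^o) @ \oo --> (l : R[i]^o)).
Proof.
rewrite cvg_complexP /csums /series /=.
have -> : (fun N => complex.Re (\sum_(0 <= n < N) u n)) =
    (fun N => \sum_(0 <= n < N) complex.Re (u n)).
  by apply/funext => N; rewrite Re_sum.
have -> : (fun N => complex.Im (\sum_(0 <= n < N) u n)) =
    (fun N => \sum_(0 <= n < N) complex.Im (u n)) => //.
by apply/funext => N; rewrite Im_sum.
Qed.

Lemma csums_uniq u l l' : csums u l -> csums u l' -> l = l'.
Proof.
move=> [r i] [r' i']; apply: complex_ext.
- by rewrite -(cvg_lim _ r)// (cvg_lim _ r').
- by rewrite -(cvg_lim _ i)// (cvg_lim _ i').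
Qed.

Lemma csumsB u v l m : csums u l -> csums v m -> csums (fun n => u n - v n) (l - m).
Proof.
move=> [ur ui] [vr vi]; split.
  have -> : series (fun n => complex.Re (u n - v n)) =
    series (fun n => complex.Re (u n)) \- series (fun n => complex.Re (v n)).
    by apply/funext => N; rewrite /series/= -sumrB; apply: eq_bigr => i _; rewrite ReB.
  by rewrite ReB; exact: cvgB.
have -> : series (fun n => complex.Im (u n - v n)) =
    series (fun n => complex.Im (u n)) \- series (fun n => complex.Im (v n)).
  by apply/funext => N; rewrite /series/= -sumrB; apply: eq_bigr => i _; rewrite ImB.
by rewrite ImB; exact: cvgB.
Qed.

Lemma csumsZ k u l : csums u l -> csums (fun n => k * u n) (k * l).
Proof.
move=> [ur ui]; split.
  have -> : series (fun n => complex.Re (k * u n)) = (fun N =>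
      complex.Re k * series (fun n => complex.Re (u n)) N
      - complex.Im k * series (fun n => complex.Im (u n)) N).
    apply/funext => N; rewrite /series/= !mulr_sumr -sumrB.
    by apply: eq_bigr => i _; rewrite ReM.
  by rewrite ReM; apply: cvgB; apply: cvgMr.
have -> : series (fun n => complex.Im (k * u n)) = (fun N =>
      complex.Re k * series (fun n => complex.Im (u n)) N
      + complex.Im k * series (fun n => complex.Re (u n)) N).
  apply/funext => N; rewrite /series/= !mulr_sumr -big_split/=.
  by apply: eq_bigr => i _; rewrite ImM.
by rewrite ImM; apply: cvgD; apply: cvgMr.
Qed.

Lemma csums_abs u M : (forall N, \sum_(0 <= n < N) normc (u n) <= M) ->
  exists l, csums u l.
Proof.
move=> uM.
have /cvg_ex[/= r ur] : cvgn (series (fun n => complex.Re (u n))).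
  apply: (@is_cvg_series_abs_bounded _ _ M) => N; apply: le_trans (uM N).
  by apply: ler_sum => n _; exact: Re_le_normc.
have /cvg_ex[/= i ui] : cvgn (series (fun n => complex.Im (u n))).
  apply: (@is_cvg_series_abs_bounded _ _ M) => N; apply: le_trans (uM N).
  by apply: ler_sum => n _; exact: Im_le_normc.
by exists (r +i* i).
Qed.

Lemma csums_le u l M : csums u l ->
  (forall N, normc (\sum_(0 <= n < N) u n) <= M) -> normc l <= M.
Proof.
move=> /csumsP/cvg_norm ul uM.
have /cvg_complexP[/= + _] := ul => /limn_le_bound; apply => N.
exact: uM.
Qed.

Lemma csums_abs_le u l M : csums u l ->
  (forall N, \sum_(0 <= n < N) normc (u n) <= M) -> normc l <= M.
Proof.
move=> ul uM; apply: (csums_le ul) => N; apply: le_trans (uM N).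
exact: normc_sum.
Qed.

Lemma csums_finite u n : (forall k, (n <= k)%N -> u k = 0) ->
  csums u (\sum_(0 <= k < n) u k).
Proof.
move=> u0; apply/csumsP; apply: cvg_near_cst; near=> N.
rewrite (@big_cat_nat _ _ _ n 0 N)//=; last by near: N; exists n.
by rewrite [X in _ + X]big_nat [X in _ + X]big1 ?addr0// => k /andP[nk _]; rewrite u0.
Unshelve. all: by end_near. Qed.

Lemma csums_shift k u l : (forall n, (n < k)%N -> u n = 0) ->
  csums (fun n => u (n + k)%N) l <-> csums u l.
Proof.
move=> u0; rewrite !csumsP.
have -> : (fun N => \sum_(0 <= n < N) u (n + k)%N) =
    [sequence \sum_(0 <= n < m + k) u n]_m.
  apply/funext => N /=; rewrite (@big_cat_nat _ _ _ k 0 (N + k)) ?leq_addl//=.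
  rewrite [X in X + _]big_nat [X in X + _]big1 ?add0r.
    by rewrite -{2}[k]add0n big_addn addnK.
  by move=> n /= nk; rewrite u0.
by rewrite (cvg_shiftn k (fun N => \sum_(0 <= n < N) u n : R[i]^o)).
Qed.

Lemma csums_exchange (a : nat -> nat -> R[i]) M (r s : nat -> R[i]) S :
  (forall N, \sum_(0 <= i < N) \sum_(0 <= j < N) normc (a i j) <= M) ->
  (forall i, csums (a i) (r i)) -> (forall j, csums (a ^~ j) (s j)) ->
  csums r S -> csums s S.
Proof.
move=> aM ar as_ [rSr rSi]; split.
  have [|X [x [y [H1 H2 H3 H4]]]] := @series_exchange _ (fun i j => complex.Re (a i j)) M.
    move=> N; apply: le_trans (aM N); apply: ler_sum => i _; apply: ler_sum => j _.
    exact: Re_le_normc.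
  have e1 : (fun i => complex.Re (r i)) = x.
    by apply/funext => i; have [h _] := ar i; rewrite -(cvg_lim _ h)// (cvg_lim _ (H1 i)).
  have e2 : (fun i => complex.Re (s i)) = y.
    by apply/funext => i; have [h _] := as_ i; rewrite -(cvg_lim _ h)// (cvg_lim _ (H2 i)).
  rewrite e2; have -> : complex.Re S = X => //.
  by rewrite -(cvg_lim _ rSr)// e1 (cvg_lim _ H3).
have [|X [x [y [H1 H2 H3 H4]]]] := @series_exchange _ (fun i j => complex.Im (a i j)) M.
  move=> N; apply: le_trans (aM N); apply: ler_sum => i _; apply: ler_sum => j _.
  exact: Im_le_normc.
have e1 : (fun i => complex.Im (r i)) = x.
  by apply/funext => i; have [_ h] := ar i; rewrite -(cvg_lim _ h)// (cvg_lim _ (H1 i)).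
have e2 : (fun i => complex.Im (s i)) = y.
  by apply/funext => i; have [_ h] := as_ i; rewrite -(cvg_lim _ h)// (cvg_lim _ (H2 i)).
rewrite e2; have -> : complex.Im S = X => //.
by rewrite -(cvg_lim _ rSi)// e1 (cvg_lim _ H3).
Qed.

(** A single column of a summable double array is summable, since it is contained
in the large squares. *)
Lemma csums_exchange_col (a : nat -> nat -> R[i]) M j :
  (forall N, \sum_(0 <= i < N) \sum_(0 <= j < N) normc (a i j) <= M) ->
  forall N, \sum_(0 <= i < N) normc (a i j) <= M.
Proof.
move=> aM N; pose m := maxn j.+1 N.
rewrite (le_trans _ (aM m))// exchange_big/=.
rewrite (@big_cat_nat _ _ _ j.+1 0 m) ?leq_max ?leqnn//= ler_wpDr//.
  by apply: sumr_ge0 => k _; apply: sumr_ge0 => i _; exact: normc_ge0.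
rewrite big_nat_recr//= ler_wpDl//.
  by apply: sumr_ge0 => k _; apply: sumr_ge0 => i _; exact: normc_ge0.
rewrite (@big_cat_nat _ _ _ N 0 m) ?leq_max ?leqnn ?orbT//= ler_wpDr//.
by apply: sumr_ge0 => i _; exact: normc_ge0.
Qed.

Lemma csums_exchange_ex (a : nat -> nat -> R[i]) M :
  (forall N, \sum_(0 <= i < N) \sum_(0 <= j < N) normc (a i j) <= M) ->
  forall j, exists l, csums (a ^~ j) l.
Proof.
by move=> aM j; apply: (@csums_abs _ M); exact: csums_exchange_col.
Qed.

End csums.

(** * Re-expansion of a power series *)

Section power_series.
Context {R : realType}.
Implicit Types (c e : nat -> R[i]) (eta : R[i] -> R[i]) (w h z l : R[i]) (r s q rho K M : R).

Lemma geometric_sum_le (x : R) N : 0 <= x < 1 -> \sum_(0 <= n < N) x ^+ n <= (1 - x)^-1.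
Proof.
move=> /andP[x0 x1]; rewrite big_mkord -[leRHS]mul1r ler_pdivlMr ?subr_gt0//.
by rewrite mulrC -opprB mulNr -subrX1 opprB lerBlDr lerDl exprn_ge0.
Qed.

(** Comparison with a geometric series: bounded terms at rho give absolute
summability at every r < rho, with an explicit bound. *)
Lemma abs_power_series_le c r rho M : 0 <= r < rho ->
  (forall n, normc (c n) * rho ^+ n <= M) ->
  forall N, \sum_(0 <= n < N) normc (c n) * r ^+ n <= M / (1 - r / rho).
Proof.
move=> /andP[r0 rrho] cM N; have rho0 : 0 < rho by exact: le_lt_trans rrho.
have M0 : 0 <= M.
  by apply: le_trans (cM 0%N); rewrite mulr_ge0 ?normc_ge0 ?exprn_ge0// ltW.
apply: (@le_trans _ _ (\sum_(0 <= n < N) M * (r / rho) ^+ n)).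
  apply: ler_sum => n _; rewrite expr_div_n mulrA mulrAC ler_wpM2r ?exprn_ge0//.
  by rewrite ler_pdivlMr ?exprn_gt0.
rewrite -mulr_sumr ler_wpM2l// geometric_sum_le// divr_ge0 ?(ltW rho0)//=.
by rewrite ltr_pdivrMr// mul1r.
Qed.

Lemma csums_bounded (u : nat -> R[i]) l : csums u l ->
  exists M, forall n, normc (u n) <= M.
Proof.
move=> [ur ui].
have [Mr [_ br]] : bounded_fun (fun n => complex.Re (u n)).
  by apply: cvg_series_bounded; apply/cvg_ex; exists (complex.Re l).
have [Mi [_ bi]] : bounded_fun (fun n => complex.Im (u n)).
  by apply: cvg_series_bounded; apply/cvg_ex; exists (complex.Im l).
exists ((Mr + 1) + (Mi + 1)) => n; apply: (le_trans (normc_le_ReIm _)).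
by rewrite lerD// ?(br (Mr + 1))// ?(bi (Mi + 1))// ltrDl.
Qed.

(** Row n of this array expands c n * (|w| + |h|) ^ n, so the squares are controlled
by the absolute series at |w| + |h|. *)
Lemma binomial_rows_le c w h K N :
  (forall N, \sum_(0 <= n < N) normc (c n) * (normc w + normc h) ^+ n <= K) ->
  \sum_(0 <= n < N) \sum_(0 <= k < N)
     normc (c n *+ 'C(n, k) * w ^+ (n - k) * h ^+ k) <= K.
Proof.
move=> cK; apply: le_trans (cK N); rewrite !big_nat; apply: ler_sum => n /= nN.
rewrite exprDn mulr_sumr (@big_cat_nat _ _ _ n.+1 0 N)//=.
rewrite [X in _ + X]big_nat [X in _ + X]big1 ?addr0; last first.
  by move=> k /andP[nk _]; rewrite bin_small// mulr0n !mul0r normc0.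
rewrite big_mkord; apply: ler_sum => k _.
rewrite !normcM !normcX -[c n *+ _]mulr_natr normcM normc_nat.
by rewrite -[in leRHS]mulr_natr -!mulrA ler_wpM2l ?normc_ge0// mulrC -mulrA.
Qed.

(** The binomial theorem and an exchange of summations move the centre of a power
series from 0 to w.  The bounds on the new coefficients depend only on q, s and K;
this uniformity in w is what the enlargement of a disc relies on. *)
Lemma reexpand c q s K w : 0 < s -> normc w <= q ->
  (forall N, \sum_(0 <= n < N) normc (c n) * (q + s) ^+ n <= K) ->
  exists e, [/\ forall k, csums (fun n => c n *+ 'C(n, k) * w ^+ (n - k)) (e k),
    forall k, normc (e k) * s ^+ k <= K &
    forall h l, normc h <= s -> csums (fun n => c n * (w + h) ^+ n) l ->
       csums (fun k => e k * h ^+ k) l].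
Proof.
move=> s0 wq cK.
have cKh h : normc h <= s -> forall N,
    \sum_(0 <= n < N) normc (c n) * (normc w + normc h) ^+ n <= K.
  move=> hs N; apply: le_trans (cK N); apply: ler_sum => n _.
  rewrite ler_wpM2l ?normc_ge0// lerXn2r ?nnegrE ?addr_ge0 ?normc_ge0 ?lerD//.
    by rewrite (le_trans (normc_ge0 w)).
  exact: ltW.
have ns : normc s%:C = s by rewrite normc_real ger0_norm// ltW.
have sn0 k : s%:C ^+ k != 0.
  by rewrite -normc_eq0 normcX ns expf_neq0// gt_eqF.
have col k : exists l, csums (fun n => c n *+ 'C(n, k) * w ^+ (n - k)) l.
  have [|l le] := @csums_exchange_ex _
      (fun n k => c n *+ 'C(n, k) * w ^+ (n - k) * s%:C ^+ k) K _ k.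
    by move=> N; apply: binomial_rows_le; apply: cKh; rewrite ns.
  exists ((s%:C ^+ k)^-1 * l); have := csumsZ (s%:C ^+ k)^-1 le.
  by congr (csums _ _); apply/funext => n; rewrite mulrC mulfK.
have [e eP] := choice col; exists e; split => //.
  move=> k; rewrite -{1}ns -normcX -normcM.
  have /csums_abs_le := csumsZ (s%:C ^+ k) (eP k).
  rewrite mulrC; apply => N.
  under eq_bigr do rewrite mulrC.
  apply: (@csums_exchange_col _
    (fun n k => c n *+ 'C(n, k) * w ^+ (n - k) * s%:C ^+ k) K k) => {}N.
  by apply: binomial_rows_le; apply: cKh; rewrite ns.
move=> h l hs cl.
apply: (@csums_exchange _ (fun n k => c n *+ 'C(n, k) * w ^+ (n - k) * h ^+ k)
    K (fun n => c n * (w + h) ^+ n) _ l) => //.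
- by move=> N; apply: binomial_rows_le; exact: cKh.
- move=> n; rewrite exprDn mulr_sumr.
  have -> : \sum_(i < n.+1) c n * (w ^+ (n - i) * h ^+ i *+ 'C(n, i)) =
      \sum_(0 <= k < n.+1) c n *+ 'C(n, k) * w ^+ (n - k) * h ^+ k.
    rewrite big_mkord; apply: eq_bigr => k _.
    by rewrite -mulr_natr -[c n *+ _]mulr_natr; move: (w ^+ _) (h ^+ _) => x y; ring.
  by apply: csums_finite => k nk; rewrite bin_small// mulr0n !mul0r.
- move=> k; have := csumsZ (h ^+ k) (eP k); rewrite mulrC.
  by congr (csums _ _); apply/funext => n; rewrite mulrC.
Qed.

End power_series.

(** * Cauchy's estimate *)

Section cauchy_estimate.
Context {R : realType}.
Implicit Types (c e : nat -> R[i]) (eta : R[i] -> R[i]) (w h z l : R[i]) (r s q rho K M : R).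

(** The polynomial X^n - 1 splits and is separable over R[i], so its n roots
contain a primitive one. *)
Lemma complex_prim_root n : (0 < n)%N -> {w : R[i] | n.-primitive_root w}.
Proof.
move=> n0; have n0R : n%:R != 0 :> R[i] by rewrite pnatr_eq0 -lt0n.
have [rs rsE] := closed_field_poly_normal ('X^n - 1 : {poly R[i]}).
have lc : lead_coef ('X^n - 1 : {poly R[i]}) = 1 by rewrite lead_coefXnsubC.
rewrite lc scale1r in rsE.
have urs : uniq rs by rewrite -separable_prod_XsubC -rsE separable_Xn_sub_1.
have szrs : size rs = n.
  by have := size_XnsubC (1 : R[i]) n0; rewrite rsE size_prod_XsubC => -[].
have /hasP/sig2W[w _ wP] : has n.-primitive_root rs.
  apply: has_prim_root => //; last by rewrite szrs.
  by apply/allP => z zrs; rewrite /root_of_unity rsE root_prod_XsubC.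
by exists w.
Qed.

Lemma sum_prim_root_pow n w k : n.-primitive_root w ->
  \sum_(0 <= j < n) (w ^+ j) ^+ k = if (n %| k)%N then n%:R else 0.
Proof.
move=> wP; rewrite (eq_bigr (fun j => (w ^+ k) ^+ j)); last by move=> j _; rewrite exprAC.
have [nk|nk] := boolP (n %| k)%N.
  have /eqP-> : w ^+ k == 1 by rewrite -(prim_order_dvd wP).
  rewrite (eq_bigr (fun=> 1)); last by move=> j _; rewrite expr1n.
  by rewrite big_const_nat iter_addr_0 subn0.
apply/eqP; have /mulfI : w ^+ k - 1 != 0 by rewrite subr_eq0 -(prim_order_dvd wP).
by move=> I; apply/eqP/I; rewrite mulr0 big_mkord -subrX1 exprAC (prim_expr_order wP) expr1n subrr.
Qed.

Lemma normc_prim_root n w : n.-primitive_root w -> normc w = 1.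
Proof.
move=> wP; apply/eqP; rewrite -(@pexpr_eq1 _ _ n) ?normc_ge0//.
  by rewrite -normcX (prim_expr_order wP) normc1.
exact: prim_order_gt0 wP.
Qed.

(** Cauchy criterion for series with nonnegative terms, with an explicit rank. *)
Lemma series_tail_le (u : nat -> R) K : (forall n, 0 <= u n) ->
  (forall N, \sum_(0 <= n < N) u n <= K) -> forall e : R, 0 < e ->
  exists N0, forall N N', (N0 <= N)%N -> \sum_(N <= n < N') u n <= e.
Proof.
move=> u0 uK e e0.
have uc : cvgn (series u) by exact: (@is_cvg_series_bounded _ _ K).
have le := nondecreasing_cvgn_le (series_le_nondecr u0) uc.
have /cvgrPdist_le/(_ _ e0)[N0 _ N0P] := uc.
exists N0 => N N' N0N.
have [NN'|N'N] := leqP N N'; last by rewrite big_geq ?(ltW e0)// ltnW.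
have -> : \sum_(N <= n < N') u n = series u N' - series u N.
  by rewrite /series/= (@big_cat_nat _ _ _ N 0 N')//= addrAC subrr add0r.
have := N0P N N0N; rewrite ler_norml => /andP[_]; apply: le_trans.
by rewrite lerD2r.
Qed.

(** Averaging p(z_j) * w^(-jm) over the N points z_j = rho w^j of a circle, for a
primitive N-th root of unity w and N > m, isolates the coefficient of index m
of a polynomial p of degree below N.  A power series is, up to e, such a
polynomial uniformly on the circle, so no integral is needed. *)
Lemma cauchy_estimate c rho K M : 0 < rho ->
  (forall N, \sum_(0 <= n < N) normc (c n) * rho ^+ n <= K) ->
  (forall z l, normc z = rho -> csums (fun n => c n * z ^+ n) l -> normc l <= M) ->
  forall m, normc (c m) * rho ^+ m <= M.
Proof.
move=> rho0 cK cM m; apply/ler_addgt0Pr => e e0.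
have [|N0 N0P] := series_tail_le _ cK e0.
  by move=> n; rewrite mulr_ge0 ?normc_ge0 ?exprn_ge0// ltW.
(* N > m for the averaging, N >= N0 for a truncation error at most e on the circle. *)
pose N := (maxn N0 m.+1).
have mN : (m < N)%N by rewrite leq_max leqnn orbT.
have N_gt0 : (0 < N)%N by exact: leq_ltn_trans mN.
have [w wP] := complex_prim_root N_gt0.
have nw := normc_prim_root wP.
pose z j := rho%:C * w ^+ j.
have nz j : normc (z j) = rho.
  by rewrite normcM normcX nw expr1n mulr1 normc_real ger0_norm ?ltW.
have nzn n j : normc (c n * z j ^+ n) = normc (c n) * rho ^+ n.
  by rewrite normcM normcX nz.
have zl j : exists l, csums (fun n => c n * z j ^+ n) l.
  by apply: (@csums_abs _ _ K) => N'; under eq_bigr do rewrite nzn.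
have part j : normc (\sum_(0 <= n < N) c n * z j ^+ n) <= M + e.
  have [l lP] := zl j.
  have : normc (l - \sum_(0 <= n < N) c n * z j ^+ n) <= e.
    pose u n := if (n < N)%N then c n * z j ^+ n else 0.
    have := csumsB lP (@csums_finite _ u N _).
    have -> : \sum_(0 <= n < N) u n = \sum_(0 <= n < N) c n * z j ^+ n.
      by rewrite !big_nat; apply: eq_bigr => n /= nN; rewrite /u nN.
    move=> /(_ _)/csums_abs_le; apply.
      by move=> k Nk; rewrite /u ltnNge Nk.
    move=> N'; have [NN'|N'N] := leqP N N'.
      rewrite (@big_cat_nat _ _ _ N 0 N')//= big_nat big1 ?add0r; last first.
        by move=> n /= nN; rewrite /u nN subrr normc0.
      apply: le_trans (N0P N N' _); last by rewrite leq_max leqnn.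
      rewrite !big_nat; apply: ler_sum => n /andP[Nn _].
      by rewrite /u ltnNge Nn/= subr0 nzn.
    rewrite big_nat big1 ?ltW// => n /= nN'.
    by rewrite /u (ltn_trans nN' N'N) subrr normc0.
  move=> h; rewrite -[X in normc X](subrK l) addrC -[X in _ + X]opprB.
  rewrite (le_trans (normcD _ _))// lerD//; first exact: cM lP.
  by rewrite normcN.
(* The exponent N - m stands for - m, as w ^+ N = 1. *)
have key : (N%:R * (c m * rho%:C ^+ m)) =
    \sum_(0 <= j < N) (\sum_(0 <= n < N) c n * z j ^+ n) * (w ^+ j) ^+ (N - m).
  under [RHS]eq_bigr do rewrite mulr_suml.
  rewrite exchange_big/= (bigD1_seq m) ?mem_index_iota ?iota_uniq//=.
  have inner n : \sum_(0 <= j < N) c n * z j ^+ n * (w ^+ j) ^+ (N - m) =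
      c n * rho%:C ^+ n * (if (N %| n + (N - m))%N then N%:R else 0).
    rewrite -(sum_prim_root_pow _ wP) mulr_sumr; apply: eq_bigr => j _.
    by rewrite /z exprMn exprD !mulrA.
  rewrite inner subnKC ?(ltnW mN)// dvdnn big_seq_cond big1 ?addr0.
    by rewrite mulrC.
  move=> n; rewrite mem_index_iota /= => /andP[nN nm].
  rewrite inner; case: ifPn; last by rewrite mulr0.
  (* n + (N - m) lies strictly between 0 and 2 N, and equals N only if n = m *)
  move=> /dvdnP[[|[|k]] E]; [exfalso; lia| |exfalso; nia].
  by exfalso; move/eqP: nm; apply; lia.
have : N%:R * (normc (c m) * rho ^+ m) <= N%:R * (M + e).
  have <- : normc (N%:R * (c m * rho%:C ^+ m)) = N%:R * (normc (c m) * rho ^+ m).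
    by rewrite normcM normc_nat normcM normcX normc_real ger0_norm// ltW.
  rewrite key (le_trans (normc_sum _ _ _))//.
  rewrite (le_trans (y := \sum_(0 <= j < N) (M + e)))//.
    apply: ler_sum => j _; rewrite normcM !normcX nw !expr1n mulr1; exact: part.
  by rewrite big_const_nat iter_addr_0 subn0 mulr_natl.
by rewrite ler_pM2l ?ltr0n.
Qed.

End cauchy_estimate.

(** * Analytic functions on a closed disc *)

Section disc.
Context {R : realType}.
Implicit Types (c e : nat -> R[i]) (eta : R[i] -> R[i]) (w h z l : R[i]) (r s q rho K M : R).

(** The factor n + 1 produced by differentiation, or by counting the terms of a
diagonal, is absorbed by a slightly larger radius. *)
Lemma mulSn_exp_le (a b : R) n : 0 <= a < b ->
  n.+1%:R * a ^+ n <= b / (b - a) * b ^+ n.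
Proof.
move=> /andP[a0 ab]; have b0 : 0 < b by exact: le_lt_trans ab.
have ba0 : 0 < b - a by rewrite subr_gt0.
elim: n => [|n IH].
  by rewrite !expr0 !mulr1 ler_pdivlMr// mul1r gerBl.
have h : a ^+ n.+1 <= b ^+ n.+1 by rewrite lerXn2r ?nnegrE// ltW.
rewrite -natr1 mulrDl mul1r.
have -> : b / (b - a) * b ^+ n.+1 = a * (b / (b - a) * b ^+ n) + b ^+ n.+1.
  by rewrite exprS; field; rewrite gt_eqF.
by rewrite lerD// exprS mulrCA ler_wpM2l.
Qed.

(** The power series with coefficients e represents eta on the open disc of
centre w and radius r. *)
Definition expands eta w e r := forall h, normc h < r ->
  csums (fun n => e n * h ^+ n) (eta (w + h)).

Lemma expands_bounded eta w e r rho : expands eta w e r -> 0 <= rho < r ->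
  exists M, forall n, normc (e n) * rho ^+ n <= M.
Proof.
move=> we /andP[rho0 rhor].
have nr : normc rho%:C = rho by rewrite normc_real ger0_norm.
have [|M MP] := csums_bounded (we rho%:C _); first by rewrite nr.
by exists M => n; rewrite -{1}nr -normcX -normcM.
Qed.

Lemma expands_summable eta w e r rho : expands eta w e r -> 0 <= rho < r ->
  exists K, forall N, \sum_(0 <= n < N) normc (e n) * rho ^+ n <= K.
Proof.
move=> we /andP[rho0 rhor].
have [|M MP] := expands_bounded (rho := (rho + r) / 2) we.
  by apply/andP; split; lra.
exists (M / (1 - rho / ((rho + r) / 2))).
by apply: abs_power_series_le MP; apply/andP; split; lra.
Qed.

(** Cauchy's estimate with bound 0, applied to the difference of the two series. *)
Lemma csums_coef_inj c e s K : 0 < s ->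
  (forall N, \sum_(0 <= n < N) normc (c n) * s ^+ n <= K) ->
  (forall N, \sum_(0 <= n < N) normc (e n) * s ^+ n <= K) ->
  (forall h, normc h = s -> exists l,
     csums (fun n => c n * h ^+ n) l /\ csums (fun n => e n * h ^+ n) l) ->
  forall k, c k = e k.
Proof.
move=> s0 cK eK ce k; apply/eqP; rewrite -subr_eq0 -normc_eq0.
have := @cauchy_estimate _ (fun n => c n - e n) s (K + K) 0 s0.
move=> /(_ _ _ k) H.
have : normc (c k - e k) * s ^+ k <= 0.
  apply: H => [N|z l zs].
    apply: le_trans (lerD (cK N) (eK N)); rewrite -big_split/=.
    apply: ler_sum => n _; rewrite -mulrDl ler_wpM2r ?exprn_ge0// ?(ltW s0)//.
    by rewrite -[normc (e n)]normcN; exact: normcD.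
  have [m [h1 h2]] := ce _ zs.
  have h3 := csumsB h1 h2.
  have -> : (fun n => (c n - e n) * z ^+ n) = (fun n => c n * z ^+ n - e n * z ^+ n).
    by apply/funext => n; rewrite mulrBl.
  by move=> /(csums_uniq h3) <-; rewrite subrr normc0.
by rewrite pmulr_lle0 ?exprn_gt0// => h; rewrite eq_le h normc_ge0.
Qed.

(** At each |w| <= rho, the k-th coefficient of the local expansion is
  e_k(w) = sum_j 'C(j + k, k) c_(j+k) w^j,
a power series bounded by K / s^k.  Cauchy's estimate turns this into
'C(j + k, k) |c_(j+k)| rho^j s^k <= K, and summation over j + k = n gives
|c_n| (rho + s)^n <= (n + 1) K.  Hence the series converges for
|z| < rho + s; its sum there is eta, by re-expansion at the point w of modulus at
most rho on the segment from 0 to z. *)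
Lemma expands_step eta w0 c R0 s K rho : 0 < s -> 0 < rho < R0 ->
  expands eta w0 c R0 ->
  (forall w, normc w <= rho -> exists e, expands eta (w0 + w) e s /\
      forall k, normc (e k) * s ^+ k <= K) ->
  expands eta w0 c (rho + s).
Proof.
move=> s0 /andP[rho0 rhoR] cR loc.
have [rho' [rhorho' rho'R]] : exists rho', rho < rho' /\ rho' < R0.
  by exists ((rho + R0) / 2); split; lra.
have [|A cA] := expands_summable (rho := rho') cR; first by apply/andP; split; lra.
pose d := rho' - rho; have d0 : 0 < d by rewrite subr_gt0.
(* The given local expansion at w has the coefficients obtained by re-expansion,
   as both represent eta on a small circle. *)
have re w : normc w <= rho -> exists e, [/\ expands eta (w0 + w) e s,
    (forall k, normc (e k) * s ^+ k <= K) &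
    forall k, csums (fun n => c n *+ 'C(n, k) * w ^+ (n - k)) (e k)].
  move=> wrho; have [e [eP eK]] := loc _ wrho.
  exists e; split => // k.
  have [|e' [e'1 e'2 e'3]] := reexpand d0 wrho (K := A) (c := c).
    by rewrite addrC subrK.
  have <- : e' k = e k => //.
  pose x := Num.min d s / 2.
  have x0 : 0 < x by rewrite divr_gt0// lt_min d0 s0.
  have xd : x < d.
    by rewrite /x ltr_pdivrMr// (@le_lt_trans _ _ d)// ?ge_min ?lexx//; lra.
  have xs : x < s.
    by rewrite /x ltr_pdivrMr// (@le_lt_trans _ _ s)// ?ge_min ?lexx ?orbT//; lra.
  have [|K1 K1P] := expands_summable (rho := x) eP; first by rewrite (ltW x0).
  have K2P := abs_power_series_le (r := x) _ e'2.
  apply: (@csums_coef_inj _ _ x (Num.max K1 (A / (1 - x / d)))) => //.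
  - by move=> N; rewrite le_max K2P ?orbT// (ltW x0).
  - by move=> N; rewrite le_max K1P.
  move=> h hx; exists (eta (w0 + w + h)); split; last by apply: eP; rewrite hx.
  apply: e'3; first by rewrite hx ltW.
  rewrite -addrA; apply: cR; rewrite (le_lt_trans (normcD _ _))//.
  by rewrite hx; move: xd wrho; rewrite /d; lra.
(* Cauchy's estimate for w |-> e_k(w) on the circle of radius rho. *)
have coef k j : normc (c (j + k)%N *+ 'C(j + k, k)) * rho ^+ j * s ^+ k <= K.
  rewrite -ler_pdivlMr ?exprn_gt0//.
  have bnd : forall N, \sum_(0 <= n < N) normc (c (n + k)%N *+ 'C(n + k, k)) * rho ^+ n <= A / d ^+ k.
    move=> N; rewrite ler_pdivlMr ?exprn_gt0// mulr_suml.
    rewrite (le_trans _ (cA (N + k)%N))// (@big_cat_nat _ _ _ k 0 (N + k))/= ?leq_addl//.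
    rewrite ler_wpDl//; first by apply: sumr_ge0 => n _; rewrite mulr_ge0 ?normc_ge0 ?exprn_ge0//; lra.
    rewrite -[X in _ <= \sum_(X <= _ < _) _]add0n big_addn addnK; apply: ler_sum => n _.
    rewrite -mulr_natr normcM normc_nat -!mulrA ler_wpM2l ?normc_ge0//.
    have -> : rho' = rho + d by rewrite addrC subrK.
    have kn : (k < (n + k).+1)%N by rewrite ltnS leq_addl.
    rewrite [leRHS]exprDn (bigD1 (Ordinal kn))//= addnK.
    rewrite ler_wpDr//; last by rewrite mulr_natl.
    by apply: sumr_ge0 => i _; rewrite mulrn_wge0// mulr_ge0// exprn_ge0//; lra.
  apply: (cauchy_estimate rho0 bnd) => z l zrho zl.
  have [|e [eP eK es]] := re z; first by rewrite zrho.
  suff -> : l = e k by rewrite ler_pdivlMr ?exprn_gt0.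
  apply: (csums_uniq zl).
  have := es k; rewrite -(@csums_shift _ k).
    by congr (csums _ _); apply/funext => n; rewrite addnK.
  by move=> n nk; rewrite bin_small// mulr0n mul0r.
(* Binomial expansion of (rho + s)^n; each of its n + 1 terms is at most K. *)
have grow n : normc (c n) * (rho + s) ^+ n <= n.+1%:R * K.
  have -> : n.+1%:R * K = \sum_(k < n.+1) K by rewrite sumr_const card_ord mulr_natl.
  rewrite exprDn mulr_sumr; apply: ler_sum => k _.
  have kn : (k <= n)%N by rewrite -ltnS.
  have := coef k (n - k)%N; rewrite subnK//; apply: le_trans.
  rewrite -mulr_natr -[c n *+ _]mulr_natr normcM normc_nat.
  by move: (rho ^+ _) (s ^+ _) => x y; rewrite !mulrA -!(mulrAC _ _ 'C(n, k)%:R).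
move=> z zrs.
(* z = w + h with w and h on the ray of z, so that |z| = |w| + |h| and the absolute
   convergence at |z| allows the re-expansion at w. *)
pose w := z * (rho / (rho + s))%:C; pose h := z * (s / (rho + s))%:C.
have rs0 : 0 < rho + s by rewrite addr_gt0.
have nq (x : R) : 0 < x -> normc (z * (x / (rho + s))%:C) = normc z * (x / (rho + s)).
  by move=> x0; rewrite normcM normc_real ger0_norm// divr_ge0// ltW.
have wh : z = w + h.
  by rewrite /w /h -mulrDr -rmorphD/= -mulrDl divff ?gt_eqF// mulr1.
have wr : normc w <= rho.
  rewrite nq// mulrCA ler_piMr// ?(ltW rho0)// ler_pdivrMr// mul1r; exact: ltW.
have hs : normc h < s.
  by rewrite nq// mulrCA gtr_pMr// ltr_pdivrMr// mul1r.
have nzE : normc z = normc w + normc h.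
  by rewrite !nq// -mulrDr -mulrDl divff ?gt_eqF// mulr1.
have [e [eP eK es]] := re w wr.
have [B BP] : exists B, forall N, \sum_(0 <= n < N) normc (c n) * (normc z) ^+ n <= B.
  (* The factor n + 1 is absorbed between sg and rho + s. *)
  pose sg := (normc z + (rho + s)) / 2.
  have sg1 : normc z < sg by rewrite /sg; lra.
  have sg2 : sg < rho + s by rewrite /sg; lra.
  have z0 := normc_ge0 z.
  exists (((rho + s) / (rho + s - sg) * K) / (1 - normc z / sg)).
  apply: abs_power_series_le; first by rewrite z0.
  move=> n; have sg0 : 0 <= sg < rho + s by apply/andP; split; lra.
  have sgn := mulSn_exp_le n sg0.
  have K0 : 0 <= K.
    by have := grow 0%N; rewrite expr0 mulr1 mul1r; exact/le_trans/normc_ge0.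
  have rsn : 0 < (rho + s) ^+ n by rewrite exprn_gt0.
  rewrite -(ler_pM2r rsn) mulrAC.
  have sgn0 : 0 <= sg ^+ n by rewrite exprn_ge0//; lra.
  rewrite (le_trans (ler_wpM2r sgn0 (grow n)))//.
  by rewrite mulrAC -[leRHS]mulrAC ler_wpM2r.
have [l cl] : exists l, csums (fun n => c n * z ^+ n) l.
  by apply: (@csums_abs _ _ B) => N; under eq_bigr do rewrite normcM normcX.
suff : eta (w0 + w + h) = l by rewrite -addrA -wh => ->.
have [h0|h0] := eqVneq (normc h) 0.
  have hh : h = 0 by apply: eq0_normc.
  rewrite hh addr0; apply: (csums_uniq _ cl).
  by rewrite wh hh addr0; apply: cR; apply: le_lt_trans wr _.
have hpos : 0 < normc h by rewrite lt_def h0 normc_ge0.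
have [|e' [e'1 e'2 e'3]] := reexpand hpos (lexx (normc w)) (K := B) (c := c).
  by rewrite -nzE.
have := e'3 h l (lexx _); rewrite -wh => /(_ cl).
have -> : e' = e by apply/funext => k; exact: csums_uniq (e'1 k) (es k).
exact/csums_uniq/eP.
Qed.

End disc.

Section disc_theorem.
Context {R : realType}.
Implicit Types (c e : nat -> R[i]) (eta : R[i] -> R[i]) (w h z l : R[i]) (r s q rho K M : R).

(** One integer governs both the radius and the size of the coefficients, so that the
property becomes weaker as n grows and can be compared with a neighbourhood of
infinity. *)
Definition expands_unif eta (n : nat) w := exists e,
  expands eta w e n.+1%:R^-1 /\ forall k, normc (e k) * n.+1%:R^-1 ^+ k <= n.+1%:R.

(** Re-expansion around the points close to w0: their expansions share a radius
and a bound. *)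
Lemma expands_unif_local eta w0 c r : 0 < r -> expands eta w0 c r ->
  exists d, 0 < d /\ \forall n \near \oo,
    forall w, normc (w - w0) <= d -> expands_unif eta n w.
Proof.
move=> r0 cr.
have [|K cK] := expands_summable (rho := r / 2) cr; first by apply/andP; split; lra.
exists (r / 4); split; first by rewrite divr_gt0.
have [m1 m1P] : exists m : nat, forall n, (m <= n)%N -> n.+1%:R^-1 <= r / 4.
  exists (Num.truncn (4 / r)) => n mn.
  have h : 4 / r < n.+1%:R by rewrite (lt_le_trans (truncnS_gt _))// ler_nat.
  by rewrite -[r / 4]invrK invf_div lef_pV2 ?posrE// ?ltW// divr_gt0.
have [m2 m2P] : exists m : nat, forall n, (m <= n)%N -> K <= n.+1%:R.
  exists (Num.truncn K) => n mn.
  by rewrite ltW// (lt_le_trans (truncnS_gt _))// ler_nat.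
near=> n => w wd.
have n4 : n.+1%:R^-1 <= r / 4 by apply: m1P; near: n; exists m1.
have nK : K <= n.+1%:R by apply: m2P; near: n; exists m2.
have n0 : 0 < n.+1%:R^-1 :> R by rewrite invr_gt0.
have [|e [_ eK eE]] := reexpand (c := c) (K := K) n0 wd.
  move=> N; apply: le_trans (cK N); apply: ler_sum => k _.
  rewrite ler_wpM2l ?normc_ge0// lerXn2r ?nnegrE//; move: n0 n4; move: (n.+1%:R^-1) => x x0 x4; lra.
exists e; split; last by move=> k; exact: le_trans (eK k) nK.
move=> h hn; apply: eE; first exact: ltW.
have -> : w + h = w0 + (w - w0 + h) by ring.
apply: cr.
rewrite (le_lt_trans (normcD _ _))//.
by move: (n.+1%:R^-1) hn n4 wd => x; lra.
Unshelve. all: by end_near. Qed.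

(** Compactness, in the form of the near covering property.  The disc is taken inside
a square of R * R, and the points of the square outside the disc are handled by
the openness of the complement. *)
Lemma expands_unif_disc eta w0 r :
  (forall z, normc z <= r -> exists c s, 0 < s /\ expands eta (w0 + z) c s) ->
  exists n, forall z, normc z <= r -> expands_unif eta n (w0 + z).
Proof.
move=> loc; pose P (n : nat) (p : R * R) :=
  normc (p.1 +i* p.2) <= r -> expands_unif eta n (w0 + (p.1 +i* p.2)).
have near_normc (p : R * R) (d : R) : 0 < d ->
    \forall p' \near p, normc ((p'.1 +i* p'.2) - (p.1 +i* p.2)) < d.
  move=> d0; have d20 : 0 < d / 2 by rewrite divr_gt0.
  near=> p'; rewrite (le_lt_trans (normc_le_ReIm _))//= (splitr d) ltrD//.
    rewrite distrC; near: p'; case: p => x y.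
    exact: (@cvgr_dist_lt _ _ _ _ _ _ _ (@cvg_fst _ _ (nbhs x) (nbhs y) _)).
  rewrite distrC; near: p'; case: p => x y.
  exact: (@cvgr_dist_lt _ _ _ _ _ _ _ (@cvg_snd _ _ (nbhs x) (nbhs y) _)).
pose A := `[- r, r] `*` `[- r, r] : set (R * R).
have cA : compact A by apply: compact_setX; exact: segment_compact.
have /compact_near_coveringP ncA := cA.
have := ncA nat \oo P _ _; case=> [p _|n0 _ n0P].
  have [pr|pr] := leP (normc (p.1 +i* p.2)) r.
    have [c [s [s0 cs]]] := loc _ pr.
    have [d [d0 dP]] := expands_unif_local s0 cs.
    exists ([set p' : R * R | normc ((p'.1 +i* p'.2) - (p.1 +i* p.2)) < d],
      [set n | forall w, normc (w - (w0 + (p.1 +i* p.2))) <= d -> expands_unif eta n w]).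
      by split => //; exact: near_normc.
    move=> [p' n] /= [p'd nP] _; apply: nP.
    by rewrite opprD addrACA subrr add0r ltW.
  exists ([set p' : R * R | normc ((p'.1 +i* p'.2) - (p.1 +i* p.2)) <
     normc (p.1 +i* p.2) - r], setT).
    by split => /=; [apply: near_normc; rewrite subr_gt0 | exact: filterT].
  move=> [p' n] [p'd _]; rewrite /P => p'r; exfalso.
  have {}p'd : normc ((p'.1 +i* p'.2) - (p.1 +i* p.2)) < normc (p.1 +i* p.2) - r by [].
  have {}p'r : normc (p'.1 +i* p'.2) <= r by [].
  have : normc (p.1 +i* p.2) <= normc (p'.1 +i* p'.2) + normc ((p'.1 +i* p'.2) - (p.1 +i* p.2)).
    rewrite -[X in _ <= _ + X]normcN opprB.
    by apply: le_trans (normcD _ _); rewrite addrC subrK.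
  by move: (normc _) (normc _) (normc _) p'd p'r pr => x y z; lra.
exists n0 => -[x y] zr; apply: (n0P n0 (leqnn _) (x, y)) => //.
have xr := le_trans (Re_le_normc _) zr; have yr := le_trans (Im_le_normc _) zr.
by split => /=; rewrite in_itv/= -ler_norml.
Unshelve. all: by end_near. Qed.

(** With the uniform radius s of [expands_unif_disc], each application of
[expands_step] at distance s / 2 inside the current disc gains s / 2; finitely
many of them pass the radius r. *)
Lemma expands_disc eta w0 r : 0 < r ->
  (forall z, normc z <= r -> exists c s, 0 < s /\ expands eta (w0 + z) c s) ->
  exists c rho, r < rho /\ expands eta w0 c rho.
Proof.
move=> r0 loc; have [n nP] := expands_unif_disc loc.
set s : R := n.+1%:R^-1; have s0 : 0 < s by rewrite invr_gt0.
have [|c [cP cK]] := nP 0; first by rewrite normc0 ltW.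
rewrite addr0 in cP; exists c.
have iter (i : nat) : (exists rho, r < rho /\ expands eta w0 c rho) \/
    expands eta w0 c (s + i%:R * (s / 2)).
  elim: i => [|i [IH|IH]]; [by right; rewrite mul0r addr0|by left|].
  have [le|lt] := leP (s + i%:R * (s / 2)) r; last by left; exists (s + i%:R * (s / 2)).
  right.
  (* The step starts from the points at distance at least s / 2 from the boundary. *)
  have -> : s + i.+1%:R * (s / 2) = (s + i%:R * (s / 2) - s / 2) + s.
    by rewrite -natr1; field.
  have i0 : 0 <= i%:R * (s / 2) by rewrite mulr_ge0// divr_ge0// ltW.
  apply: (expands_step (K := n.+1%:R) s0 _ IH); first by apply/andP; split; lra.
  by move=> w wr; apply: nP; move: wr; lra.
have [//|H] := iter (Num.truncn (r / (s / 2))).+1.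
exists (s + (Num.truncn (r / (s / 2))).+1%:R * (s / 2)); split => //.
have h : r / (s / 2) < (Num.truncn (r / (s / 2))).+1%:R by exact: truncnS_gt.
by move: h; rewrite ltr_pdivrMr ?divr_gt0//; lra.
Qed.

End disc_theorem.

(** * Real power series *)

Section real_power_series.
Context {R : realType}.
Implicit Types (c : nat -> R) (x t r rho : R).

(** A lower bound for the radius of convergence, phrased with bounded terms: this
passes to derivatives and to components with no convergence to prove. *)
Definition radius_ge c r := forall rho, 0 <= rho < r ->
  exists M, forall n, `|c n| * rho ^+ n <= M.

Lemma radius_ge_series c r x : radius_ge c r -> `|x| < r -> cvgn (pseries c x).
Proof.
move=> cr xr; pose rho := (`|x| + r) / 2.
have x0 := normr_ge0 x.
have [M MP] : exists M, forall n, `|c n| * rho ^+ n <= M.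
  by apply: cr; rewrite /rho; apply/andP; split; lra.
apply: (@is_cvg_series_abs_bounded _ _ (M / (1 - `|x| / rho))) => N.
have := @abs_power_series_le _ (fun n => (c n)%:C) `|x| rho M _ _ N.
rewrite (eq_bigr (fun n => `|c n * x ^+ n|)); last first.
  by move=> n _; rewrite normc_real normrM normrX.
apply; first by rewrite x0/= /rho; lra.
by move=> n; rewrite normc_real.
Qed.

Lemma radius_ge_diffs c r : radius_ge c r -> radius_ge (pseries_diffs c) r.
Proof.
move=> cr rho /andP[rho0 rhor]; pose s := (rho + r) / 2.
have s0 : 0 < s by rewrite /s; lra.
have [M MP] : exists M, forall n, `|c n| * s ^+ n <= M.
  by apply: cr; rewrite /s; apply/andP; split; lra.
exists (s / (s - rho) * M / s) => n; rewrite /pseries_diffs normrM normr_nat.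
have rs : 0 <= rho < s by rewrite rho0/= /s; lra.
have h := mulSn_exp_le n rs.
rewrite mulrAC (le_trans (ler_wpM2r (normr_ge0 _) h))// ler_pdivlMr//.
have -> : s / (s - rho) * s ^+ n * `|c n.+1| * s = s / (s - rho) * (`|c n.+1| * s ^+ n.+1).
  by rewrite exprS; ring.
by apply: ler_wpM2l => //; rewrite divr_ge0 ?(ltW s0)//; lra.
Qed.

Definition psum c x := limn (pseries c x).

Lemma is_derive_psum c r x : radius_ge c r -> `|x| < r ->
  is_derive x 1 (psum c) (psum (pseries_diffs c) x).
Proof.
(* pseries_snd_diffs asks for convergence at one point beyond x. *)
move=> cr xr; pose k := (`|x| + r) / 2.
have x0 := normr_ge0 x.
have kr : `|k| < r by rewrite /k ger0_norm; lra.
have xk : `|x| < `|k| by rewrite [ltRHS]ger0_norm /k; lra.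
have h1 := radius_ge_diffs cr; have h2 := radius_ge_diffs h1.
apply: pseries_snd_diffs xk.
- exact: radius_ge_series cr kr.
- exact: radius_ge_series h1 kr.
- exact: radius_ge_series h2 kr.
Qed.

Lemma psum0 c : psum c 0 = c 0%N.
Proof.
apply: cvg_lim => //; apply: cvg_near_cst; near=> n.
rewrite /pseries /series /= -[n]prednK; last by near: n; exists 1%N.
rewrite big_nat_recl//= expr0 mulr1 big1_seq ?addr0// => i _.
by rewrite exprS mul0r mulr0.
Unshelve. all: by end_near. Qed.

Lemma near_ball_shift t r : 0 < r -> \forall x \near t, `|x - t| < r.
Proof. by move=> r0; near do rewrite distrC; exact: cvgr_dist_lt. Unshelve. all: by end_near. Qed.

Lemma is_derive_psum_shift c r t x : radius_ge c r -> `|x - t| < r ->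
  is_derive x 1 (fun y => psum c (y - t)) (psum (pseries_diffs c) (x - t)).
Proof.
move=> cr xr; have d1 := is_derive_psum cr xr.
have d2 : is_derive x 1 (fun y => y - t) 1.
  by apply: is_derive_eq; rewrite subr0.
by have := @is_derive1_comp _ _ (fun y => y - t) _ _ _ d1 d2; rewrite mulr1.
Qed.

(** Induction on n: near t the n-th derivative is again the sum of a power series
in x - t with the same radius, whose coefficients are explicit. *)
Lemma derive1n_psum c r t f : 0 < r -> radius_ge c r ->
  (\forall x \near t, f x = psum c (x - t)) ->
  forall n, derive1n n f t = n`!%:R * c n.
Proof.
move=> r0 cr fE n.
suff : exists d, [/\ radius_ge d r, (forall k, d k = ((n + k)`!%:R / k`!%:R) * c (n + k)%N)
    & \forall x \near t, derive1n n f x = psum d (x - t)].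
  move=> [d [_ dc /nbhs_singleton->]].
  by rewrite subrr psum0 dc addn0 divr1.
elim: n => [|n [d [dr dc dE]]].
  exists c; split => // k; rewrite add0n divff ?mul1r// pnatr_eq0 -lt0n fact_gt0//.
exists (pseries_diffs d); split; first exact: radius_ge_diffs.
  move=> k; rewrite /pseries_diffs dc addSnnS [(k.+1)`!]factS natrM; field.
  by rewrite nat1r !pnatr_eq0 -!lt0n fact_gt0.
have dE2 := near_join dE; have near_t := near_ball_shift t r0.
near=> x; rewrite derive1nS derive1E.
have xt : `|x - t| < r by near: x.
rewrite (near_eq_derive (g := fun y => psum d (y - t))); last by near: x.
exact: (@derive_val _ _ _ _ _ _ _ (is_derive_psum_shift dr xt)).
Unshelve. all: by end_near. Qed.

End real_power_series.

(** * The formula of Faà di Bruno *)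

Section multinomial.
Context {F : numFieldType} {A : comAlgType F}.

(** The product of exponentials is the exponential of the sum, truncated at
degree n: the coefficient of X^k is exact as long as k <= n. *)
Lemma truncated_exp_coef n m (x : 'I_m -> A) k : (k <= n)%N ->
  (\prod_(i < m) \sum_(p < n.+1) ((p`!%:R : F)^-1 *: x i ^+ p)%:P * 'X^p)`_k =
  (k`!%:R : F)^-1 *: (\sum_(i < m) x i) ^+ k.
Proof.
elim: (index_enum _) k => [|i s IH] k kn.
  rewrite !big_nil coef1 expr0n; case: k {kn} => [|k] /=.
    by rewrite invr1 scale1r.
  by rewrite scaler0.
have Ei j : (j <= n)%N ->
   (\sum_(p < n.+1) ((p`!%:R : F)^-1 *: x i ^+ p)%:P * 'X^p)`_j =
   (j`!%:R : F)^-1 *: x i ^+ j.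
  move=> jn; rewrite coef_sum (bigD1 (Ordinal (jn : (j < n.+1)%N)))//= big1 ?addr0.
    by rewrite coefCM coefXn eqxx mulr1.
  move=> p pj; rewrite coefCM coefXn; case: eqP => [jp|]; last by rewrite mulr0.
  by case/eqP: pj; apply/val_inj.
rewrite !big_cons coefM [_ + _]addrC exprDn scaler_sumr; apply: eq_bigr => j _.
have jk : (j <= k)%N by rewrite -ltnS.
rewrite Ei ?(leq_trans jk)// IH ?(leq_trans (leq_subr _ _))//.
rewrite -scalerAl -scalerAr; etransitivity; first exact: scalerA.
rewrite mulrC [_ * x i ^+ _]mulrC -[_ *+ 'C(k, j)]scaler_nat.
etransitivity; last by symmetry; exact: scalerA.
congr (_ *: _).
have f0 a : a`!%:R != 0 :> F by rewrite pnatr_eq0 -lt0n fact_gt0.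
rewrite -(bin_fact jk) !natrM; field.
by rewrite !f0 pnatr_eq0 -lt0n bin_gt0 jk.
Qed.

(** Expanding the product of truncated exponentials by distributivity.  The bound n on
the exponents, which can exceed k, is the one that [faa_di_bruno_coef] uses. *)
Lemma multinomial n m (x : 'I_m -> A) k : (k <= n)%N ->
  (k`!%:R : F)^-1 *: (\sum_(i < m) x i) ^+ k =
  \sum_(P : {ffun 'I_m -> 'I_n.+1} | (\sum_(i < m) P i)%N == k)
     \prod_(i < m) (((P i)`!%:R : F)^-1 *: x i ^+ P i).
Proof.
move=> kn; rewrite -(truncated_exp_coef x kn) bigA_distr_bigA/= coef_sum [RHS]big_mkcond/=.
apply: eq_bigr => P _; rewrite big_split/= prodrXr -rmorph_prod/= coefCM coefXn.
by rewrite eq_sym; case: eqP => _; rewrite ?mulr1 ?mulr0.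
Qed.

End multinomial.

Section faa_di_bruno.
Context {R : realType}.
Implicit Types (g u : R -> R) (x t : R).

(** Coefficientwise derivative of a polynomial that depends on a real parameter. *)
Definition poly_is_derive (P : R -> {poly R}) (Q : {poly R}) x :=
  forall n, is_derive x 1 (fun y => (P y)`_n) Q`_n.

Lemma is_derive_sum_ord n (f : 'I_n -> R -> R) (df : 'I_n -> R) x :
  (forall i, is_derive x 1 (f i) (df i)) ->
  is_derive x 1 (fun y => \sum_(i < n) f i y) (\sum_(i < n) df i).
Proof.
move=> fd; have := @is_derive_sum _ _ _ n f x 1 df fd.
by rewrite (_ : \sum_(i < n) f i = fun y => \sum_(i < n) f i y)//; apply/funext => y; rewrite fct_sumE.
Qed.

Lemma poly_is_deriveM P1 P2 Q1 Q2 x :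
  poly_is_derive P1 Q1 x -> poly_is_derive P2 Q2 x ->
  poly_is_derive (fun y => P1 y * P2 y) (Q1 * P2 x + P1 x * Q2) x.
Proof.
move=> d1 d2 n; rewrite coefD !coefM -big_split/=.
have -> : (fun y => (P1 y * P2 y)`_n) =
    (fun y => \sum_(j < n.+1) (P1 y)`_j * (P2 y)`_(n - j)).
  by apply/funext => y; rewrite coefM.
apply: is_derive_sum_ord => i.
apply: is_derive_eq; first by apply: is_deriveM; [exact: d1|exact: d2].
by rewrite addrC; congr (_ + _); exact: mulrC.
Qed.

Lemma poly_is_deriveX P Q x k : poly_is_derive P Q x ->
  poly_is_derive (fun y => P y ^+ k) (P x ^+ k.-1 * Q *+ k) x.
Proof.
move=> d; elim: k => [|k IH].
  by move=> n; rewrite mulr0n coef0; under eq_fun do rewrite expr0; exact: is_derive_cst.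
have -> : (fun y => P y ^+ k.+1) = (fun y => P y * P y ^+ k).
  by apply/funext => y; rewrite exprS.
have -> : P x ^+ k.+1.-1 * Q *+ k.+1 = Q * P x ^+ k + P x * (P x ^+ k.-1 * Q *+ k).
  rewrite mulrS/= [Q * _]mulrC; congr (_ + _).
  case: k {IH} => [|k]; first by rewrite !mulr0n mulr0.
  by rewrite -mulrnAr mulrA -exprS mulrnAr.
exact: poly_is_deriveM.
Qed.

(** The Taylor polynomial of y |-> g (x + y) - g x.  The degree N stays fixed while
orders of derivation increase up to N. *)
Definition taylor_poly g N x : {poly R} :=
  \sum_(i < N) (derive1n i.+1 g x / i.+1`!%:R) *: 'X^(i.+1).

(** The partial exponential Bell polynomial B_(n,k) evaluated at the derivatives of
g, for n <= N: its generating function is the k-th power of the Taylor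
polynomial over k!. *)
Definition bell_coef g N n k x : R :=
  n`!%:R / k`!%:R * (taylor_poly g N x ^+ k)`_n.

(** The multinomial expansion of the k-th power of the Taylor polynomial; the numbers
i in the numerators of [faa_di_bruno_coef] multiply to n!. *)
Lemma bell_coefE g n k t : (k <= n)%N ->
  bell_coef g n n k t = faa_di_bruno_coef g t n k.
Proof.
move=> kn; rewrite /bell_coef /faa_di_bruno_coef -mulrA -coefZ.
rewrite (@multinomial R {poly R} n n _ k kn) coef_sum mulr_sumr.
rewrite [RHS]big_mkcondr/=; apply: eq_bigr => P _.
have -> : \prod_(i < n) ((P i)`!%:R^-1 *:
      ((derive1n i.+1 g t / i.+1`!%:R) *: 'X^(i.+1)) ^+ P i) =
    (\prod_(i < n) ((P i)`!%:R^-1 * (derive1n i.+1 g t / i.+1`!%:R) ^+ P i))%:P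
    * 'X^(\sum_(i < n) i.+1 * P i).
  rewrite -prodrXr rmorph_prod -big_split/=; apply: eq_bigr => i _.
  by move: (derive1n i.+1 g t / i.+1`!%:R) => a; rewrite -!mul_polyC exprMn -exprM -polyC_exp mulrA -polyCM.
rewrite coefCM coefXn [n == _]eq_sym; case: ifPn => _; last by rewrite !mulr0.
rewrite mulr1.
have -> : (n`!)%:R = \prod_(i < n) i.+1%:R :> R.
  by rewrite -natr_prod; congr (_%:R); rewrite fact_prod big_add1 big_mkord.
rewrite -big_split/=; apply: eq_bigr => i _.
rewrite expr_div_n invfM; move: (_ ^+ P i) (_ ^+ P i) => x y.
by move: (_^-1) (y^-1) => p q; ring.
Qed.

Lemma bell_coef0 g N n k x : (n < k)%N -> bell_coef g N n k x = 0.
Proof.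
move=> nk; rewrite /bell_coef /taylor_poly.
have -> : \sum_(i < N) (derive1n i.+1 g x / i.+1`!%:R) *: 'X^(i.+1) =
    (\sum_(i < N) (derive1n i.+1 g x / i.+1`!%:R) *: 'X^i) * 'X.
  by rewrite mulr_suml; apply: eq_bigr => i _; rewrite -scalerAl -exprSr.
by rewrite exprMn coefMXn nk mulr0.
Qed.

(** Differentiating the Taylor polynomial T in the base point x is differentiating
it in X, up to removing the constant term g' and correcting the degree N:
dT/dx = T' - g' + b X^N.  So d(T^k)/dx = (T^k)' - k g' T^(k-1) modulo X^N, which
reads as the recurrence of the Bell polynomials on coefficients. *)
Lemma is_derive_bell_coef g N n k x : (n < N)%N ->
  (forall i, (i <= N)%N -> derivable (derive1n i g) x 1) ->
  is_derive x 1 (bell_coef g N n k)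
    (bell_coef g N n.+1 k x -
     (if k is k'.+1 then derive1 g x * bell_coef g N n k' x else 0)).
Proof.
move=> nN gd; pose b : R := derive1n N.+1 g x / N`!%:R.
(* The derivative of the Taylor polynomial in x; the last term restores the degree N,
   and disappears from the coefficients of index n < N. *)
pose Q : {poly R} := (taylor_poly g N x)^`() - (derive1 g x)%:P + b *: 'X^N.
have dT : poly_is_derive (taylor_poly g N) Q x.
  have -> : Q = \sum_(i < N) (derive1n i.+2 g x / i.+1`!%:R) *: 'X^(i.+1).
    rewrite /Q; have -> : (taylor_poly g N x)^`() = \sum_(i < N) (derive1n i.+1 g x / i`!%:R) *: 'X^i.
      rewrite /taylor_poly raddf_sum; apply: eq_bigr => i _.
      rewrite /= derivZ derivXn /= -[_ *+ i.+1]scaler_nat scalerA; congr (_ *: _).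
      rewrite factS natrM; field.
      by rewrite nat1r !pnatr_eq0 -!lt0n fact_gt0.
    have : \sum_(i < N.+1) (derive1n i.+1 g x / i`!%:R) *: 'X^i =
       (derive1 g x)%:P + \sum_(i < N) (derive1n i.+2 g x / i.+1`!%:R) *: 'X^(i.+1).
      by rewrite big_ord_recl/= divr1 expr0 alg_polyC.
    rewrite big_ord_recr/= -/b => E.
    by rewrite addrAC E addrAC subrr add0r.
  move=> m; rewrite coef_sum.
  have -> : (fun y => (taylor_poly g N y)`_m) = (fun y =>
     \sum_(i < N) (derive1n i.+1 g y / i.+1`!%:R) * ('X^(i.+1) : {poly R})`_m).
    by apply/funext => y; rewrite coef_sum; apply: eq_bigr => i _; rewrite coefZ.
  apply: is_derive_sum_ord => i.
  have -> : derive1n i.+2 g x = 'D_1 (derive1n i.+1 g) x by rewrite derive1nS derive1E.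
  rewrite coefZ -mulrA.
  under eq_fun do rewrite -mulrA.
  have dg : is_derive x 1 (derive1n i.+1 g) ('D_1 (derive1n i.+1 g) x).
    by apply/derivableP/gd.
  set cc := _ * _.
  have -> : (fun y => derive1n i.+1 g y * cc) = cc \*: derive1n i.+1 g.
    by apply/funext => y; rewrite mulrC.
  by apply: is_derive_eq; rewrite mulrC.
have dk := poly_is_deriveX k dT n.
have := is_deriveZ (n`!%:R / k`!%:R) dk.
rewrite [_ \*: _](_ : _ = bell_coef g N n k)//.
move/is_derive_eq; apply.
case: k {dk} => [|k]; first by rewrite mulr0n coef0 scaler0 subr0 /bell_coef expr0 coef1 mulr0.
have XT : taylor_poly g N x ^+ k * (b *: 'X^N) = (b *: taylor_poly g N x ^+ k) * 'X^N.
  by rewrite -scalerAr -scalerAl.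
have dT2 : (taylor_poly g N x ^+ k.+1)^`()`_n = (taylor_poly g N x ^+ k * (taylor_poly g N x)^`() *+ k.+1)`_n.
  by rewrite deriv_exp mulrC.
rewrite coef_deriv in dT2.
rewrite /= /Q mulrDr mulrBr XT mulrnDl coefD [X in _ + X]coefMn coefMXn nN mul0rn addr0.
rewrite mulrnBl coefB -dT2 /bell_coef [_ * _%:P]mulrC coefMn coefCM.
rewrite factS [in RHS](factS n) !natrM /GRing.scale/=.
move: (_`_n.+1) (_`_n) => y z; rewrite -(mulr_natr y) -(mulr_natr (_ * z)); field.
by rewrite !nat1r !pnatr_eq0 -!lt0n fact_gt0.
Qed.

(** Induction on the order.  The derivative of the k-th term produces
u^(k+1) g' B_(n,k) and, by [is_derive_bell_coef], u^(k) (B_(n+1,k) - g' B_(n,k-1));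
the terms with g' telescope. *)
Lemma derive1n_comp u g t N :
  (forall k, \forall y \near g t, derivable (derive1n k u) y 1) ->
  (forall k, \forall x \near t, derivable (derive1n k g) x 1) ->
  derive1n N (u \o g) t =
  \sum_(0 <= k < N.+1) derive1n k u (g t) * faa_di_bruno_coef g t N k.
Proof.
move=> ud gd.
suff H n : (n <= N)%N -> \forall x \near t, derive1n n (u \o g) x =
    \sum_(0 <= k < N.+1) derive1n k u (g x) * bell_coef g N n k x.
  rewrite (nbhs_singleton (H N (leqnn N))) !big_nat; apply: eq_bigr => k /= kN.
  by rewrite bell_coefE.
elim: n => [_|n IH nN].
  near=> x; rewrite derive1n0 big_nat_recl//= big1_seq ?addr0; last first.
    by move=> k _; rewrite bell_coef0// mulr0.
  by rewrite /bell_coef expr0 coef1 eqxx /= !mulr1 divr1 mulr1.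
have gall : \forall x \near t, forall i : 'I_N.+1, derivable (derive1n i g) x 1.
  apply: (@filter_forall _ _ (fun (i : 'I_N.+1) x => derivable (derive1n i g) x 1) _ (nbhs_filter t)).
  by move=> i; exact: gd.
have gc : g x @[x --> t] --> g t.
  apply/differentiable_continuous/derivable1_diffP.
  by have := nbhs_singleton (gd 0%N).
have uall : \forall x \near t, forall i : 'I_N.+1, derivable (derive1n i u) (g x) 1.
  have h : \forall y \near g t, forall i : 'I_N.+1, derivable (derive1n i u) y 1.
    apply: (@filter_forall _ _ (fun (i : 'I_N.+1) y => derivable (derive1n i u) y 1) _ (nbhs_filter (g t))).
    by move=> i; exact: ud.
  exact: (gc _ h).
have IHn := near_join (IH (ltnW nN)).
near=> x.
have gx : forall i : 'I_N.+1, derivable (derive1n i g) x 1 by near: x.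
have ux : forall i : 'I_N.+1, derivable (derive1n i u) (g x) 1 by near: x.
have eqx : \forall y \near x, derive1n n (u \o g) y =
    \sum_(0 <= k < N.+1) derive1n k u (g y) * bell_coef g N n k y by near: x.
have dg : is_derive x 1 g (derive1 g x).
  by rewrite derive1E; apply/derivableP; exact: (gx ord0).
have du (k : 'I_N.+1) : is_derive x 1 (derive1n k u \o g)
    (derive1n k.+1 u (g x) * derive1 g x).
  have dgx : is_derive (g x) 1 (derive1n k u) (derive1n k.+1 u (g x)).
    by rewrite derive1nS derive1E; apply/derivableP.
  exact: is_derive1_comp.
have db k := @is_derive_bell_coef g N n k x nN (fun i iN => gx (Ordinal (iN : (i < N.+1)%N))).
rewrite derive1nS derive1E.
have -> : 'D_1 (derive1n n (u \o g)) x =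
   'D_1 (fun y => \sum_(k < N.+1) (derive1n k u \o g) y * bell_coef g N n k y) x.
  by apply: near_eq_derive; apply: filterS eqx => y ->; rewrite big_mkord.
have hd := is_derive_sum_ord (fun k => is_deriveM (du k) (db k)).
etransitivity; first exact: (@derive_val _ _ _ _ _ _ _ hd).
rewrite big_mkord.
(* The telescoping terms; w (N + 1) vanishes because bell_coef N n N x = 0 for n < N. *)
pose w (k : nat) : R := if k is k'.+1 then
  derive1n k u (g x) * (derive1 g x * bell_coef g N n k' x) else 0.
rewrite (eq_bigr (fun k : 'I_N.+1 => derive1n k u (g x) * bell_coef g N n.+1 k x
    + (w k.+1 - w k))); last first.
  move=> k _; rewrite /GRing.scale/= /w; case: k => -[|k] kN/=.
    by rewrite !subr0; ring.
  by ring.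
rewrite big_split/= -[in LHS](big_mkord xpredT (fun k => w k.+1 - w k)).
by rewrite telescope_sumr// {1}/w bell_coef0// !mulr0 /w subr0 addr0.
Unshelve. all: by end_near. Qed.

End faa_di_bruno.

(** * The Gamma function *)

Section Gamma_function.
Context {R : realType}.
Implicit Types (x y s p A : R).
Local Notation mu := lebesgue_measure.

Lemma powR_at0 p : 0 < p -> x `^ p @[x --> (0 : R)^'+] --> (0 : R) `^ p.
Proof. by move=> p0; rewrite powR0 ?gt_eqF//; exact: powR_cvg0. Qed.

Lemma powR_continuous_gt0 p x : 0 < x -> {for x, continuous (@powR R ^~ p)}.
Proof.
move=> x0; apply/differentiable_continuous/derivable1_diffP.
by apply: derivable_powR; rewrite in_itv/= x0.
Qed.

Lemma powR_le_exp p : 0 <= p -> exists C, 0 <= C /\ forall x, 0 < x ->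
  x `^ p <= C * expR (x / 2).
Proof.
move=> p0; pose n := Num.truncn p.
have pn : p <= n.+1%:R by rewrite ltW// truncnS_gt.
(* For x <= 1 the power is at most 1; for x > 1, x^p <= x^(n+1), a multiple of one
   term of the exponential series at x / 2. *)
exists (1 + n.+1`!%:R * 2 ^+ n.+1); split => [|x x0].
  by rewrite addr_ge0// mulr_ge0// exprn_ge0.
have e1 : 1 <= expR (x / 2).
  by rewrite -[leLHS]expR0 ler_expR divr_ge0// ltW.
have [x1|x1] := leP x 1.
  rewrite (le_trans (y := 1))//; last first.
    rewrite mulrDl mul1r ler_wpDr// mulr_ge0 ?expR_ge0// mulr_ge0// exprn_ge0//.
  have := @ger_powR _ x _ 0 p p0; rewrite powRr0; apply.
  by rewrite x0.
rewrite (le_trans (ler_powR (ltW x1) pn))// powR_mulrn ?(ltW x0)//.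
have := @expR_ge1Dxn _ (x / 2) n; rewrite divr_ge0 ?(ltW x0)// => /(_ isT) h.
have {}h : (x / 2) ^+ n.+1 / n.+1`!%:R <= expR (x / 2).
  by apply: le_trans h; rewrite lerDr.
rewrite mulrDl mul1r ler_wpDl ?expR_ge0//.
move: h; rewrite ler_pdivrMr ?ltr0n ?fact_gt0// expr_div_n.
rewrite ler_pdivrMr ?exprn_gt0// => h.
apply: (le_trans h); rewrite le_eqVlt; apply/orP; left; apply/eqP.
by move: (n.+1`!%:R) (2 ^+ _) => u v; ring.
Qed.

Definition gamma_integrand s x := x `^ (s - 1) * expR (- x).

Lemma measurable_gamma_integrand s D :
  measurable_fun D (gamma_integrand s).
Proof.
apply: measurable_funM.
  apply: measurable_funTS; exact: measurable_powR.
apply: measurableT_comp; first exact: measurable_expR.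
exact: oppr_measurable.
Qed.

(** The restriction to s >= 1 keeps the integrand bounded at 0, and exponential decay
at infinity comes by comparison with the exponential density of rate 1 / 2. *)
Lemma gamma_integrable s : 1 <= s ->
  mu.-integrable `]0, +oo[ (EFin \o gamma_integrand s).
Proof.
move=> s1; have sp : 0 <= s - 1 by rewrite subr_ge0.
have [C [C0 CP]] := powR_le_exp sp.
have i2 : mu.-integrable `]0, +oo[ (EFin \o exponential_pdf (2^-1 : R)).
  have h2 : 0 < 2^-1 :> R by rewrite invr_gt0.
  have h := integrable_exponential_pdf h2.
  by apply: integrableS h => //; exact: measurable_itv.
have := integrableZl _ (2 * C) i2; move=> /(_ (measurable_itv _)).
apply: le_integrable => //.
  by apply/measurable_EFinP; apply: measurable_gamma_integrand.
move=> x /=; rewrite in_itv/= andbT => x0.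
rewrite exponential_pdfE ?(ltW x0)//.
rewrite lee_fin ger0_norm; last by rewrite mulr_ge0 ?powR_ge0 ?expR_ge0.
rewrite ger0_norm; last by rewrite !mulr_ge0// ?expR_ge0.
rewrite /gamma_integrand.
have -> : expR (- x) = expR (- (x / 2)) * expR (- (x / 2)).
  by rewrite -expRD; congr expR; field.
rewrite mulrA; have -> : - (2^-1) * x = - (x / 2) by rewrite mulNr mulrC.
have h := CP x x0.
rewrite [leRHS](_ : _ = C * expR (- (x / 2))); last by field.
rewrite ler_wpM2r ?expR_ge0// (le_trans (ler_wpM2r (expR_ge0 _) h))//.
by rewrite -mulrA -expRD subrr expR0 mulr1.
Qed.

Lemma Gamma1 : Gamma (1 : R) = 1.
Proof.
rewrite /Gamma; have i1 := gamma_integrable (lexx 1).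
rewrite Rintegral_itv_obnd_cbnd; last exact: i1.
rewrite (@eq_Rintegral _ _ _ mu _ (fun x => expR (- x))); last first.
  by move=> x _; rewrite subrr powRr0 mul1r.
rewrite (@Rintegral_ge0_continuous_FTC2y _ _ (fun x => - expR (- x)) 0 0).
- by rewrite oppr0 expR0 sub0r opprK.
- by move=> x _; exact: expR_ge0.
- apply: continuous_subspaceT => x.
  by apply: continuous_comp; [exact: opp_continuous|exact: continuous_expR].
- rewrite -[X in _ --> X]oppr0; apply: cvgN; exact: cvgr_expR.
- by move=> x _; apply: ex_derive.
- apply: cvg_at_right_filter; apply: cvgN.
  by apply: continuous_comp; [exact: opp_continuous|exact: continuous_expR].
- by move=> x _; rewrite derive1E derive_val /GRing.scale/=; ring.
Qed.

Lemma is_derive_gamma_primitive s x : 0 < x ->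
  is_derive x 1 (fun y => y `^ s * expR (- y))
    (s * x `^ (s - 1) * expR (- x) - x `^ s * expR (- x)).
Proof.
move=> x0; have d1 := is_derive1_powR s x0.
have d2 : is_derive x 1 (fun y => expR (- y)) (- expR (- x)).
  by apply: is_derive_eq; rewrite /GRing.scale/=; ring.
have d := is_deriveM d1 d2; apply: (is_derive_eq d).
by rewrite /GRing.scale/=; ring.
Qed.

Lemma gamma_primitive_cvgy s : 0 <= s ->
  x `^ s * expR (- x) @[x --> +oo] --> (0 : R).
Proof.
move=> s0; have [C [C0 CP]] := powR_le_exp s0.
apply: (@squeeze_cvgr _ _ _ _ (fun=> 0) (fun x => C * expR (- (x / 2)))).
- near=> x; have x0 : 0 < x by near: x; exact: nbhs_pinfty_gt.
  rewrite mulr_ge0 ?powR_ge0 ?expR_ge0//=.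
  have -> : expR (- x) = expR (- (x / 2)) * expR (- (x / 2)).
    by rewrite -expRD; congr expR; field.
  rewrite mulrA ler_wpM2r ?expR_ge0// (le_trans (ler_wpM2r (expR_ge0 _) (CP _ x0)))//.
  by rewrite -mulrA -expRD subrr expR0 mulr1.
- exact: cvg_cst.
- rewrite -[X in _ --> X](mulr0 C); apply: cvgMr.
  apply: (@cvg_comp _ _ _ (fun x => x / 2) (fun x => expR (- x)) +oo +oo); last exact: cvgr_expR.
  by apply: gt0_cvgMly; first rewrite invr_gt0.
Unshelve. all: by end_near. Qed.

(** Integration by parts, as the vanishing of the integral of (x^s exp(-x))'.  For
s > 1 this derivative is continuous at 0; it is nonpositive from s on, where the
one-signed fundamental theorem applies to the unbounded interval. *)
Lemma GammaS s : 1 < s -> Gamma (s + 1) = s * Gamma s.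
Proof.
move=> s1; have s0 : 0 < s by lra.
pose h x : R := x `^ s * expR (- x).
pose h' x : R := s * x `^ (s - 1) * expR (- x) - x `^ s * expR (- x).
have i1 := gamma_integrable (ltW s1).
have i2 : mu.-integrable `]0, +oo[ (EFin \o gamma_integrand (s + 1)).
  by apply: gamma_integrable; lra.
have hE : h' = (fun x => s * gamma_integrand s x - gamma_integrand (s + 1) x).
  by apply/funext => x; rewrite /h' /gamma_integrand addrK mulrA.
have is1 : mu.-integrable `]0, +oo[ (EFin \o (fun x => s * gamma_integrand s x)).
  by have := integrableZl _ s i1; apply; exact: measurable_itv.
have ih : mu.-integrable `]0, +oo[ (EFin \o h').
  by rewrite hE; have := @integrableB _ _ _ mu _ (measurable_itv `]0, +oo[) _ _ is1 i2; apply.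
apply/eqP; rewrite eq_sym -subr_eq0 /Gamma.
rewrite -(@RintegralZl _ _ _ _ _ _ s _ i1)//.
rewrite -(@RintegralB _ _ _ _ _ _ _ _ is1 i2)//.
have -> : \int[mu]_(x in `]0, +oo[) (s * gamma_integrand s x - gamma_integrand (s + 1) x) = \int[mu]_(x in `]0, +oo[) h' x.
  by rewrite hE.
have dh x : 0 < x -> is_derive x 1 h (h' x) := @is_derive_gamma_primitive s x.
have ch x : 0 < x -> {for x, continuous h}.
  move=> x0; apply/differentiable_continuous/derivable1_diffP.
  by have := dh x x0 => -[].
have cexp : continuous (fun x : R => expR (- x)).
  by move=> x; apply: continuous_comp; [exact: opp_continuous|exact: continuous_expR].
have ch' x : 0 < x -> {for x, continuous h'}.
  move=> x0; apply: cvgB; apply: cvgM; try exact: cexp.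
    by apply: cvgMr; exact: powR_continuous_gt0.
  exact: powR_continuous_gt0.
have h0 : h x @[x --> 0^'+] --> h 0.
  apply: cvgM; first exact: powR_at0.
  by apply: cvg_at_right_filter; exact: cexp.
have h'0 : h' x @[x --> 0^'+] --> h' 0.
  apply: cvgB; apply: cvgM; try by apply: cvg_at_right_filter; exact: cexp.
    by apply: cvgMr; apply: powR_at0; rewrite subr_gt0.
  exact: powR_at0.
(* Splitting at s, where the derivative (s - x) x^(s-1) exp(-x) changes sign. *)
have := Rintegral_itvB (x := s) ih.
rewrite !bnd_simp => /(_ (ltW s0) isT) E.
move/eqP: E; rewrite subr_eq => /eqP->.
rewrite Rintegral_itv_obnd_cbnd; last by apply: integrableS ih => //; apply: subset_itvr; rewrite bnd_simp ltW.
rewrite [X in _ + X]Rintegral_itv_obnd_cbnd; last first.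
  by apply: integrableS ih => //; apply: subset_itvl.
have -> : \int[mu]_(x in `[0, s]) h' x = h s - h 0.
  rewrite /Rintegral (@continuous_FTC2 _ h' h 0 s)//.
  - apply/continuous_within_itvP => //; split => //.
      by move=> x; rewrite in_itv/= => /andP[x0 _]; exact: ch'.
    by apply: cvg_at_left_filter; exact: ch'.
  - split => //.
      by move=> x; rewrite in_itv/= => /andP[x0 _]; have [] := dh x x0.
    by apply: cvg_at_left_filter; exact: ch.
  - move=> x; rewrite in_itv/= => /andP[x0 _]; rewrite derive1E.
    exact: (@derive_val _ _ _ _ _ _ _ (dh x x0)).
have -> : \int[mu]_(x in `[s, +oo[) h' x = 0 - h s.
  rewrite /Rintegral (@le0_continuous_FTC2y _ h' h s 0)//.
  - move=> x sx; rewrite /h'.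
    have x0 : 0 < x by exact: lt_le_trans sx.
    rewrite -mulrBl mulr_le0_ge0 ?expR_ge0// -(@mulr_powRB1 _ x s) ?(ltW x0)//.
    by rewrite -mulrBl mulr_le0_ge0 ?powR_ge0// subr_le0.
  - apply/continuous_within_itvcyP; split.
      by move=> x; rewrite in_itv/= andbT => sx; apply: ch'; exact: lt_trans sx.
    by apply: cvg_at_right_filter; exact: ch'.
  - exact: gamma_primitive_cvgy (ltW s0).
  - by apply: cvg_at_right_filter; exact: ch.
  - by move=> x sx; have [] := dh x (lt_trans s0 sx).
  - move=> x; rewrite in_itv/= andbT => sx; rewrite derive1E.
    exact: (@derive_val _ _ _ _ _ _ _ (dh x (lt_trans s0 sx))).
by apply/eqP; rewrite /h powR0 ?gt_eqF//; ring.
Qed.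

(** Keep only the part of Euler's integral over [A, A + 1].  As A is free, Gamma grows
faster than any geometric sequence. *)
Lemma Gamma_ge y A : 0 <= y -> 0 < A -> A `^ y * expR (- (A + 1)) <= Gamma (y + 1).
Proof.
move=> y0 A0; have i1 : mu.-integrable `]0, +oo[ (EFin \o gamma_integrand (y + 1)).
  by apply: gamma_integrable; rewrite lerDr.
have sub : `[A, A + 1] `<=` `]0, +oo[.
  by move=> x /=; rewrite !in_itv/= andbT => /andP[Ax _]; exact: lt_le_trans Ax.
have i2 : mu.-integrable `[A, A + 1] (EFin \o gamma_integrand (y + 1)).
  by apply: integrableS i1.
have -> : A `^ y * expR (- (A + 1)) = \int[mu]_(x in `[A, A + 1]) (A `^ y * expR (- (A + 1))).
  rewrite Rintegral_cst//= lebesgue_measure_itv/= lte_fin ltrDl ltr01/=.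
  by rewrite addrAC subrr add0r mulr1.
apply: (@le_trans _ _ (\int[mu]_(x in `[A, A + 1]) gamma_integrand (y + 1) x)).
  apply: le_Rintegral => //.
    by apply: continuous_compact_integrable; [exact: segment_compact|move=> x; exact: cvg_cst].
  move=> x /=; rewrite in_itv/= => /andP[Ax xA].
  rewrite /gamma_integrand addrK ler_pM ?powR_ge0 ?expR_ge0//.
    by apply: ge0_ler_powR => //; rewrite nnegrE ltW//; exact: lt_le_trans Ax.
  by rewrite ler_expR lerN2.
rewrite /Gamma /Rintegral fine_le//.
- by apply: integrable_fin_num.
- by apply: integrable_fin_num.
apply: ge0_subset_integral => //=.
- by apply/measurable_EFinP; exact: measurable_gamma_integrand.
- by move=> x _; rewrite lee_fin mulr_ge0 ?powR_ge0 ?expR_ge0.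
Qed.

Lemma Gamma_gt0 y : 0 <= y -> 0 < Gamma (y + 1).
Proof.
move=> y0; apply: lt_le_trans (Gamma_ge y0 ltr01).
by rewrite mulr_gt0 ?powR_gt0 ?expR_gt0.
Qed.

End Gamma_function.

(** * The fundamental theorem of calculus up to a singular endpoint *)

Section open_FTC.
Context {R : realType}.
Implicit Types (f g F G : R -> R) (a b x : R).
Local Notation mu := lebesgue_measure.

(** States [measurable_itv] on the measurable type that carries Lebesgue measure, as
the lemmas on integrals expect it. *)
Lemma measurable_itvR (i : interval R) : @measurable _ (measurableTypeR R) [set` i].
Proof. exact: measurable_itv. Qed.

Lemma is_derive_continuous f x (l : R) : is_derive x 1 f l -> {for x, continuous f}.
Proof. by move=> [d _]; apply/differentiable_continuous/derivable1_diffP. Qed.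

Lemma open_itv_measurable_fun f a b : (forall x, a < x < b -> {for x, continuous f}) ->
  measurable_fun (`]a, b[%classic : set R) f.
Proof.
move=> fc; apply: open_continuous_measurable_fun; first exact: interval_open.
by move=> x; rewrite inE/= in_itv/=; exact: fc.
Qed.

Lemma measurable_patch_oo f a b : (forall x, a < x < b -> {for x, continuous f}) ->
  measurable_fun setT (f \_ `]a, b[%classic).
Proof.
move=> fc; apply/(measurable_restrictT f); first exact: (measurable_itv `]a, b[).
exact: open_itv_measurable_fun.
Qed.

(** Monotone convergence along the segments [a + d, b - d], on which the integrand is
continuous.  Only F is assumed continuous at a and b, so f may blow up there. *)
Lemma FTC2_open_ge0 f F a b : a < b ->
  (forall x, a < x < b -> 0 <= f x) ->
  (forall x, a < x < b -> {for x, continuous f}) ->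
  (forall x, a < x < b -> is_derive x 1 F (f x)) ->
  F x @[x --> a^'+] --> F a -> F x @[x --> b^'-] --> F b ->
  (\int[mu]_(x in `]a, b[) (f x)%:E = (F b - F a)%:E)%E.
Proof.
move=> ab f0 fc Fd Fa Fb.
(* The offset 3 makes the segments nondegenerate: 2 d < b - a. *)
pose d n := (b - a) / n.+3%:R.
have ba0 : 0 < b - a by rewrite subr_gt0.
have d0 n : 0 < d n by rewrite divr_gt0.
have d3 n : d n <= (b - a) / 3%:R.
  by rewrite ler_wpM2l ?(ltW ba0)// lef_pV2 ?posrE// ler_nat.
have d_cvg : d n @[n --> \oo] --> 0.
  rewrite -[X in _ --> X](mulr0 (b - a)); apply: cvgMr.
  have := @cvg_harmonic R; rewrite -(cvg_shiftn 2); apply: cvg_trans.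
  by apply: near_eq_cvg; near=> n; rewrite /harmonic /= addn2.
pose U n : set R := [set` `[a + d n, b - d n]].
have UI : \bigcup_n U n = `]a, b[%classic.
  rewrite eqEsubset; split => x /=.
    move=> [n _]; rewrite /U /= !in_itv/= => /andP[h1 h2].
    by move: h1 h2; have := d0 n; move: (d n) => e e0 h1 h2; apply/andP; split; lra.
  rewrite in_itv/= => /andP[ax xb].
  have m0 : 0 < Num.min (x - a) (b - x) by rewrite lt_min !subr_gt0 ax xb.
  have /cvgrPdist_le/(_ _ m0)[n _ /(_ n (leqnn n))/=] := d_cvg.
  rewrite sub0r normrN ger0_norm ?(ltW (d0 n))// le_min => /andP[h1 h2].
  by exists n => //; rewrite /U /= in_itv/=; apply/andP; split; lra.
have Uab n x : a + d n <= x <= b - d n -> a < x < b.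
  move=> /andP[h1 h2]; move: (d0 n) h1 h2; move: (d n) => e e0 h1 h2; apply/andP; split; lra.
have Un n : (\int[mu]_(x in U n) (f x)%:E = (F (b - d n) - F (a + d n))%:E)%E.
  have adb : a + d n < b - d n by have := d3 n; lra.
  have ain : a < a + d n < b by apply: (Uab n); rewrite lexx/= ltW.
  have bin : a < b - d n < b by apply: (Uab n); rewrite lexx andbT ltW.
  have Uoo x : x \in `]a + d n, b - d n[%R -> a < x < b.
    by rewrite in_itv/= => /andP[h1 h2]; apply: (Uab n); rewrite !ltW.
  rewrite EFinB; apply: continuous_FTC2 => //.
  - apply/continuous_within_itvP => //; split.
    + by move=> x /Uoo; exact: fc.
    + by apply: cvg_at_right_filter; exact: fc.
    + by apply: cvg_at_left_filter; exact: fc.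
  - split.
    + by move=> x /Uoo/Fd[].
    + by apply: cvg_at_right_filter; apply: is_derive_continuous (Fd _ ain).
    + by apply: cvg_at_left_filter; apply: is_derive_continuous (Fd _ bin).
  - move=> x /Uoo/Fd h; rewrite derive1E.
    exact: (@derive_val _ _ _ _ _ _ _ h).
have := @ge0_nondecreasing_set_cvg_integral _ (measurableTypeR R) R U (EFin \o f) mu.
rewrite UI => H.
have {}H : (\int[mu]_(x in U i) (f x)%:E)%E @[i --> \oo] --> (\int[mu]_(x in `]a, b[) (f x)%:E)%E.
  apply: H.
  - move=> n m nm; rewrite subsetEset; apply: subset_itv; rewrite bnd_simp.
      by rewrite lerD2l ler_wpM2l ?(ltW ba0)// lef_pV2 ?posrE// ler_nat !ltnS.
    by rewrite lerD2l lerN2 ler_wpM2l ?(ltW ba0)// lef_pV2 ?posrE// ler_nat !ltnS.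
  - by move=> n; exact: measurable_itv.
  - move=> n; apply/measurable_EFinP.
    apply: (@measurable_funS _ _ _ _ `]a, b[%classic); first exact: measurable_itv.
      by move=> x; rewrite /U /= !in_itv/= => /Uab.
    exact: open_itv_measurable_fun.
  - by move=> n x; rewrite /U /= in_itv/= => /Uab xab; rewrite lee_fin; exact: f0.
have G : (\int[mu]_(x in U i) (f x)%:E)%E @[i --> \oo] --> (F b - F a)%:E.
  rewrite (_ : (fun i => _) = (fun n => (F (b - d n) - F (a + d n))%:E)); last first.
    by apply/funext => n; exact: Un.
  apply: cvg_EFin; first by near=> n.
  apply: cvgB.
  - move/cvg_at_leftP : Fb; apply; split; first by move=> n; rewrite ltrBlDr ltrDl.
    by rewrite -[X in _ --> X]subr0; apply: cvgB => //; exact: cvg_cst.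
  - move/cvg_at_rightP : Fa; apply; split; first by move=> n; rewrite ltrDl.
    by rewrite -[X in _ --> X]addr0; apply: cvgD => //; exact: cvg_cst.
by rewrite -(cvg_lim _ H)// (cvg_lim _ G).
Unshelve. all: by end_near. Qed.

Lemma FTC2_open_ge0_integrable f F a b : a < b ->
  (forall x, a < x < b -> 0 <= f x) ->
  (forall x, a < x < b -> {for x, continuous f}) ->
  (forall x, a < x < b -> is_derive x 1 F (f x)) ->
  F x @[x --> a^'+] --> F a -> F x @[x --> b^'-] --> F b ->
  mu.-integrable `]a, b[ (EFin \o f).
Proof.
move=> ab f0 fc Fd Fa Fb; apply/integrableP; split.
  by apply/measurable_EFinP; exact: open_itv_measurable_fun.
rewrite (@eq_integral _ _ _ mu _ (EFin \o f)).
  by rewrite (FTC2_open_ge0 ab f0 fc Fd Fa Fb) ltry.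
by move=> x; rewrite inE/= in_itv/= => /f0 h; rewrite ger0_norm.
Qed.

(** Apply [FTC2_open_ge0] to g and to f + g, both nonnegative, and subtract. *)
Lemma FTC2_open_dominated f F g G a b : a < b ->
  (forall x, a < x < b -> `|f x| <= g x) ->
  (forall x, a < x < b -> {for x, continuous f}) ->
  (forall x, a < x < b -> {for x, continuous g}) ->
  (forall x, a < x < b -> is_derive x 1 F (f x)) ->
  (forall x, a < x < b -> is_derive x 1 G (g x)) ->
  F x @[x --> a^'+] --> F a -> F x @[x --> b^'-] --> F b ->
  G x @[x --> a^'+] --> G a -> G x @[x --> b^'-] --> G b ->
  \int[mu]_(x in `]a, b[) f x = F b - F a.
Proof.
move=> ab fg fc gc Fd Gd Fa Fb Ga Gb.
have g0 x : a < x < b -> 0 <= g x by move=> /fg; apply: le_trans.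
have fg0 x : a < x < b -> 0 <= f x + g x.
  by move=> /fg; rewrite ler_norml => /andP[]; rewrite -subr_ge0 opprK.
have fgc x : a < x < b -> {for x, continuous (f \+ g)}.
  by move=> xab; apply: cvgD; [exact: fc|exact: gc].
have FGd x : a < x < b -> is_derive x 1 (F \+ G) (f x + g x).
  by move=> xab; apply: is_deriveD; [exact: Fd|exact: Gd].
have FGa : (F \+ G) x @[x --> a^'+] --> (F \+ G) a by exact: cvgD.
have FGb : (F \+ G) x @[x --> b^'-] --> (F \+ G) b by exact: cvgD.
have i1 := FTC2_open_ge0 ab g0 gc Gd Ga Gb.
have i2 := FTC2_open_ge0 ab fg0 fgc FGd FGa FGb.
have j1 := FTC2_open_ge0_integrable ab g0 gc Gd Ga Gb.
have j2 := FTC2_open_ge0_integrable ab fg0 fgc FGd FGa FGb.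
transitivity (\int[mu]_(x in `]a, b[) ((f x + g x) - g x)).
  by apply: eq_Rintegral => x _; rewrite addrK.
rewrite RintegralB// /Rintegral i1 i2/=; ring.
Qed.

End open_FTC.

Section power_kernel.
Context {R : realType}.
Implicit Types (x y T alpha : R).
Local Notation mu := (@lebesgue_measure R).

Lemma cvg_powR_subr x alpha : 0 < alpha ->
  (y - x) `^ alpha @[y --> x^'+] --> (x - x) `^ alpha.
Proof.
move=> a0; rewrite subrr; apply/cvg_at_rightP => u [ux uc].
move/cvg_at_rightP : (powR_at0 a0); apply; split.
  by move=> n; rewrite subr_gt0.
by rewrite -(subrr x); apply: cvgB => //; exact: cvg_cst.
Qed.

Lemma cvg_powR_subl x alpha : 0 < alpha ->
  (x - y) `^ alpha @[y --> x^'-] --> (x - x) `^ alpha.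
Proof.
move=> a0; rewrite subrr; apply/cvg_at_leftP => u [ux uc].
move/cvg_at_rightP : (powR_at0 a0); apply; split.
  by move=> n; rewrite subr_gt0.
by rewrite -(subrr x); apply: cvgB => //; exact: cvg_cst.
Qed.

Lemma is_derive_powR_subr x y alpha : alpha != 0 -> x < y ->
  is_derive y 1 (fun z => (z - x) `^ alpha / alpha) ((y - x) `^ (alpha - 1)).
Proof.
move=> a0 xy; have d2 : is_derive y 1 (fun z => z - x) 1.
  by apply: is_derive_eq; rewrite subr0.
have yx : 0 < y - x by rewrite subr_gt0.
have d := @is_derive1_comp _ _ (fun z => z - x) _ _ _ (is_derive1_powR alpha yx) d2.
have := @is_deriveZ _ _ _ _ alpha^-1 _ _ _ d.
rewrite (_ : _ \*: _ = fun z => (z - x) `^ alpha / alpha); last first.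
  by apply/funext => z; rewrite mulrC.
by move/is_derive_eq; apply; rewrite /GRing.scale/= mulr1 mulrA mulVf// mul1r.
Qed.

Lemma is_derive_powR_subl x y alpha : alpha != 0 -> y < x ->
  is_derive y 1 (fun z => - ((x - z) `^ alpha / alpha)) ((x - y) `^ (alpha - 1)).
Proof.
move=> a0 xy; have d2 : is_derive y 1 (fun z => x - z) (- 1).
  by apply: is_derive_eq; rewrite add0r mul1r.
have yx : 0 < x - y by rewrite subr_gt0.
have d := @is_derive1_comp _ _ (fun z => x - z) _ _ _ (is_derive1_powR alpha yx) d2.
have := @is_deriveZ _ _ _ _ (- alpha^-1) _ _ _ d.
rewrite (_ : _ \*: _ = fun z => - ((x - z) `^ alpha / alpha)); last first.
  by apply/funext => z; rewrite /= /GRing.scale/= mulNr mulrC.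
by move/is_derive_eq; apply; rewrite /GRing.scale/=; field.
Qed.

Lemma continuous_powR_subr x y alpha : x < y ->
  {for y, continuous (fun z => (z - x) `^ alpha)}.
Proof.
move=> xy; apply: (@continuous_comp _ _ _ (fun z => z - x) (fun z => z `^ alpha)).
  by apply: cvgB; [exact: cvg_id|exact: cvg_cst].
by apply: powR_continuous_gt0; rewrite subr_gt0.
Qed.

Lemma continuous_powR_subl x y alpha : y < x ->
  {for y, continuous (fun z => (x - z) `^ alpha)}.
Proof.
move=> xy; apply: (@continuous_comp _ _ _ (fun z => x - z) (fun z => z `^ alpha)).
  by apply: cvgB; [exact: cvg_cst|exact: cvg_id].
by apply: powR_continuous_gt0; rewrite subr_gt0.
Qed.

Lemma integral_powR_subr x T alpha : 0 < alpha -> x < T ->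
  (\int[mu]_(y in `]x, T[) ((y - x) `^ (alpha - 1))%:E = ((T - x) `^ alpha / alpha)%:E)%E.
Proof.
move=> a0 xT; have an0 : alpha != 0 by rewrite gt_eqF.
etransitivity; first apply: (@FTC2_open_ge0 _ _ (fun z => (z - x) `^ alpha / alpha) x T xT).
- by move=> y _; exact: powR_ge0.
- by move=> y /andP[xy _]; exact: continuous_powR_subr.
- by move=> y /andP[xy _]; exact: is_derive_powR_subr.
- by apply: cvgMl; exact: cvg_powR_subr.
- by apply: cvgMl; apply: cvg_at_left_filter; exact: continuous_powR_subr.
- by rewrite /= subrr powR0// mul0r subr0.
Qed.

Lemma integral_powR_subl x T alpha : 0 < alpha -> T < x ->
  (\int[mu]_(y in `]T, x[) ((x - y) `^ (alpha - 1))%:E = ((x - T) `^ alpha / alpha)%:E)%E.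
Proof.
move=> a0 xT; have an0 : alpha != 0 by rewrite gt_eqF.
etransitivity; first apply: (@FTC2_open_ge0 _ _ (fun z => - ((x - z) `^ alpha / alpha)) T x xT).
- by move=> y _; exact: powR_ge0.
- by move=> y /andP[_ xy]; exact: continuous_powR_subl.
- by move=> y /andP[_ xy]; exact: is_derive_powR_subl.
- by apply: cvgN; apply: cvgMl; apply: cvg_at_right_filter; exact: continuous_powR_subl.
- by apply: cvgN; apply: cvgMl; exact: cvg_powR_subl.
- by rewrite /= subrr powR0// mul0r oppr0 sub0r opprK.
Qed.

Lemma integrable_powR_subl x T alpha : 0 < alpha -> T < x ->
  mu.-integrable `]T, x[ (EFin \o (fun y => (x - y) `^ (alpha - 1))).
Proof.
move=> a0 xT; apply/integrableP; split.
  apply/measurable_EFinP; apply: open_itv_measurable_fun => y /andP[_ yx].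
  exact: continuous_powR_subl.
under eq_integral do rewrite /= ger0_norm ?powR_ge0//.
by rewrite integral_powR_subl// ltry.
Qed.

Lemma integrable_powR_subr x T alpha : 0 < alpha -> x < T ->
  mu.-integrable `]x, T[ (EFin \o (fun y => (y - x) `^ (alpha - 1))).
Proof.
move=> a0 xT; apply/integrableP; split.
  apply/measurable_EFinP; apply: open_itv_measurable_fun => y /andP[xy _].
  exact: continuous_powR_subr.
under eq_integral do rewrite /= ger0_norm ?powR_ge0//.
by rewrite integral_powR_subr// ltry.
Qed.

End power_kernel.

(** * Differentiation of a convolution integral *)

Section volterra.
Context {R : realType}.
Local Notation mu := (@lebesgue_measure R).
Implicit Types (x y T s : R).
(** K is a primitive of a kernel k that may blow up at 0 like s^(alpha - 1); L is at
least the length of the interval of integration. *)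
Variables (alpha C L : R) (K k : R -> R).
Hypotheses (alpha0 : 0 < alpha) (alpha1 : alpha <= 1) (C0 : 0 <= C).
Hypothesis Kd : forall s : R, 0 < s -> is_derive s 1 K (k s).
Hypothesis kc : forall s : R, 0 < s -> {for s, continuous k}.
Hypothesis K0 : K s @[s --> 0^'+] --> K 0.
Hypothesis kb : forall s : R, 0 < s < L -> `|k s| <= C * s `^ (alpha - 1).

Lemma kernel_continuous_subr x y : x < y -> {for y, continuous (fun z => k (z - x))}.
Proof.
move=> xy; apply: (@continuous_comp _ _ _ (fun z => z - x) k).
  by apply: cvgB; [exact: cvg_id|exact: cvg_cst].
by apply: kc; rewrite subr_gt0.
Qed.

Lemma kernel_continuous_subl x y : y < x -> {for y, continuous (fun z => k (x - z))}.
Proof.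
move=> xy; apply: (@continuous_comp _ _ _ (fun z => x - z) k).
  by apply: cvgB; [exact: cvg_cst|exact: cvg_id].
by apply: kc; rewrite subr_gt0.
Qed.

(** The bound s^(alpha - 1) on the kernel is integrable, which permits the fundamental
theorem although k may be unbounded at 0. *)
Lemma kernel_integral x T : x < T -> T - x <= L ->
  \int[mu]_(y in `]x, T[) k (y - x) = K (T - x) - K 0.
Proof.
move=> xT TxL; have an0 : alpha != 0 by rewrite gt_eqF.
rewrite -[X in _ - K X](subrr x).
apply: (@FTC2_open_dominated _ _ (fun y => K (y - x))
   (fun y => C * (y - x) `^ (alpha - 1)) (fun y => C * ((y - x) `^ alpha / alpha))) => //.
- move=> y /andP[xy yT]; apply: kb.
  by rewrite subr_gt0 xy/= (lt_le_trans _ TxL)// ltrD2r.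
- by move=> y /andP[xy _]; exact: kernel_continuous_subr.
- by move=> y /andP[xy _]; apply: cvgMr; exact: continuous_powR_subr.
- move=> y /andP[xy _]; have d2 : is_derive y 1 (fun z => z - x) 1.
    by apply: is_derive_eq; rewrite subr0.
  have yx0 : 0 < y - x by rewrite subr_gt0.
  by have := @is_derive1_comp _ _ (fun z => z - x) _ _ _ (Kd yx0) d2; rewrite mulr1.
- by move=> y /andP[xy _]; exact: (is_deriveZ C (is_derive_powR_subr an0 xy)).
- apply/cvg_at_rightP => u [ux uc]; rewrite subrr.
  move/cvg_at_rightP : K0; apply; split; first by move=> n; rewrite subr_gt0.
  by rewrite -(subrr x); apply: cvgB => //; exact: cvg_cst.
- have h : {for T, continuous (fun y => K (y - x))}.
    apply: (@continuous_comp _ _ _ (fun z => z - x) K).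
      by apply: cvgB; [exact: cvg_id|exact: cvg_cst].
    by apply: (is_derive_continuous (Kd _)); rewrite subr_gt0.
  by apply: cvg_at_left_filter; exact: h.
- by apply: cvgMr; apply: cvgMl; exact: cvg_powR_subr.
- by apply: cvgMr; apply: cvgMl; apply: cvg_at_left_filter; exact: continuous_powR_subr.
Qed.

Lemma kernel_integrable x T : x < T -> T - x <= L ->
  mu.-integrable `]x, T[ (EFin \o (fun y => k (y - x))).
Proof.
move=> xT TxL; have := integrableZl (measurable_itvR `]x, T[) C (integrable_powR_subr alpha0 xT).
apply: le_integrable; first exact: measurable_itvR.
  apply/measurable_EFinP; apply: open_itv_measurable_fun => y /andP[xy _].
  exact: kernel_continuous_subr.
move=> y; rewrite /= in_itv/= => /andP[xy yT].
rewrite lee_fin [leRHS]ger0_norm ?mulr_ge0 ?powR_ge0//; apply: kb.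
by rewrite subr_gt0 xy/= (lt_le_trans _ TxL)// ltrD2r.
Qed.

Variables (F : R -> R) (a u : R).
Hypotheses (au : a < u) (uaL : u - a <= L).
Hypothesis Fint : mu.-integrable `]a, u[ (EFin \o F).
Hypothesis Fc : forall x : R, a < x < u -> {for x, continuous F}.

(** F(x) k(y - x) on the triangle a < x < y < T and 0 elsewhere, written as a
product of restrictions to intervals so that joint measurability is immediate. *)
Definition volterra_integrand T (z : R * R) : R :=
  (F \_ `]a, T[%classic) z.1 * (k \_ `]0, L[%classic) (z.2 - z.1)
    * ((cst 1 : R -> R) \_ `]a, T[%classic) z.2.

Lemma volterra_integrandE T x y : T <= u ->
  volterra_integrand T (x, y) =
  if [&& a < x, x < y & y < T] then F x * k (y - x) else 0.
Proof.
move=> Tu; rewrite /volterra_integrand /= !patchE !mem_setE !in_itv/=.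
have [/and3P[ax xy yT]|] := boolP [&& a < x, x < y & y < T].
  rewrite ax (lt_trans xy yT) subr_gt0 xy (lt_trans ax xy) yT/= mulr1.
  suff -> : y - x < L by [].
  apply: lt_le_trans uaL; rewrite ltrD ?ltrN2//; exact: lt_le_trans Tu.
case: (ltP a x) => [ax|]; last by rewrite !mul0r.
case: (ltP x y) => [xy|yx _].
  by case: (ltP y T) => [//|yT _]; rewrite andbF mulr0.
have -> : (0 < y - x) = false by rewrite subr_gt0 ltNge yx.
by rewrite /= mulr0 mul0r.
Qed.

Lemma measurable_volterra_integrand T : T <= u ->
  measurable_fun [set: R * R] (EFin \o volterra_integrand T).
Proof.
move=> Tu; apply/measurable_EFinP; apply: measurable_funM; first apply: measurable_funM.
- apply: (@measurableT_comp _ _ _ _ _ _ (F \_ `]a, T[%classic)); last exact: measurable_fst.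
  apply: measurable_patch_oo => x /andP[ax xT]; apply: Fc.
  by rewrite ax (lt_le_trans xT).
- apply: (@measurableT_comp _ _ _ _ _ _ (k \_ `]0, L[%classic)).
    by apply: measurable_patch_oo => x /andP[x0 _]; exact: kc.
  by apply: measurable_funB; [exact: measurable_snd|exact: measurable_fst].
- apply: (@measurableT_comp _ _ _ _ _ _ ((cst 1 : R -> R) \_ `]a, T[%classic)); last exact: measurable_snd.
  by apply: measurable_patch_oo => x _; exact: cvg_cst.
Qed.

Lemma volterra_section T x : T <= u -> (fun y => (volterra_integrand T (x, y))%:E) =
  if (a < x) && (x < T) then
    (fun y => (F x * k (y - x))%:E) \_ `]x, T[%classic else cst 0%E.
Proof.
move=> Tu; apply/funext => y; rewrite volterra_integrandE//.
case: ifPn => [/and3P[ax xy yT]|].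
  by rewrite ax (lt_trans xy yT)/= patchE mem_setE in_itv/= xy yT.
case: (ltP a x) => //= ax.
case: (ltP x T) => //= xT h.
by rewrite patchE mem_setE in_itv/= (negbTE h).
Qed.

Lemma volterra_cosection T y : T <= u -> (fun x => (volterra_integrand T (x, y))%:E) =
  if (a < y) && (y < T) then
    (fun x => (F x * k (y - x))%:E) \_ `]a, y[%classic else cst 0%E.
Proof.
move=> Tu; apply/funext => x; rewrite volterra_integrandE//.
case: ifPn => [/and3P[ax xy yT]|].
  by rewrite (lt_trans ax xy) yT/= patchE mem_setE in_itv/= ax xy.
case: (ltP y T) => [yT|Ty _]; last by rewrite andbF.
rewrite andbT => h; case: ifP => // ay.
by rewrite patchE mem_setE in_itv/= (negbTE h).
Qed.

(** Tonelli: the integral of |k(y - x)| in y is bounded, uniformly in x, by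
C (u - a)^alpha / alpha. *)
Lemma integrable_volterra_integrand T : a < T -> T <= u ->
  (mu \x mu)%E.-integrable [set: R * R] (EFin \o volterra_integrand T).
Proof.
move=> aT Tu; apply/(integrable12ltyP mu mu); first exact: measurable_volterra_integrand.
have Fi : mu.-integrable `]a, T[ (EFin \o F).
  by apply: integrableS Fint => //; apply: subset_itvl; rewrite bnd_simp.
pose M := C * ((u - a) `^ alpha / alpha).
have M0 : 0 <= M by rewrite mulr_ge0// divr_ge0 ?powR_ge0// ltW.
have FMi : mu.-integrable `]a, T[ (fun x => (`|F x|%:E * M%:E)%E).
  have := integrableZr (measurable_itvR `]a, T[) M (integrable_abse Fi).
  exact.
apply: (@le_lt_trans _ _ (\int[mu]_(x in `]a, T[) (`|F x|%:E * M%:E))%E).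
  rewrite [leRHS]integral_mkcond; apply: ge0_le_integral => //=.
  - by move=> x _; apply: integral_ge0 => y _; rewrite lee_fin.
  - apply: (@measurable_fun_fubini_tonelli_F _ _ (measurableTypeR R) (measurableTypeR R) R mu (abse \o (EFin \o volterra_integrand T))); last by move=> z; exact: abse_ge0.
    by apply: measurableT_comp => //; exact: measurable_volterra_integrand.
  - by have := (integrable_mkcond _ (measurable_itvR `]a, T[)).1 FMi => /measurable_int.
  move=> x _.
  have -> : (fun y => `|volterra_integrand T (x, y)|%:E) =
      abse \o (fun y => (volterra_integrand T (x, y))%:E) by [].
  rewrite volterra_section// patchE mem_setE in_itv/=.
  case: ifPn => [/andP[ax xT]|_]; last by rewrite integral0_eq// => y _ /=; rewrite normr0.
  have xTL : T - x <= L by apply: le_trans uaL; rewrite lerB// ltW.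
  have -> : (\int[mu]_y (abse \o (fun y => (F x * k (y - x))%:E) \_ `]x, T[%classic) y =
     \int[mu]_(y in `]x, T[) `|F x * k (y - x)|%:E)%E.
    rewrite [RHS]integral_mkcond; apply: eq_integral => y _.
    by rewrite /= !patchE; case: ifP => //=; rewrite normr0.
  apply: (@le_trans _ _ (\int[mu]_(y in `]x, T[) ((`|F x| * C)%:E * ((y - x) `^ (alpha - 1))%:E))%E).
    apply: ge0_le_integral => //=.
    - apply/measurable_EFinP; apply: measurableT_comp => //.
      apply: measurable_funM; first exact: measurable_cst.
      apply: open_itv_measurable_fun => y /andP[xy _]; exact: kernel_continuous_subr.
    - apply/measurable_EFinP; apply: measurable_funM; first exact: measurable_cst.
      apply: open_itv_measurable_fun => y /andP[xy _]; exact: continuous_powR_subr.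
    move=> y; rewrite in_itv/= => /andP[xy yT].
    rewrite lee_fin normrM -mulrA ler_wpM2l//; apply: kb.
    by rewrite subr_gt0 xy/= (lt_le_trans _ xTL)// ltrD2r.
  rewrite ge0_integralZl_EFin//; last 3 first.
  - by move=> y _; rewrite lee_fin powR_ge0.
  - by apply: measurable_int; exact: (integrable_powR_subr alpha0 xT).
  - by rewrite mulr_ge0.
  rewrite integral_powR_subr// -!EFinM lee_fin -mulrA ler_wpM2l// ler_wpM2l//.
  rewrite ler_wpM2r ?invr_ge0 ?(ltW alpha0)//; apply: ge0_ler_powR; rewrite ?nnegrE ?subr_ge0 ?(ltW alpha0) ?(ltW xT) ?(ltW au)//.
  by rewrite lerB// ltW.
have := integrable_lty (measurable_itvR `]a, T[) FMi.
by [].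
Qed.

Definition volterra_conv y := \int[mu]_(x in `]a, y[) (F x * k (y - x)).

(** The two singularities, that of F at a and that of the kernel at y, are separated by
the midpoint p: the kernel is bounded before p and F after p. *)
Lemma integrable_conv_integrand y : a < y < u ->
  mu.-integrable `]a, y[ (EFin \o (fun x => F x * k (y - x))).
Proof.
move=> /andP[ay yu]; pose p := (a + y) / 2.
have ap : a < p by rewrite /p; lra.
have py : p < y by rewrite /p; lra.
have [c _ cM] : exists2 c, c \in `[p, y] & forall x, x \in `[p, y] -> `|F x| <= `|F c|.
  apply: (@EVT_max _ (fun x => `|F x|)); first exact: ltW.
  apply: continuous_in_subspaceT => x; rewrite inE/= in_itv/= => /andP[px xy].
  by apply: cvg_norm; apply: Fc; rewrite (lt_le_trans ap px) (le_lt_trans xy yu).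
have Fi : mu.-integrable `]a, y[ (EFin \o F).
  by apply: integrableS Fint => //; apply: subset_itvl; rewrite bnd_simp ltW.
have i1 := integrableZl (measurable_itvR `]a, y[) (C * (y - p) `^ (alpha - 1)) (integrable_abse Fi).
have i2 := integrableZl (measurable_itvR `]a, y[) (`|F c| * C) (integrable_powR_subl alpha0 ay).
have := integrableD (measurable_itvR `]a, y[) i1 i2.
apply: le_integrable; first exact: measurable_itvR.
  apply/measurable_EFinP; apply: open_itv_measurable_fun => x /andP[ax xy].
  apply: cvgM; last exact: kernel_continuous_subl.
  by apply: Fc; rewrite ax (lt_trans xy yu).
move=> x; rewrite /= in_itv/= => /andP[ax xy].
have p1 : 0 <= C * (y - p) `^ (alpha - 1) * `|F x| by rewrite !mulr_ge0// powR_ge0.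
have p2 : 0 <= `|F c| * C * (y - x) `^ (alpha - 1) by rewrite !mulr_ge0// powR_ge0.
have yx0 : 0 < y - x by rewrite subr_gt0.
rewrite lee_fin [leRHS]ger0_norm ?addr_ge0// normrM.
have kk : `|k (y - x)| <= C * (y - x) `^ (alpha - 1).
  by apply: kb; rewrite yx0/= (lt_le_trans _ uaL)// ltrB.
have [xp|px] := leP x p.
  rewrite ler_wpDr// mulrC ler_wpM2r// (le_trans kk)// ler_wpM2l//.
  have yp0 : 0 < y - p by rewrite subr_gt0.
  have h := @ge0_ler_powR _ (1 - alpha) _ (y - p) (y - x).
  have {}h : (y - p) `^ (1 - alpha) <= (y - x) `^ (1 - alpha).
    by apply: h; rewrite ?nnegrE ?subr_ge0 ?(ltW py) ?(ltW xy)// lerD2l lerN2.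
  by rewrite -(opprB 1 alpha) !powRN lef_pV2// posrE powR_gt0.
rewrite ler_wpDl// -mulrA; apply: ler_pM => //.
by apply: cM; rewrite in_itv/= (ltW px) (ltW xy).
Qed.

Lemma volterra_section_integral T x : T <= u ->
  (\int[mu]_y (volterra_integrand T (x, y))%:E)%E =
  ((fun x => (F x * (K (T - x) - K 0))%:E) \_ `]a, T[%classic) x.
Proof.
move=> Tu; rewrite volterra_section// patchE mem_setE in_itv/=.
case: ifPn => [/andP[ax xT]|_]; last exact: integral0.
have xTL : T - x <= L by apply: le_trans uaL; rewrite lerB// ltW.
have ki := kernel_integrable xT xTL.
rewrite -integral_mkcond; under eq_integral do rewrite EFinM.
rewrite (integralZl (measurable_itvR `]x, T[) ki) EFinM -(kernel_integral xT xTL).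
by rewrite /Rintegral fineK//; exact: (integrable_fin_num (measurable_itvR `]x, T[) ki).
Qed.

Lemma volterra_cosection_integral T y : T <= u ->
  (\int[mu]_x (volterra_integrand T (x, y))%:E)%E =
  ((fun y => (volterra_conv y)%:E) \_ `]a, T[%classic) y.
Proof.
move=> Tu; rewrite volterra_cosection// patchE mem_setE in_itv/=.
case: ifPn => [/andP[ay yT]|_]; last exact: integral0.
rewrite -integral_mkcond /volterra_conv /Rintegral fineK//.
apply: (integrable_fin_num (measurable_itvR `]a, y[)).
by apply: integrable_conv_integrand; rewrite ay (lt_le_trans yT).
Qed.

(** Both sides are iterated integrals of [volterra_integrand]; integrating in y first
reproduces K by [kernel_integral]. *)
Lemma volterra_fubini T : a < T <= u ->
  (\int[mu]_(x in `]a, T[) (F x * (K (T - x) - K 0))%:E =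
   \int[mu]_(y in `]a, T[) (volterra_conv y)%:E)%E.
Proof.
move=> /andP[aT Tu]; rewrite integral_mkcond [RHS]integral_mkcond.
transitivity (\int[mu]_x \int[mu]_y (volterra_integrand T (x, y))%:E)%E.
  by apply: eq_integral => x _; exact: esym (volterra_section_integral x Tu).
etransitivity; first exact: (Fubini (integrable_volterra_integrand aT Tu)).
by apply: eq_integral => y _; exact: volterra_cosection_integral.
Qed.

(** The inner integrals of an integrable function of two variables are integrable. *)
Lemma integrable_volterra_conv : mu.-integrable `]a, u[ (EFin \o volterra_conv).
Proof.
have i := integrable_volterra_integrand au (lexx u).
have mi := measurable_volterra_integrand (lexx u).
have : mu.-integrable setT (fubini_G mu (EFin \o volterra_integrand u)).
  apply/integrableP; split; first exact: (measurable_fubini_G i).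
  apply: le_lt_trans ((integrable21ltyP mu mu mi).1 i).
  apply: ge0_le_integral => //.
  - by apply: measurableT_comp => //; exact: (measurable_fubini_G i).
  - apply: (@measurable_fun_fubini_tonelli_G _ _ (measurableTypeR R) (measurableTypeR R) R mu (abse \o (EFin \o volterra_integrand u))); last by move=> z; exact: abse_ge0.
    exact: measurableT_comp.
  - move=> y _; apply: le_abse_integral => //.
    by apply: measurableT_comp => //; exact: measurable_pair2.
move/(integrableS measurableT (measurable_itvR `]a, u[) (@subsetT _ _)).
apply: eq_integrable; first exact: measurable_itvR.
move=> y; rewrite inE/= => yau; etransitivity; first exact: volterra_cosection_integral.
by rewrite patchE mem_set.
Qed.

Lemma integrable_kernel_conv T : a < T <= u ->
  mu.-integrable `]a, T[ (EFin \o (fun x => F x * (K (T - x) - K 0))).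
Proof.
move=> /andP[aT Tu].
have := integrable_fubini_F (integrable_volterra_integrand aT Tu).
move/(integrableS measurableT (measurable_itvR `]a, T[) (@subsetT _ _)).
apply: eq_integrable; first exact: measurable_itvR.
move=> x; rewrite inE/= => xaT; etransitivity; first exact: volterra_section_integral.
by rewrite patchE mem_set.
Qed.

(** Close to the singularity of the kernel, the contribution to the convolution is small
uniformly in y as long as F is bounded there. *)
Lemma conv_tail_le M p y : a < p -> p < y -> y < u ->
  (forall x, p < x < y -> `|F x| <= M) ->
  `|\int[mu]_(x in `]p, y[) (F x * k (y - x))| <= M * C * ((y - p) `^ alpha / alpha).
Proof.
move=> ap py yu FM.
have ay := lt_trans ap py.
have M0 : 0 <= M.
  by apply: le_trans (FM ((p + y) / 2) _) => //; apply/andP; split; lra.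
have fi : mu.-integrable `]p, y[ (EFin \o (fun x => F x * k (y - x))).
  apply: integrableS (integrable_conv_integrand _) => //; last by rewrite ay.
  by apply: subset_itvr; rewrite bnd_simp ltW.
have pi := integrable_powR_subl alpha0 py.
apply: (le_trans (le_normr_Rintegral (measurable_itvR `]p, y[) fi)).
have -> : M * C * ((y - p) `^ alpha / alpha) =
    \int[mu]_(x in `]p, y[) (M * C * (y - x) `^ (alpha - 1)).
  rewrite (RintegralZl _ (measurable_itvR `]p, y[))//; congr (_ * _).
  by rewrite /Rintegral integral_powR_subl.
apply: (le_Rintegral (measurable_itvR `]p, y[)).
- exact: (integrable_abse fi).
- by have := integrableZl (measurable_itvR `]p, y[) (M * C) pi.
move=> x; rewrite /= in_itv/= => /andP[px xy].
rewrite normrM -mulrA ler_pM//; first by apply: FM; rewrite px.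
by apply: kb; rewrite subr_gt0 xy/= (lt_le_trans _ uaL)// ltrB// (lt_trans ap px).
Qed.

Lemma conv_split p y : a < p -> p < y -> y < u ->
  volterra_conv y = \int[mu]_(x in `]a, p]) (F x * k (y - x)) +
    \int[mu]_(x in `]p, y[) (F x * k (y - x)).
Proof.
move=> ap py yu; have fi := integrable_conv_integrand (y := y).
have := Rintegral_itvB (x := p) (fi _).
rewrite !bnd_simp (lt_trans ap py) yu => /(_ isT (ltW ap) py) <-.
by rewrite addrC subrK.
Qed.

(** Cut the integral at p slightly below t.  The part over ]p, y[ is small by
[conv_tail_le]; on ]a, p] the kernel stays away from its singularity, and dominated
convergence applies. *)
Lemma continuous_volterra_conv t : a < t < u -> {for t, continuous volterra_conv}.
Proof.
move=> /andP[at_ tu].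
have tc : {for t, continuous F} by apply: Fc; rewrite at_.
pose M := `|F t| + 1; have M0 : 0 < M by rewrite ltr_pwDr.
have /cvgrPdist_lt/(_ _ ltr01)[d0 /= d00 d0P] := tc.
have FM x : `|t - x| < d0 -> `|F x| <= M.
  move=> h; have := d0P x h; rewrite distrC => {}h.
  have -> : F x = F t + (F x - F t) by ring.
  by rewrite (le_trans (ler_normD _ _))// lerD2l ltW.
apply/cvgrPdist_le => e e0.
have [h0 [h00 h0e]] : exists h0, 0 < h0 /\ forall h, 0 < h <= h0 ->
    M * C * (h `^ alpha / alpha) <= e / 3.
  have : (fun h => M * C * (h `^ alpha / alpha)) h @[h --> 0^'+] --> M * C * (0 / alpha).
    apply: cvgMr; apply: cvgMl; exact: powR_cvg0.
  rewrite mul0r mulr0 => /cvgrPdist_le/(_ (e / 3)).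
  rewrite divr_gt0// => /(_ isT)[r /= r0 rP].
  exists (r / 2); split; first by rewrite divr_gt0.
  move=> h /andP[hh hr]; have := rP h; rewrite /ball_ /= !sub0r !normrN.
  rewrite ger0_norm ?(ltW hh)// => /(_ _ hh) H.
  by apply: (le_trans (ler_norm _)); apply: H; lra.
(* The distance from p to t: short enough for the tail, for the bound on F, and to
   keep p and the points near t inside ]a, u[. *)
pose q := Num.min (Num.min (h0 / 2) (d0 / 2)) (Num.min ((t - a) / 2) (u - t)).
have q0 : 0 < q by rewrite !lt_min !divr_gt0 ?subr_gt0.
have [qh qd qa qu] : [/\ q <= h0 / 2, q <= d0 / 2, q <= (t - a) / 2 & q <= u - t].
  by split; rewrite /q !ge_min lexx ?orbT.
pose p := t - q.
have ap : a < p by rewrite /p; lra.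
have pt : p < t by rewrite /p; lra.
have tail y : `|t - y| < q / 2 -> p < y -> y < u -> `|\int[mu]_(x in `]p, y[) (F x * k (y - x))| <= e / 3.
  move=> ty py yu; apply: (@le_trans _ _ (M * C * ((y - p) `^ alpha / alpha))).
    apply: conv_tail_le => // x /andP[px xy]; apply: FM.
    by move: ty px xy; rewrite /p !ltr_norml => /andP[h1 h2] h3 h4; apply/andP; split; lra.
  apply: h0e; rewrite subr_gt0 py/=.
  by move: ty; rewrite /p ltr_norml => /andP[h1 h2]; lra.
pose I1 y := \int[mu]_(x in `]a, p]) (F x * k (y - x)).
have I1c : {for t, continuous I1}.
  have Fi : mu.-integrable `]a, p] (EFin \o F).
    apply: integrableS Fint => //.
    by apply: subset_itvl; rewrite bnd_simp (lt_trans pt tu).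
  have tin : t \in `]t - q / 2, t + q / 2[%classic.
    by rewrite inE/= in_itv/=; apply/andP; split; lra.
  apply: (@continuity_under_integral _ _ (measurableTypeR R) mu (fun y x => F x * k (y - x)) `]a, p] (measurable_itvR _) _ _ _ _ (fun x => C * (q / 2) `^ (alpha - 1) * `|F x|)) tin.
  - move=> y; rewrite /= in_itv/= => /andP[y1 y2].
    have yu : a < y < u by apply/andP; split; move: y1 y2; rewrite ?/p; lra.
    apply: integrableS (integrable_conv_integrand yu) => //.
    by apply: subset_itvl; rewrite bnd_simp /p; lra.
  - apply/aeW => x; rewrite /= in_itv/= => /andP[ax xp] y; rewrite inE/= in_itv/= => /andP[y1 y2].
    apply: cvgMr; apply: kernel_continuous_subr.
    by move: xp y1; rewrite /p; lra.
  - by have := integrableZl (measurable_itvR `]a, p]) (C * (q / 2) `^ (alpha - 1)) (integrable_abse Fi).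
  - move=> y; rewrite /= in_itv/= => /andP[y1 y2]; apply/aeW => x; rewrite /= in_itv/= => /andP[ax xp].
    rewrite normrM mulrC ler_wpM2r//.
    have yx : q / 2 <= y - x by move: xp y1; rewrite /p; lra.
    have q20 : 0 < q / 2 by rewrite divr_gt0.
    have yx0 : 0 < y - x by exact: lt_le_trans yx.
    apply: (le_trans (kb _)).
      by rewrite yx0/= (lt_le_trans _ uaL)//; lra.
    rewrite ler_wpM2l// -(opprB 1 alpha) !powRN lef_pV2 ?posrE ?powR_gt0//.
    by apply: ge0_ler_powR; rewrite ?nnegrE ?(ltW q20) ?(ltW yx0) ?subr_ge0.
have e30 : 0 < e / 3 by rewrite divr_gt0.
have /cvgrPdist_le/(_ _ e30) I1t := I1c.
near=> y.
have ty : `|t - y| < q / 2.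
  by near: y; apply: cvgr_dist_lt => //; rewrite divr_gt0.
have [y1 y2] : p < y /\ y < u.
  by move: ty; rewrite ltr_norml /p => /andP[h1 h2]; split; lra.
rewrite (conv_split ap pt tu) (conv_split ap y1 y2).
have i1 : `|I1 t - I1 y| <= e / 3 by near: y.
have tt : `|t - t| < q / 2 by rewrite subrr normr0 divr_gt0.
have i2 := tail t tt pt tu; have i3 := tail y ty y1 y2.
rewrite opprD addrACA (le_trans (ler_normD _ _))//.
have -> : e = e / 3 + (e / 3 + e / 3) by field.
by rewrite lerD// (le_trans (ler_normB _ _))// lerD.
Unshelve. all: by end_near. Qed.

Hypothesis K01 : K 0 = 1.

(** By [volterra_fubini] and K 0 = 1, the convolution integral is a primitive of
F + volterra_conv, which is continuous at t. *)
Lemma volterra_derive t : a < t < u ->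
  is_derive t 1 (fun T => \int[mu]_(x in `[a, T]) (F x * K (T - x))) (F t + volterra_conv t).
Proof.
move=> /andP[at_ tu].
pose G x := F x + volterra_conv x.
have Gi : mu.-integrable `]a, u[ (EFin \o G).
  by have := integrableD (measurable_itvR `]a, u[) Fint integrable_volterra_conv.
pose v := (t + u) / 2.
have tv : t < v by rewrite /v; lra.
have vu : v < u by rewrite /v; lra.
have Gi2 : mu.-integrable `]a, v] (EFin \o G).
  by apply: integrableS Gi => //; apply: subset_itvl; rewrite bnd_simp.
have Gc : {for t, continuous G}.
  by apply: cvgD; [apply: Fc|apply: continuous_volterra_conv]; rewrite at_.
have [Hd HE] := @continuous_FTC1 _ G (BRight a) t v tv Gi2 at_ Gc.
have d : is_derive t 1 (fun T => \int[mu]_(x in `]a, T]) G x) (F t + volterra_conv t).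
  by apply: DeriveDef; [exact: Hd|rewrite -derive1E; exact: HE].
apply: near_eq_is_derive d.
near=> T.
have aT : a < T by near: T; exact: lt_nbhsr.
have Tu : T < u by near: T; exact: lt_nbhsl.
have Fi : mu.-integrable `]a, T[ (EFin \o F).
  by apply: integrableS Fint => //; apply: subset_itvl; rewrite bnd_simp ltW.
have Qi : mu.-integrable `]a, T[ (EFin \o volterra_conv).
  by apply: integrableS integrable_volterra_conv => //; apply: subset_itvl; rewrite bnd_simp ltW.
have aTu : a < T <= u by rewrite aT ltW.
have Ki := integrable_kernel_conv aTu.
have FKi : mu.-integrable `]a, T[ (EFin \o (fun x => F x * K (T - x))).
  have := integrableD (measurable_itvR `]a, T[) Fi Ki; apply: eq_integrable; first exact: measurable_itvR.
  by move=> x _; rewrite /= -EFinD; congr EFin; rewrite K01; ring.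
rewrite -Rintegral_itv_bndo_bndc; last first.
  by apply: integrableS Gi => //; apply: subset_itvl; rewrite bnd_simp ltW.
transitivity (\int[mu]_(x in `]a, T[) (F x * K (T - x))).
  rewrite (RintegralD (measurable_itvR `]a, T[))//.
  have -> : \int[mu]_(x in `]a, T[) volterra_conv x =
      \int[mu]_(x in `]a, T[) (F x * (K (T - x) - K 0)).
    by rewrite /Rintegral (volterra_fubini aTu).
  rewrite -(RintegralD (measurable_itvR `]a, T[))//; apply: eq_Rintegral => x _.
  by rewrite K01; ring.
rewrite Rintegral_itv_bndo_bndc// /Rintegral integral_itv_obnd_cbnd//.
by apply/emeasurable_fun_itv_bndo_bndcP; exact: (measurable_int mu).
Unshelve. all: by end_near. Qed.

End volterra.

(** * The Mittag-Leffler kernel *)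

Section mittag_leffler_kernel.
Context {R : realType}.
Implicit Types (x s : R).
Variables (alpha c : R).
Hypothesis alpha0 : 0 < alpha.

Definition ml_coef (n : nat) : R := (Gamma (alpha * n%:R + 1))^-1.

Lemma ml_coef_gt0 n : 0 < ml_coef n.
Proof. by rewrite invr_gt0 Gamma_gt0// mulr_ge0// ltW. Qed.

Lemma ml_coef0 : ml_coef 0 = 1.
Proof. by rewrite /ml_coef mulr0 add0r Gamma1 invr1. Qed.

(** [Gamma_ge] with A such that A^alpha = rho + 1 bounds the coefficient of index n by
a constant times (rho + 1)^(-n). *)
Lemma ml_coef_entire r : radius_ge ml_coef r.
Proof.
move=> rho /andP[rho0 _]; pose A := (rho + 1) `^ alpha^-1.
have r1 : 0 < rho + 1 by rewrite ltr_wpDl.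
have A0 : 0 < A by rewrite powR_gt0.
have AE n : A `^ (alpha * n%:R) = (rho + 1) ^+ n.
  by rewrite /A -powRrM mulrA mulVf ?gt_eqF// mul1r powR_mulrn// ltW.
exists (expR (A + 1)) => n; rewrite ger0_norm ?(ltW (ml_coef_gt0 n))//.
have an : 0 <= alpha * n%:R by rewrite mulr_ge0// ltW.
have := Gamma_ge an A0; rewrite AE expRN => h.
rewrite /ml_coef mulrC ler_pdivrMr ?Gamma_gt0//.
apply: (@le_trans _ _ (expR (A + 1) * ((rho + 1) ^+ n / expR (A + 1)))).
  rewrite mulrCA mulfV ?gt_eqF ?expR_gt0// mulr1.
  by rewrite lerXn2r ?nnegrE ?(ltW r1)// lerDl.
by rewrite ler_wpM2l ?expR_ge0.
Qed.

Lemma mittag_lefflerE x : mittag_leffler alpha x = psum ml_coef x.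
Proof.
rewrite /mittag_leffler /psum /pseries; congr (limn (series _)).
by apply/funext => n; rewrite mulrC.
Qed.

Definition ml_kernel s := mittag_leffler alpha (c * s `^ alpha).

(** The derivative of [ml_kernel] on ]0, +oo[, by the chain rule. *)
Definition ml_kernel' s :=
  psum (pseries_diffs ml_coef) (c * s `^ alpha) * (c * (alpha * s `^ (alpha - 1))).

Lemma is_derive_ml x : is_derive x 1 (psum ml_coef) (psum (pseries_diffs ml_coef) x).
Proof. by apply: (@is_derive_psum _ _ (`|x| + 1)); [exact: ml_coef_entire|rewrite ltrDl]. Qed.

Lemma is_derive_ml' x : is_derive x 1 (psum (pseries_diffs ml_coef))
  (psum (pseries_diffs (pseries_diffs ml_coef)) x).
Proof.
apply: (@is_derive_psum _ _ (`|x| + 1)); last by rewrite ltrDl.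
exact/radius_ge_diffs/ml_coef_entire.
Qed.

Lemma is_derive_ml_kernel s : 0 < s -> is_derive s 1 ml_kernel (ml_kernel' s).
Proof.
move=> s0; have -> : ml_kernel = psum ml_coef \o (fun s => c * s `^ alpha).
  by apply/funext => y; rewrite /ml_kernel mittag_lefflerE.
have d : is_derive s 1 (fun s => c * s `^ alpha) (c * (alpha * s `^ (alpha - 1))).
  exact: (is_deriveZ c (is_derive1_powR alpha s0)).
exact: (@is_derive1_comp _ _ (fun s => c * s `^ alpha) _ _ _ (is_derive_ml _) d).
Qed.

Lemma continuous_ml_kernel' s : 0 < s -> {for s, continuous ml_kernel'}.
Proof.
move=> s0; apply: cvgM; last by apply: cvgMr; apply: cvgMr; exact: powR_continuous_gt0.
apply: (@continuous_comp _ _ _ (fun s => c * s `^ alpha) (psum (pseries_diffs ml_coef))).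
  by apply: cvgMr; exact: powR_continuous_gt0.
exact: (is_derive_continuous (is_derive_ml' _)).
Qed.

Lemma ml_kernel0 : ml_kernel 0 = 1.
Proof. by rewrite /ml_kernel mittag_lefflerE powR0 ?gt_eqF// mulr0 psum0 ml_coef0. Qed.

Lemma ml_kernel_cvg0 : ml_kernel s @[s --> 0^'+] --> ml_kernel 0.
Proof.
rewrite /ml_kernel mittag_lefflerE.
have -> : (fun s => mittag_leffler alpha (c * s `^ alpha)) =
    psum ml_coef \o (fun s => c * s `^ alpha).
  by apply/funext => y; rewrite mittag_lefflerE.
apply: cvg_comp; first by apply: cvgMr; exact: powR_at0.
exact: (is_derive_continuous (is_derive_ml _)).
Qed.

Lemma ml_kernel'_le L : exists C, 0 <= C /\
  forall s, 0 < s < L -> `|ml_kernel' s| <= C * s `^ (alpha - 1).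
Proof.
(* The argument c s^alpha ranges over [- X, X], where the derivative of the
   Mittag-Leffler series is bounded; the 1 keeps the segment nondegenerate. *)
pose X := `|c| * L `^ alpha + 1.
have X0 : 0 <= X by rewrite addr_ge0// mulr_ge0// powR_ge0.
have [m _ mP] : exists2 m, m \in `[- X, X] & forall x, x \in `[- X, X] ->
    `|psum (pseries_diffs ml_coef) x| <= `|psum (pseries_diffs ml_coef) m|.
  apply: (@EVT_max _ (fun x => `|psum (pseries_diffs ml_coef) x|)); first by lra.
  apply: continuous_in_subspaceT => x _; apply: cvg_norm.
  exact: (is_derive_continuous (is_derive_ml' _)).
exists (`|psum (pseries_diffs ml_coef) m| * (`|c| * alpha)).
split; first by rewrite !mulr_ge0// ltW.
move=> s /andP[s0 sL].
rewrite /ml_kernel' !normrM (ger0_norm (powR_ge0 _ _)) (ger0_norm (ltW alpha0)).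
rewrite !mulrA ler_wpM2r ?powR_ge0// ler_wpM2r ?(ltW alpha0)// ler_wpM2r//.
apply: mP; rewrite in_itv/= -ler_norml normrM (ger0_norm (powR_ge0 _ _)).
rewrite /X ler_wpDr// ler_wpM2l//; apply: ge0_ler_powR; rewrite ?nnegrE ?(ltW alpha0) ?(ltW s0)//.
  by rewrite ltW// (lt_trans s0).
exact: ltW.
Qed.

(** The coefficients of k(s) = sum_m k_m s^(alpha m - 1); the one of index 0 vanishes. *)
Definition ml_kernel_coef (m : nat) : R := c ^+ m * (alpha * m%:R) * ml_coef m.

Lemma ml_kernel'_series s : 0 < s ->
  series (fun m => ml_kernel_coef m * s `^ (alpha * m%:R - 1)) @ \oo --> ml_kernel' s.
Proof.
move=> s0; have h : cvgn (pseries (pseries_diffs ml_coef) (c * s `^ alpha)).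
  apply: (@radius_ge_series _ _ (`|c * s `^ alpha| + 1)); last by rewrite ltrDl.
  exact/radius_ge_diffs/ml_coef_entire.
have {}h : (fun N => pseries (pseries_diffs ml_coef) (c * s `^ alpha) N * (c * (alpha * s `^ (alpha - 1)))) @ \oo
   --> ml_kernel' s by apply: cvgMl; exact: h.
rewrite -(cvg_shiftS (series _)); apply: cvg_trans h; apply: near_eq_cvg; near=> N.
rewrite /series /= big_nat_recl// /ml_kernel_coef !mulr0 !mul0r add0r /pseries /series/= mulr_suml.
apply: eq_bigr => m _; rewrite /pseries_diffs.
have -> : s `^ (alpha * m.+1%:R - 1) = (s `^ alpha) ^+ m * s `^ (alpha - 1).
  rewrite -powR_mulrn ?powR_ge0// -powRrM -powRD; last by rewrite (gt_eqF s0) implybT.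
  by congr (_ `^ _); rewrite -natr1; ring.
by rewrite exprMn exprS; ring.
Unshelve. all: by end_near. Qed.

Lemma ml_kernel_series s : 0 <= s ->
  series (fun m => c ^+ m * ml_coef m * s `^ (alpha * m%:R)) @ \oo --> ml_kernel s.
Proof.
move=> s0; have h : cvgn (pseries ml_coef (c * s `^ alpha)).
  by apply: (@radius_ge_series _ _ (`|c * s `^ alpha| + 1)); [exact: ml_coef_entire|rewrite ltrDl].
rewrite /ml_kernel mittag_lefflerE; apply: cvg_trans (h : _ --> psum _ _); apply: near_eq_cvg; near=> N.
apply: eq_bigr => m _; rewrite /= powRrM powR_mulrn ?powR_ge0//.
by rewrite exprMn; ring.
Unshelve. all: by end_near. Qed.

End mittag_leffler_kernel.

(** The absolute values are the coefficients for |c|, whose series converges by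
[ml_kernel'_series]. *)
Lemma ml_kernel_coef_summable {R : realType} (alpha c r : R) : 0 < alpha -> 0 < r ->
  exists M, forall N,
  \sum_(0 <= m < N) `|ml_kernel_coef alpha c m| * r `^ (alpha * m%:R) <= M.
Proof.
move=> a0 r0; have h := @ml_kernel'_series R alpha `|c| a0 r r0.
pose l := ml_kernel' alpha `|c| r.
have t0 m : 0 <= ml_kernel_coef alpha `|c| m * r `^ (alpha * m%:R - 1).
  by rewrite /ml_kernel_coef !mulr_ge0 ?powR_ge0 ?exprn_ge0 ?(ltW a0)// ltW// ml_coef_gt0.
exists (r * l) => N.
have : series (fun m => ml_kernel_coef alpha `|c| m * r `^ (alpha * m%:R - 1)) N <= l.
  rewrite /l -(cvg_lim _ h)//; apply: nondecreasing_cvgn_le; first exact: series_le_nondecr.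
  by apply/cvg_ex; exists l.
rewrite -(ler_pM2l r0); apply: le_trans; rewrite mulr_sumr; apply: ler_sum => m _.
rewrite mulrCA [r * _](_ : _ = r `^ (alpha * m%:R)); last first.
  rewrite -{1}(powRr1 (ltW r0)) -powRD; last by rewrite (gt_eqF r0) implybT.
  by rewrite addrC subrK.
rewrite ler_wpM2r ?powR_ge0// /ml_kernel_coef !normrM normrX.
by rewrite (ger0_norm (ltW a0)) normr_nat (ger0_norm (ltW (ml_coef_gt0 a0 m))).
Qed.

(** * Termwise integration of the convolution *)

Section integral_series.
Context {R : realType}.
Local Notation mu := (@lebesgue_measure R).

Lemma Rintegral_sum (A : set (measurableTypeR R)) (g : nat -> R -> R) N :
  measurable A -> (forall n, mu.-integrable A (EFin \o g n)) ->
  mu.-integrable A (EFin \o (fun x => \sum_(0 <= n < N) g n x)) /\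
  \int[mu]_(x in A) (\sum_(0 <= n < N) g n x) = \sum_(0 <= n < N) \int[mu]_(x in A) g n x.
Proof.
move=> mA gi; elim: N => [|N [IH1 IH2]].
  have E : (fun x => \sum_(0 <= n < 0) g n x) = cst 0 by apply/funext => x; rewrite big_geq.
  by rewrite E big_geq//; split; [exact: integrable0|rewrite /Rintegral integral0].
have E : (fun x => \sum_(0 <= n < N.+1) g n x) = (fun x => \sum_(0 <= n < N) g n x + g N x).
  by apply/funext => x; rewrite big_nat_recr.
rewrite E big_nat_recr//= -IH2; split; last by rewrite RintegralD.
by have := integrableD mA IH1 (gi N).
Qed.

(** The sum of the |g n| is integrable and dominates all partial sums. *)
Lemma Rintegral_series (A : set (measurableTypeR R)) (g : nat -> R -> R) (S : R -> R) M :
  measurable A ->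
  (forall n, mu.-integrable A (EFin \o g n)) ->
  (forall N, \sum_(0 <= n < N) \int[mu]_(x in A) `|g n x| <= M) ->
  (forall x, A x -> series (g ^~ x) @ \oo --> S x) ->
  [/\ mu.-integrable A (EFin \o S), \int[mu]_(x in A) `|S x| <= M &
    series (fun n => \int[mu]_(x in A) g n x) @ \oo --> \int[mu]_(x in A) S x].
Proof.
move=> mA gi gM gS.
pose h x := (\sum_(0 <= n <oo) `|g n x|%:E)%E.
have mg n : measurable_fun A (EFin \o g n) by exact: (measurable_int mu).
have mag n : measurable_fun A (fun x => `|g n x|%:E).
  by have := measurable_int mu (integrable_abse (gi n)).
have ihE : (\int[mu]_(x in A) h x <= M%:E)%E.
  rewrite /h integral_nneseries//.
  apply: lime_le; first by apply: is_cvg_nneseries => n _ _; apply: integral_ge0 => x _; rewrite lee_fin.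
  near=> N; apply: le_trans (_ : _ <= (\sum_(0 <= n < N) \int[mu]_(x in A) `|g n x|)%:E)%E _; last by rewrite lee_fin.
  rewrite -sumEFin; apply: lee_sum => n _; rewrite /Rintegral fineK//.
  exact: (integrable_fin_num mA (integrable_abse (gi n))).
have h0 x : (0 <= h x)%E by apply: nneseries_ge0 => n _ _; rewrite lee_fin.
have ih : mu.-integrable A h.
  apply/integrableP; split.
    by apply: ge0_emeasurable_sum => // n x _ _; rewrite lee_fin.
  have -> : (\int[mu]_(x in A) `|h x| = \int[mu]_(x in A) h x)%E.
    by apply: eq_integral => x _; rewrite gee0_abs.
  by apply: le_lt_trans ihE _; rewrite ltry.
have mf N : measurable_fun A (fun x => (series (g ^~ x) N)%:E).
  rewrite (_ : (fun _ => _) = (fun x => \sum_(0 <= n < N) (g n x)%:E)%E).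
    by apply: emeasurable_sum => n; exact: mg.
  by apply/funext => x; rewrite sumEFin.
have fS x : A x -> (series (g ^~ x) N)%:E @[N --> \oo] --> (S x)%:E.
  by move=> Ax; apply: cvg_EFin; [near=> N|exact: gS].
have mS : measurable_fun A (EFin \o S).
  by apply: (emeasurable_fun_cvg _ _ mf).
have dom x N : A x -> (`|(series (g ^~ x) N)%:E| <= h x)%E.
  move=> Ax; apply: le_trans (nneseries_lim_ge N _); last by move=> n _ _; rewrite lee_fin.
  by rewrite sumEFin lee_fin; exact: ler_norm_sum.
have [iS _ cvgI] := dominated_convergence mA mf mS (aeW _ fS) ih (aeW _ (fun x N => dom x N)).
split => //.
  rewrite -lee_fin; apply: le_trans ihE; rewrite /Rintegral fineK; last first.
    exact: (integrable_fin_num mA (integrable_abse iS)).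
  apply: ge0_le_integral => //.
  - by have := measurable_int mu (integrable_abse iS).
  - exact: (measurable_int mu ih).
  move=> x Ax.
  have hc : `|(series (g ^~ x) N)%:E|%E @[N --> \oo] --> `|S x|%:E.
    by apply: cvg_EFin; [near=> N|apply: cvg_norm; exact: gS].
  rewrite -(cvg_lim _ hc)//; apply: lime_le; first by apply/cvg_ex; exists `|S x|%:E.
  by near=> N; exact: dom.
have -> : series (fun n => \int[mu]_(x in A) g n x) =
    (fun N => fine (\int[mu]_(x in A) (series (g ^~ x) N)%:E)).
  by apply/funext => N; have [_ E] := Rintegral_sum N mA gi; exact: (esym E).
rewrite /Rintegral; apply: fine_cvg; rewrite fineK//.
exact: (integrable_fin_num mA iS).
Unshelve. all: by end_near. Qed.

End integral_series.

Section convolution_series.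
Context {R : realType}.
Local Notation mu := (@lebesgue_measure R).
Variables (alpha c a t M0 : R) (F : R -> R) (cf : nat -> R).
Hypotheses (alpha0 : 0 < alpha) (alpha1 : alpha < 1) (at_ : a < t).
Hypothesis cfM : forall N, \sum_(0 <= n < N) `|cf n| * (t - a) ^+ n / n.+1%:R <= M0.
Hypothesis Fseries : forall x : R, a < x < t -> series (fun n => cf n * (x - t) ^+ n) @ \oo --> F x.

(** The n-th term integrates to a multiple of r^(n + beta) / (n + beta), and
1 / (n + beta) <= 1 / (alpha (n + 1)) because alpha <= beta and alpha <= 1; so the
weighted summability of cf is enough. *)
Lemma power_conv_series beta : alpha <= beta ->
  [/\ mu.-integrable `]a, t[ (EFin \o (fun x => F x * (t - x) `^ (beta - 1))),
    \int[mu]_(x in `]a, t[) `|F x * (t - x) `^ (beta - 1)| <= M0 * ((t - a) `^ beta / alpha) &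
    series (fun n => cf n * (-1) ^+ n * ((t - a) `^ (n%:R + beta) / (n%:R + beta))) @ \oo -->
      \int[mu]_(x in `]a, t[) (F x * (t - x) `^ (beta - 1))].
Proof.
move=> ab; have beta0 : 0 < beta by exact: lt_le_trans ab.
pose g n x := cf n * (-1) ^+ n * (t - x) `^ (n%:R + beta - 1).
have nb0 n : 0 < n%:R + beta by rewrite ltr_wpDl.
have gi0 n := integrable_powR_subl (nb0 n) at_.
have gi n : mu.-integrable `]a, t[ (EFin \o g n).
  by have := integrableZl (measurable_itvR `]a, t[) (cf n * (-1) ^+ n) (gi0 n).
have ta0 : 0 < t - a by rewrite subr_gt0.
have Ig n : \int[mu]_(x in `]a, t[) g n x = cf n * (-1) ^+ n * ((t - a) `^ (n%:R + beta) / (n%:R + beta)).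
  by rewrite (RintegralZl _ (measurable_itvR `]a, t[) (gi0 n)) /Rintegral integral_powR_subl.
have Iga n : \int[mu]_(x in `]a, t[) `|g n x| = `|cf n| * ((t - a) `^ (n%:R + beta) / (n%:R + beta)).
  rewrite (@eq_Rintegral _ _ _ mu _ (fun x => `|cf n| * (t - x) `^ (n%:R + beta - 1))).
    by rewrite (RintegralZl _ (measurable_itvR `]a, t[) (gi0 n)) /Rintegral integral_powR_subl.
  by move=> x _; rewrite /g !normrM normrX normrN1 expr1n mulr1 (ger0_norm (powR_ge0 _ _)).
have gE n x : x < t -> cf n * (x - t) ^+ n * (t - x) `^ (beta - 1) = g n x.
  move=> xt; have tx : 0 < t - x by rewrite subr_gt0.
  rewrite /g -(opprB t x) [in LHS]exprNn -addrA [in RHS]powRD; last by rewrite (gt_eqF tx) implybT.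
  by rewrite powR_mulrn ?(ltW tx)// !mulrA.
have [||iS bS cS] := @Rintegral_series R `]a, t[%classic g (fun x => F x * (t - x) `^ (beta - 1)) (M0 * ((t - a) `^ beta / alpha)) (measurable_itvR _) gi.
- move=> N; apply: (@le_trans _ _ ((\sum_(0 <= n < N) `|cf n| * (t - a) ^+ n / n.+1%:R) * ((t - a) `^ beta / alpha))); last first.
    by rewrite ler_wpM2r// divr_ge0 ?powR_ge0// ltW.
  rewrite mulr_suml; apply: ler_sum => n _; rewrite Iga -!mulrA ler_wpM2l//.
  rewrite powRD; last by rewrite (gt_eqF ta0) implybT.
  rewrite powR_mulrn ?(ltW ta0)// -!mulrA ler_wpM2l ?exprn_ge0 ?(ltW ta0)//.
  rewrite [leRHS]mulrCA ler_wpM2l ?powR_ge0// -invfM lef_pV2 ?posrE ?mulr_gt0//.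
  rewrite -natr1 mulrDl mul1r lerD// ler_piMr// ltW//.
- move=> x; rewrite /= in_itv/= => /andP[ax xt].
  have -> : series (g ^~ x) = (fun N => series (fun n => cf n * (x - t) ^+ n) N * (t - x) `^ (beta - 1)).
    apply/funext => N; rewrite /series/= mulr_suml; apply: eq_bigr => n _.
    by rewrite gE.
  by apply: cvgMl; apply: Fseries; rewrite ax.
split => //; rewrite (_ : (fun n => _) = (fun n => \int[mu]_(x in `]a, t[) g n x))//.
by apply/funext => n; rewrite Ig.
Qed.

(** [power_conv_series] for each exponent alpha m of the kernel; its bound, uniform in m
up to the factor r^(alpha m), makes the sum over m convergent by
[ml_kernel_coef_summable]. *)
Lemma volterra_conv_series : exists J : nat -> R,
  (forall m, (0 < m)%N -> series (fun n => cf n * (-1) ^+ n *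
      ((t - a) `^ (n%:R + alpha * m%:R) / (n%:R + alpha * m%:R))) @ \oo --> J m) /\
  series (fun m => ml_kernel_coef alpha c m * J m) @ \oo -->
    volterra_conv (ml_kernel' alpha c) F a t.
Proof.
exists (fun m => \int[mu]_(x in `]a, t[) (F x * (t - x) `^ (alpha * m%:R - 1))).
have am m : (0 < m)%N -> alpha <= alpha * m%:R.
  by move=> m0; rewrite ler_peMr ?(ltW alpha0)// ler1n.
have ta0 : 0 < t - a by rewrite subr_gt0.
split; first by move=> m /am/power_conv_series[].
pose g m x := ml_kernel_coef alpha c m * (F x * (t - x) `^ (alpha * m%:R - 1)).
have k0 : ml_kernel_coef alpha c 0 = 0 by rewrite /ml_kernel_coef !mulr0 mul0r.
have gi m : mu.-integrable `]a, t[ (EFin \o g m).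
  case: m => [|m].
    have -> : g 0%N = cst 0 by apply/funext => x; rewrite /g k0 mul0r.
    exact: integrable0.
  have [i _ _] := power_conv_series (am m.+1 isT).
  by have := integrableZl (measurable_itvR `]a, t[) (ml_kernel_coef alpha c m.+1) i.
have [B BP] := ml_kernel_coef_summable c alpha0 ta0.
have M00 : 0 <= M0 by have := cfM 0; rewrite big_geq.
have [||_ _ cS] := @Rintegral_series R `]a, t[%classic g
   (fun x => F x * ml_kernel' alpha c (t - x)) (B * (M0 / alpha)) (measurable_itvR _) gi.
- move=> N; apply: (@le_trans _ _ ((\sum_(0 <= m < N) `|ml_kernel_coef alpha c m| * (t - a) `^ (alpha * m%:R)) * (M0 / alpha))); last first.
    by rewrite ler_wpM2r// divr_ge0// ltW.
  rewrite mulr_suml; apply: ler_sum => m _.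
  case: m => [|m].
    rewrite k0 normr0 !mul0r /Rintegral integral0_eq// => x _.
    by rewrite /g k0 mul0r normr0.
  have [i b _] := power_conv_series (am m.+1 isT).
  rewrite (@eq_Rintegral _ _ _ mu _ (fun x => `|ml_kernel_coef alpha c m.+1| * `|F x * (t - x) `^ (alpha * m.+1%:R - 1)|)); last first.
    by move=> x _; rewrite /g normrM.
  rewrite (RintegralZl _ (measurable_itvR `]a, t[) (integrable_abse i)) -mulrA ler_wpM2l//.
  by apply: (le_trans b); rewrite mulrCA.
- move=> x; rewrite /= in_itv/= => /andP[ax xt].
  have tx : 0 < t - x by rewrite subr_gt0.
  have -> : series (g ^~ x) = (fun N => F x * series (fun m => ml_kernel_coef alpha c m * (t - x) `^ (alpha * m%:R - 1)) N).
    apply/funext => N; rewrite /series/= mulr_sumr; apply: eq_bigr => m _.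
    by rewrite /g mulrCA.
  by apply: cvgMr; exact: ml_kernel'_series.
rewrite (_ : (fun m => _) = (fun m => \int[mu]_(x in `]a, t[) g m x))//.
apply/funext => -[|m].
  by rewrite k0 mul0r /Rintegral integral0_eq// => x _; rewrite /g k0 mul0r.
have [i _ _] := power_conv_series (am m.+1 isT).
by rewrite (RintegralZl _ (measurable_itvR `]a, t[) i).
Qed.

End convolution_series.

(** * The binomial series *)

Section complex_real_variable.
Context {R : realType}.
Implicit Types (b : nat -> R[i]) (h r : R).

Definition cpsum b h : R[i] :=
  psum (fun n => complex.Re (b n)) h +i* psum (fun n => complex.Im (b n)) h.

(** Absolute summability after one integration.  Unlike absolute summability at r, it
tolerates an integrable singularity of the sum on the circle of radius r. *)
Definition summable_div b r := exists M, forall N,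
  \sum_(0 <= n < N) normc (b n) * r ^+ n / n.+1%:R <= M.

Definition cradius_ge b r := forall rho, 0 <= rho < r ->
  exists M, forall n, normc (b n) * rho ^+ n <= M.

Lemma summable_div_radius b r : summable_div b r -> cradius_ge b r.
Proof.
move=> [M MP] rho /andP[rho0 rhor]; have r0 : 0 < r by exact: le_lt_trans rhor.
exists (M * (r / (r - rho))) => n.
have rr : 0 <= rho < r by rewrite rho0.
have h := mulSn_exp_le n rr.
have t0 k : 0 <= normc (b k) * r ^+ k / k.+1%:R.
  by rewrite divr_ge0// mulr_ge0 ?normc_ge0 ?exprn_ge0// ltW.
have bn : normc (b n) * r ^+ n / n.+1%:R <= M.
  apply: le_trans (MP n.+1); rewrite big_nat_recr//= lerDr; exact: sumr_ge0.
have rrho : 0 <= r / (r - rho) by rewrite divr_ge0 ?subr_ge0// ltW.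
apply: (@le_trans _ _ (normc (b n) / n.+1%:R * (n.+1%:R * rho ^+ n))).
  by rewrite mulrA divfK// pnatr_eq0.
apply: (@le_trans _ _ (normc (b n) / n.+1%:R * (r / (r - rho) * r ^+ n))).
  by rewrite ler_wpM2l// divr_ge0 ?normc_ge0.
by rewrite mulrCA [leRHS]mulrC ler_wpM2l// mulrAC.
Qed.

Lemma cradius_ge_Re b r : cradius_ge b r -> radius_ge (fun n => complex.Re (b n)) r.
Proof.
move=> br rho rr; have [M MP] := br rho rr; exists M => n.
apply: le_trans (MP n); rewrite ler_wpM2r ?Re_le_normc// exprn_ge0//.
by have /andP[] := rr.
Qed.

Lemma cradius_ge_Im b r : cradius_ge b r -> radius_ge (fun n => complex.Im (b n)) r.
Proof.
move=> br rho rr; have [M MP] := br rho rr; exists M => n.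
apply: le_trans (MP n); rewrite ler_wpM2r ?Im_le_normc// exprn_ge0//.
by have /andP[] := rr.
Qed.

Lemma Re_pow_term b h n : complex.Re (b n * h%:C ^+ n) = complex.Re (b n) * h ^+ n.
Proof. by rewrite -rmorphXn/= ReMr. Qed.

Lemma Im_pow_term b h n : complex.Im (b n * h%:C ^+ n) = complex.Im (b n) * h ^+ n.
Proof. by rewrite -rmorphXn/= ImMr. Qed.

Lemma csums_cpsum b r h : cradius_ge b r -> `|h| < r ->
  csums (fun n => b n * h%:C ^+ n) (cpsum b h).
Proof.
move=> br hr; split => /=.
  rewrite (_ : series _ = pseries (fun n => complex.Re (b n)) h).
    exact: (radius_ge_series (cradius_ge_Re br) hr).
  by apply/funext => N; apply: eq_bigr => n _; rewrite Re_pow_term.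
rewrite (_ : series _ = pseries (fun n => complex.Im (b n)) h).
  exact: (radius_ge_series (cradius_ge_Im br) hr).
by apply/funext => N; apply: eq_bigr => n _; rewrite Im_pow_term.
Qed.

Lemma cpsum_uniq b r h l : cradius_ge b r -> `|h| < r ->
  csums (fun n => b n * h%:C ^+ n) l -> l = cpsum b h.
Proof. by move=> br hr hl; exact: csums_uniq hl (csums_cpsum br hr). Qed.

Definition cdiffs b n : R[i] := n.+1%:R * b n.+1.

Lemma Re_natM n (z : R[i]) : complex.Re (n%:R * z) = n%:R * complex.Re z.
Proof. by rewrite -(rmorph_nat (real_complex R)) mulrC ReMr mulrC. Qed.

Lemma Im_natM n (z : R[i]) : complex.Im (n%:R * z) = n%:R * complex.Im z.
Proof. by rewrite -(rmorph_nat (real_complex R)) mulrC ImMr mulrC. Qed.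

Lemma Re_cdiffs b : (fun n => complex.Re (cdiffs b n)) =
  pseries_diffs (fun n => complex.Re (b n)).
Proof. by apply/funext => n; rewrite Re_natM. Qed.

Lemma Im_cdiffs b : (fun n => complex.Im (cdiffs b n)) =
  pseries_diffs (fun n => complex.Im (b n)).
Proof. by apply/funext => n; rewrite Im_natM. Qed.

Lemma cradius_ge_diffs b r : cradius_ge b r -> cradius_ge (cdiffs b) r.
Proof.
move=> br; have : radius_ge (fun n => normc (b n)) r.
  move=> rho rr; have [M MP] := br rho rr; exists M => n.
  by rewrite ger0_norm ?normc_ge0.
move/radius_ge_diffs => dr rho rr; have [M MP] := dr rho rr; exists M => n.
apply: le_trans (MP n); rewrite /pseries_diffs /cdiffs normcM normc_nat.
by rewrite ger0_norm// mulr_ge0// normc_ge0.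
Qed.

End complex_real_variable.

Section cexp.
Context {R : realType}.
Implicit Types (z w : R[i]).

Lemma cexpD z w : cexp (z + w) = cexp z * cexp w.
Proof.
rewrite /cexp ReD ImD expRD cosD sinD rmorphM/= -!mulrA; congr (_ * _).
rewrite [RHS]mulrCA; congr (_ * _); apply: complex_ext; rewrite ?ReM ?ImM//=.
by rewrite addrC.
Qed.

Lemma cexp0 : cexp (0 : R[i]) = 1.
Proof. by rewrite /cexp /= expR0 cos0 sin0 mul1r. Qed.

Lemma cexpX z n : cexp (n%:R * z) = cexp z ^+ n.
Proof.
elim: n => [|n IH]; first by rewrite mul0r cexp0 expr0.
by rewrite -natr1 mulrDl mul1r cexpD IH exprSr.
Qed.

End cexp.

(** The mean value theorem on the segment between 0 and w. *)
Lemma is_derive0_cst {R : realType} (f : R -> R) (r w : R) :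
  (forall x : R, `|x| < r -> is_derive x 1 f 0) -> `|w| < r -> f w = f 0.
Proof.
move=> fd wr.
have [w0|w0|->//] := ltgtP w 0.
- have [||c _ /eqP] := @MVT _ f (fun=> 0) _ _ w0.
  + move=> x; rewrite in_itv/= => /andP[wx x0]; apply: fd.
    by move: wr; rewrite !ltr0_norm//; lra.
  + apply: continuous_in_subspaceT => x; rewrite inE/= in_itv/= => /andP[wx x0].
    apply: is_derive_continuous (fd x _).
    by move: wr; rewrite (ltr0_norm w0) ler0_norm//; lra.
  by rewrite mul0r subr_eq0 => /eqP->.
have [||c _ /eqP] := @MVT _ f (fun=> 0) _ _ w0.
+ move=> x; rewrite in_itv/= => /andP[x0 xw]; apply: fd.
  by move: wr; rewrite !gtr0_norm//; lra.
+ apply: continuous_in_subspaceT => x; rewrite inE/= in_itv/= => /andP[x0 xw].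
  apply: is_derive_continuous (fd x _).
  by move: wr; rewrite (gtr0_norm w0) ger0_norm//; lra.
by rewrite mul0r subr_eq0 => /eqP->.
Qed.

Section binomial_series.
Context {R : realType}.
Variable lambda : R[i].
Hypothesis lambda_gt : -1 < complex.Re lambda.

(** The generalised binomial coefficients of the complex number lambda, by their
recurrence. *)
Fixpoint cbinom n : R[i] :=
  if n is m.+1 then cbinom m * ((lambda - m%:R) / m.+1%:R) else 1.

(** The modulus of lambda - n is n - Re lambda + O(1 / n), so any number mu strictly
between -1 and Re lambda works for n large. *)
Lemma normc_lambda_sub_le : exists (mu : R) N, -1 < mu /\
  forall n, (N <= n)%N -> normc (lambda - n%:R) <= n%:R - mu.
Proof.
(* m is the midpoint of -1 and Re lambda; beyond q one has |lambda - n|^2 <= (n - m)^2. *)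
case: lambda lambda_gt => mu nu /= mu1; pose m := (mu - 1) / 2.
have m0 : 0 < mu - m by rewrite /m; lra.
pose q := (nu ^+ 2 + mu ^+ 2 - m ^+ 2) / (2 * (mu - m)).
pose A := `|m| + `|q|.
exists m, (Num.truncn A).+1; split => [|n nA]; first by rewrite /m; lra.
have hA : A < n%:R by rewrite (lt_le_trans (truncnS_gt _))// ler_nat.
have hm : m <= n%:R.
  by have := ler_norm m; have := normr_ge0 q; move: hA; rewrite /A; lra.
have hq : q <= n%:R.
  by have := ler_norm q; have := normr_ge0 m; move: hA; rewrite /A; lra.
rewrite -[leRHS]ger0_norm ?subr_ge0// -sqrtr_sqr.
rewrite -(rmorph_nat (real_complex R)) /= ler_sqrt ?sqr_ge0// subr0.
move: hq; rewrite /q ler_pdivrMr ?mulr_gt0//; nra.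
Qed.

(** Raabe's argument: with d n the modulus of the coefficient of index n, the estimate
|lambda - n| <= n - mu reads (1 + mu) d n / (n + 1) <= d n - d (n + 1), and the right-hand
side telescopes.  Here mu > -1 is essential. *)
Lemma cbinom_summable : summable_div cbinom 1.
Proof.
have [mu [N0 [mu1 muP]]] := normc_lambda_sub_le.
have mu0 : 0 < 1 + mu by lra.
pose d n := normc (cbinom n).
have step n : (N0 <= n)%N -> d n / n.+1%:R <= (d n - d n.+1) / (1 + mu).
  move=> Nn; rewrite ler_pdivlMr// /d /= !normcM normcV normc_nat.
  have h := muP n Nn; have d0 := normc_ge0 (cbinom n).
  have n0 : 0 < n.+1%:R :> R by [].
  rewrite -{2}[normc (cbinom n)]mulr1 -mulrBr -mulrA ler_wpM2l//.
  rewrite -(ler_pM2l n0) mulrA mulfV ?gt_eqF// mul1r mulrBr mulr1 mulrCA mulfV ?gt_eqF// mulr1.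
  by rewrite -natr1; lra.
pose S := \sum_(0 <= n < N0) d n / n.+1%:R.
exists (S + d N0 / (1 + mu)) => N.
have -> : \sum_(0 <= n < N) normc (cbinom n) * 1 ^+ n / n.+1%:R = \sum_(0 <= n < N) d n / n.+1%:R.
  by apply: eq_bigr => n _; rewrite expr1n mulr1.
have t0 n : 0 <= d n / n.+1%:R by rewrite divr_ge0 ?normc_ge0.
have dm0 : 0 <= d N0 / (1 + mu) by rewrite divr_ge0 ?normc_ge0// ltW.
have [NN|NN] := leqP N N0.
  rewrite ler_wpDr// /S (@big_cat_nat _ _ _ N 0 N0)//= lerDl; exact: sumr_ge0.
rewrite (@big_cat_nat _ _ _ N0 0 N) ?(ltnW NN)//= lerD2l.
apply: (@le_trans _ _ (\sum_(N0 <= n < N) (d n - d n.+1) / (1 + mu))).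
  by rewrite !big_nat; apply: ler_sum => n /andP[Nn _]; exact: step.
rewrite -mulr_suml ler_wpM2r ?invr_ge0 ?(ltW mu0)//.
rewrite -[X in X <= _]opprK -sumrN (eq_bigr (fun n => d n.+1 - d n)); last by move=> n _; rewrite opprB.
by rewrite telescope_sumr ?(ltnW NN)// opprB lerBlDr lerDl normc_ge0.
Qed.

Lemma cbinom_radius : cradius_ge cbinom 1.
Proof. exact/summable_div_radius/cbinom_summable. Qed.

(** Comparing coefficients: (n + 1) b_(n+1) + n b_n = lambda b_n. *)
Lemma cbinom_ode (w : R) : `|w| < 1 ->
  (1 + w)%:C * cpsum (cdiffs cbinom) w = lambda * cpsum cbinom w.
Proof.
move=> w1; have s1 := csums_cpsum cbinom_radius w1.
have s2 := csums_cpsum (cradius_ge_diffs cbinom_radius) w1.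
have s3 : csums (fun n => n%:R * cbinom n * w%:C ^+ n) (w%:C * cpsum (cdiffs cbinom) w).
  rewrite -(@csums_shift _ 1); last by move=> [|n]// _; rewrite !mul0r.
  have := csumsZ w%:C s2; congr (csums _ _); apply/funext => n.
  by rewrite /cdiffs addn1 exprS; ring.
apply: csums_uniq (csumsZ lambda s1).
have -> : (fun n => lambda * (cbinom n * w%:C ^+ n)) =
    (fun n => cdiffs cbinom n * w%:C ^+ n - (- (n%:R * cbinom n * w%:C ^+ n))).
  apply/funext => n; rewrite /cdiffs /=.
  have n0 : n.+1%:R != 0 :> R[i] by rewrite pnatr_eq0.
  have -> : n.+1%:R * (cbinom n * ((lambda - n%:R) / n.+1%:R)) = cbinom n * (lambda - n%:R).
    by rewrite mulrCA [_ * (_ / _)]mulrC divfK.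
  ring.
have -> : (1 + w)%:C * cpsum (cdiffs cbinom) w =
    cpsum (cdiffs cbinom) w - (- (w%:C * cpsum (cdiffs cbinom) w)).
  by rewrite rmorphD/= mulrDl mul1r opprK.
apply: csumsB => //; have := csumsZ (-1) s3; rewrite mulN1r.
by congr (csums _ _); apply/funext => n; rewrite mulN1r.
Qed.

(** By [cbinom_ode], the product of the binomial series with (1 + x)^(- lambda) has
derivative 0.  Its real and imaginary parts are P and Q below. *)
Lemma cexp_ln_cpsum (w : R) : `|w| < 1 -> cpsum cbinom w = cexp (lambda * (ln (1 + w))%:C).
Proof.
move=> w1.
pose mu := complex.Re lambda; pose nu := complex.Im lambda.
pose u : R -> R := psum (fun n => complex.Re (cbinom n)).
pose v : R -> R := psum (fun n => complex.Im (cbinom n)).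
pose E x := expR (- (mu * ln (1 + x))).
(* P + i Q is (1 + x)^(- mu - i nu) (u + i v). *)
pose P x := E x * (cos (nu * ln (1 + x)) * u x + sin (nu * ln (1 + x)) * v x).
pose Q x := E x * (cos (nu * ln (1 + x)) * v x - sin (nu * ln (1 + x)) * u x).
have br := cbinom_radius.
have du (x : R) : `|x| < 1 -> is_derive x 1 u ((mu * u x - nu * v x) / (1 + x)) /\
    is_derive x 1 v ((mu * v x + nu * u x) / (1 + x)).
  move=> x1; have x0 : 1 + x != 0 by rewrite gt_eqF//; move: x1; rewrite ltr_norml => /andP[]; lra.
  have ode := cbinom_ode x1.
  have odeR := congr1 (@complex.Re R) ode; have odeI := congr1 (@complex.Im R) ode.
  rewrite ReM ImM/= Re_cdiffs Im_cdiffs in odeR odeI.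
  rewrite mul0r subr0 ReM/= in odeR; rewrite mul0r addr0 ImM/= in odeI.
  have d1 := is_derive_psum (cradius_ge_Re br) x1.
  have d2 := is_derive_psum (cradius_ge_Im br) x1.
  split; [apply: (is_derive_eq d1)|apply: (is_derive_eq d2)].
    by rewrite -odeR mulrC mulKf.
  by rewrite [_ + nu * _]addrC addrC -odeI mulrC mulKf.
have dl (x : R) : `|x| < 1 -> is_derive x 1 (fun x => ln (1 + x)) (1 + x)^-1.
  move=> x1; have x0 : 0 < 1 + x by move: x1; rewrite ltr_norml => /andP[]; lra.
  have d : is_derive x 1 (fun x : R => 1 + x) 1 by apply: is_derive_eq; rewrite ?add0r ?mulr1 ?mul1r.
  have := @is_derive1_comp _ _ (fun x : R => 1 + x) _ _ _ (is_derive1_ln x0) d.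
  by rewrite mulr1.
have dE (x : R) : `|x| < 1 -> is_derive x 1 E (- mu / (1 + x) * E x).
  move=> x1; have d := is_deriveN (is_deriveZ mu (dl x x1)).
  have := @is_derive1_comp _ _ (fun x : R => - (mu * ln (1 + x))) _ _ _ (is_derive_expR _) d.
  by move/is_derive_eq; apply; rewrite /E /GRing.scale/=; ring.
have dc (x : R) : `|x| < 1 -> is_derive x 1 (fun x => cos (nu * ln (1 + x)))
    (- sin (nu * ln (1 + x)) * (nu / (1 + x))).
  move=> x1; have d := is_deriveZ nu (dl x x1).
  exact: (@is_derive1_comp _ _ (fun x : R => nu * ln (1 + x)) _ _ _ (is_derive_cos _) d).
have ds (x : R) : `|x| < 1 -> is_derive x 1 (fun x => sin (nu * ln (1 + x)))
    (cos (nu * ln (1 + x)) * (nu / (1 + x))).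
  move=> x1; have d := is_deriveZ nu (dl x x1).
  exact: (@is_derive1_comp _ _ (fun x : R => nu * ln (1 + x)) _ _ _ (is_derive_sin _) d).
have dP (x : R) : `|x| < 1 -> is_derive x 1 P 0.
  move=> x1; have [d1 d2] := du x x1.
  pose p x := cos (nu * ln (1 + x)) * u x + sin (nu * ln (1 + x)) * v x.
  have d3 : is_derive x 1 p _ := is_deriveD (is_deriveM (dc x x1) d1) (is_deriveM (ds x x1) d2).
  apply: (is_derive_eq (is_deriveM (dE x x1) d3)).
  by rewrite /p /GRing.scale/=; ring.
have dQ (x : R) : `|x| < 1 -> is_derive x 1 Q 0.
  move=> x1; have [d1 d2] := du x x1.
  pose p x := cos (nu * ln (1 + x)) * v x - sin (nu * ln (1 + x)) * u x.
  have d3 : is_derive x 1 p _ := is_deriveB (is_deriveM (dc x x1) d2) (is_deriveM (ds x x1) d1).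
  apply: (is_derive_eq (is_deriveM (dE x x1) d3)).
  by rewrite /p /GRing.scale/=; ring.
have ln1 : ln (1 + 0) = 0 :> R by rewrite addr0 ln1.
have P0 : P 0 = 1.
  by rewrite /P /E ln1 !mulr0 oppr0 expR0 cos0 sin0 /u psum0 /=; ring.
have Q0 : Q 0 = 0.
  by rewrite /Q /E ln1 !mulr0 oppr0 expR0 cos0 sin0 /v psum0 /=; ring.
have Pw := is_derive0_cst dP w1; rewrite P0 in Pw.
have Qw := is_derive0_cst dQ w1; rewrite Q0 in Qw.
have : cexp (- (lambda * (ln (1 + w))%:C)) * cpsum cbinom w = 1.
  have -> : - (lambda * (ln (1 + w))%:C) = (- (mu * ln (1 + w))) +i* (- (nu * ln (1 + w))).
    have ReN (z : R[i]) : complex.Re (- z) = - complex.Re z by case: z.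
    have ImN (z : R[i]) : complex.Im (- z) = - complex.Im z by case: z.
    by apply: complex_ext; rewrite ?ReN ?ImN ?ReMr ?ImMr.
  rewrite /cexp /= cosN sinN -/(E w) mulrC.
  apply: complex_ext; rewrite ?ReM ?ImM/= -/(u w) -/(v w) ?mul0r ?subr0 ?addr0.
    by etransitivity; last exact: Pw; rewrite /P; ring.
  by etransitivity; last exact: Qw; rewrite /Q; ring.
move=> h; rewrite -[LHS]mul1r -cexp0 -(subrr (lambda * (ln (1 + w))%:C)) cexpD -mulrA h.
by rewrite mulr1.
Qed.

End binomial_series.

(** * Taylor coefficients of a power times an analytic function *)

Section power_expansion.
Context {R : realType}.
Implicit Types (t x r : R) (lambda : R[i]) (b e c : nat -> R[i]).

Lemma rcpow_nat x k : rcpow x (k%:R) = (x ^+ k)%:C.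
Proof.
rewrite /rcpow; have [->|x0] := eqVneq x 0.
  rewrite pnatr_eq0; case: k => [|k]; first by rewrite expr0.
  by rewrite expr0n.
rewrite cexpX rmorphXn /=; congr (_ ^+ k).
rewrite /cexp /= lnK ?posrE ?normr_gt0//.
case: ltP => h; first by rewrite ltr0_norm// cospi sinpi; apply: complex_ext => /=; ring.
by rewrite ger0_norm// cos0 sin0; apply: complex_ext => /=; ring.
Qed.

(** Multiplication by 1 + w > 0 keeps the sign of t, hence the argument that the
principal value uses. *)
Lemma rcpow_scale t (w : R) lambda : t != 0 -> 0 < 1 + w ->
  rcpow (t * (1 + w)) lambda = rcpow t lambda * cexp (lambda * (ln (1 + w))%:C).
Proof.
move=> t0 w0; have x0 : t * (1 + w) != 0 by rewrite mulf_neq0// gt_eqF.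
rewrite /rcpow (negbTE t0) (negbTE x0) -cexpD -mulrDr pmulr_llt0//.
rewrite normrM (gtr0_norm w0) lnM ?posrE ?normr_gt0//.
by congr (cexp (_ * _)); apply: complex_ext => /=; rewrite ?addr0.
Qed.

Lemma summable_div_finite b r n : 0 <= r -> (forall k, (n <= k)%N -> b k = 0) ->
  summable_div b r.
Proof.
move=> r0 bn; exists (\sum_(0 <= k < n) normc (b k) * r ^+ k / k.+1%:R) => N.
have t0 k : 0 <= normc (b k) * r ^+ k / k.+1%:R.
  by rewrite divr_ge0// mulr_ge0 ?normc_ge0 ?exprn_ge0.
have [Nn|nN] := leqP N n.
  by rewrite [leRHS](@big_cat_nat _ _ _ N 0 n)//= lerDl sumr_ge0.
rewrite (@big_cat_nat _ _ _ n 0 N) ?(ltnW nN)//= [X in _ + X]big_nat [X in _ + X]big1 ?addr0//.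
by move=> k /andP[nk _]; rewrite bn// normc0 !mul0r.
Qed.

(** For r <= |t| this is the binomial series in (x - t) / t, and otherwise a polynomial. *)
Lemma rcpow_expansion t r lambda : 0 < r -> -1 < complex.Re lambda ->
  r <= `|t| \/ (exists k : nat, lambda = k%:R) ->
  exists b, summable_div b r /\ forall x, `|x - t| < r ->
    csums (fun n => b n * (x - t)%:C ^+ n) (rcpow x lambda).
Proof.
move=> r0 l1 [rt|[k ->]]; last first.
  exists (fun n => (t ^+ (k - n) *+ 'C(k, n))%:C); split.
    apply: (@summable_div_finite _ _ k.+1 (ltW r0)) => n kn.
    by rewrite bin_small// mulr0n.
  move=> x _; rewrite rcpow_nat.
  have := @csums_finite _ (fun n => (t ^+ (k - n) *+ 'C(k, n))%:C * (x - t)%:C ^+ n) k.+1.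
  rewrite (_ : \sum_(_ <= _ < _) _ = (x ^+ k)%:C).
    by apply=> n kn; rewrite bin_small// mulr0n mul0r.
  have -> : x ^+ k = (t + (x - t)) ^+ k by rewrite addrC subrK.
  rewrite exprDn rmorph_sum/= big_mkord.
  by apply: eq_bigr => i _; rewrite -rmorphXn -rmorphM/= mulrnAl.
have t0 : t != 0 by rewrite -normr_gt0 (lt_le_trans r0).
have t0' : 0 < `|t| by rewrite normr_gt0.
exists (fun n => rcpow t lambda * (cbinom lambda n * (t^-1)%:C ^+ n)); split.
  have [M MP] := cbinom_summable l1.
  exists (normc (rcpow t lambda) * M) => N.
  apply: le_trans (_ : _ <= normc (rcpow t lambda) * \sum_(0 <= n < N) normc (cbinom lambda n) * 1 ^+ n / n.+1%:R) _; last first.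
    by rewrite ler_wpM2l ?normc_ge0.
  rewrite mulr_sumr; apply: ler_sum => n _.
  rewrite !normcM normcX normc_real -!mulrA ler_wpM2l ?normc_ge0// ler_wpM2l ?normc_ge0//.
  rewrite mulrA ler_wpM2r// expr1n -exprMn normfV exprn_ile1// ?mulr_ge0 ?invr_ge0// ?(ltW r0)//.
  by rewrite mulrC ler_pdivrMr// mul1r.
move=> x xr; pose w := (x - t) / t.
have w1 : `|w| < 1.
  by rewrite normrM normfV ltr_pdivrMr// mul1r (lt_le_trans xr).
have w0 : 0 < 1 + w by move: w1; rewrite ltr_norml => /andP[]; lra.
have -> : rcpow x lambda = rcpow t lambda * cpsum (cbinom lambda) w.
  by rewrite cexp_ln_cpsum// -rcpow_scale//; congr rcpow; rewrite /w; field.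
have := csumsZ (rcpow t lambda) (csums_cpsum (cbinom_radius l1) w1).
congr (csums _ _); apply/funext => n; rewrite /w -mulrA; congr (_ * _).
by rewrite rmorphM/= exprMn -mulrA; congr (_ * _); rewrite mulrC.
Qed.

(** The triangle k <= n < N is contained in the square of side N. *)
Lemma triangle_le (x y : nat -> R) N : (forall n, 0 <= x n) -> (forall n, 0 <= y n) ->
  \sum_(0 <= n < N) \sum_(0 <= k < n.+1) x k * y (n - k)%N <=
  (\sum_(0 <= k < N) x k) * (\sum_(0 <= j < N) y j).
Proof.
move=> x0 y0.
rewrite (eq_big_nat _ _ (F2 := fun n => \sum_(0 <= k < N) if (k <= n)%N then x k * y (n - k)%N else 0)); last first.
  move=> n /andP[_ nN]; rewrite [RHS](@big_cat_nat _ _ _ n.+1 0 N)//=.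
  rewrite [X in _ + X]big_nat [X in _ + X]big1 ?addr0; last first.
    by move=> k /andP[nk _]; rewrite leqNgt nk.
  by rewrite !big_nat; apply: eq_bigr => k /=; rewrite ltnS => ->.
rewrite exchange_big/= mulr_suml !big_nat; apply: ler_sum => k /= kN.
rewrite (@big_cat_nat _ _ _ k 0 N) ?(ltnW kN)//= [X in X + _]big_nat [X in X + _]big1 ?add0r; last first.
  by move=> n /= nk; rewrite leqNgt nk.
rewrite big_nat (eq_bigr (fun n => x k * y (n - k)%N)); last by move=> n /andP[->].
rewrite -big_nat -mulr_sumr ler_wpM2l//.
have -> : \sum_(k <= n < N) y (n - k)%N = \sum_(0 <= j < N - k) y j.
  rewrite -[X in \sum_(X <= _ < _) _ = _]add0n big_addn.
  by apply: eq_bigr => n _; rewrite addnK.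
rewrite -big_nat [leRHS](@big_cat_nat _ _ _ (N - k)%N 0 N) ?leq_subr//= lerDl; exact: sumr_ge0.
Qed.

Definition cauchy_prod b e n : R[i] := \sum_(0 <= k < n.+1) b k * e (n - k)%N.

(** The weights satisfy 1 / (n + 1) <= 1 / (k + 1) for k <= n, so the weight may be put on
the first factor alone. *)
Lemma summable_div_cauchy_prod b e r K : 0 <= r -> summable_div b r ->
  (forall N, \sum_(0 <= n < N) normc (e n) * r ^+ n <= K) ->
  summable_div (cauchy_prod b e) r.
Proof.
move=> r0 [M MP] eK; exists (M * K) => N.
have x0 n : 0 <= normc (b n) * r ^+ n / n.+1%:R.
  by rewrite divr_ge0// mulr_ge0 ?normc_ge0 ?exprn_ge0.
have y0 n : 0 <= normc (e n) * r ^+ n by rewrite mulr_ge0 ?normc_ge0 ?exprn_ge0.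
apply: le_trans (_ : _ <= \sum_(0 <= n < N) \sum_(0 <= k < n.+1)
    (normc (b k) * r ^+ k / k.+1%:R) * (normc (e (n - k)%N) * r ^+ (n - k))) _; last first.
  apply: (le_trans (triangle_le N x0 y0)); apply: ler_pM => //; exact: sumr_ge0.
apply: ler_sum => n _; rewrite -mulrA.
apply: le_trans (ler_wpM2r _ (normc_sum _ _ _)) _.
  by rewrite divr_ge0// exprn_ge0.
rewrite mulr_suml !big_nat; apply: ler_sum => k /=; rewrite ltnS => kn.
have rn : r ^+ n = r ^+ k * r ^+ (n - k) by rewrite -exprD subnKC.
rewrite normcM rn.
have -> : normc (b k) * normc (e (n - k)%N) * (r ^+ k * r ^+ (n - k) / n.+1%:R) =
  (normc (b k) * r ^+ k * (normc (e (n - k)%N) * r ^+ (n - k))) / n.+1%:R by ring.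
rewrite [leRHS]mulrAC ler_wpM2l ?mulr_ge0 ?normc_ge0 ?exprn_ge0//.
by rewrite lef_pV2 ?posrE// ler_nat.
Qed.

(** The product as an exchange of summations over the triangle k <= n. *)
Lemma csums_cauchy_prod b e (z B E : R[i]) Mb Me :
  (forall N, \sum_(0 <= n < N) normc (b n * z ^+ n) <= Mb) ->
  (forall N, \sum_(0 <= n < N) normc (e n * z ^+ n) <= Me) ->
  csums (fun n => b n * z ^+ n) B -> csums (fun n => e n * z ^+ n) E ->
  csums (fun n => cauchy_prod b e n * z ^+ n) (B * E).
Proof.
move=> bM eM bB eE.
(* Row k carries b_k times the shifted series of e; column n sums to the coefficient
   of index n of the product. *)
pose a k n := if (k <= n)%N then (b k * z ^+ k) * (e (n - k)%N * z ^+ (n - k)) else 0.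
apply: (@csums_exchange _ a (Mb * Me) (fun k => b k * z ^+ k * E)).
- move=> N; rewrite exchange_big/=.
  apply: le_trans (_ : _ <= \sum_(0 <= n < N) \sum_(0 <= k < n.+1) normc (b k * z ^+ k) * normc (e (n - k)%N * z ^+ (n - k))) _; last first.
    apply: (le_trans (@triangle_le (fun n => normc (b n * z ^+ n)) (fun n => normc (e n * z ^+ n)) N _ _)).
    + by move=> n; exact: normc_ge0.
    + by move=> n; exact: normc_ge0.
    by apply: ler_pM => //; apply: sumr_ge0 => n _; exact: normc_ge0.
  rewrite !big_nat; apply: ler_sum => n /= nN.
  rewrite (@big_cat_nat _ _ _ n.+1 0 N)//= [X in _ + X]big_nat [X in _ + X]big1 ?addr0; last first.
    by move=> k /andP[nk _]; rewrite /a leqNgt nk; exact: normc0.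
  by rewrite !big_nat; apply: ler_sum => k /=; rewrite ltnS /a => ->; rewrite normcM.
- move=> k; rewrite -(@csums_shift _ k); last by move=> n nk; rewrite /a leqNgt nk.
  have := csumsZ (b k * z ^+ k) eE; congr (csums _ _); apply/funext => n.
  by rewrite /a leq_addl addnK.
- move=> n; rewrite /cauchy_prod mulr_suml.
  rewrite (eq_big_nat _ _ (F2 := fun k => a k n)); last first.
    move=> k /andP[_]; rewrite ltnS => kn; rewrite /a kn.
    have -> : z ^+ n = z ^+ k * z ^+ (n - k) by rewrite -exprD subnKC.
    by move: (z ^+ k) (z ^+ (n - k)) => p q; ring.
  by apply: csums_finite => k nk; rewrite /a leqNgt nk.
- have := csumsZ E bB; rewrite mulrC; congr (csums _ _); apply/funext => n; exact: mulrC.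
Qed.

Lemma cradius_summable b r rho : cradius_ge b r -> 0 <= rho < r -> exists K,
  forall N, \sum_(0 <= n < N) normc (b n) * rho ^+ n <= K.
Proof.
move=> br /andP[rho0 rhor]; pose s := (rho + r) / 2.
have [|M MP] := br s; first by rewrite /s; apply/andP; split; lra.
exists (M / (1 - rho / s)); apply: abs_power_series_le MP.
by rewrite /s; apply/andP; split; lra.
Qed.

(** The Cauchy product of the expansions of x^lambda, weighted summable at r, and of eta,
absolutely summable at r because its disc of convergence is larger. *)
Lemma rcpow_analytic_expansion t r lambda (eta : R[i] -> R[i]) :
  0 < r -> -1 < complex.Re lambda ->
  r <= `|t| \/ (exists k : nat, lambda = k%:R) ->
  (forall z, normc z <= r -> exists c s, 0 < s /\ expands eta (t%:C + z) c s) ->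
  exists c, summable_div c r /\ forall x, `|x - t| < r ->
    rcpow x lambda * eta x%:C = cpsum c (x - t).
Proof.
move=> r0 l1 br loc; have [b [bS bE]] := rcpow_expansion r0 l1 br.
have [e [rho [rrho eE]]] := expands_disc r0 loc.
have [|K eK] := expands_summable (rho := r) eE; first by rewrite (ltW r0).
exists (cauchy_prod b e).
have cS := summable_div_cauchy_prod (ltW r0) bS eK.
split => // x xr; apply: (cpsum_uniq (summable_div_radius cS) xr).
have nx : normc (x - t)%:C = `|x - t| by rewrite normc_real.
have xr0 : 0 <= `|x - t| < r by apply/andP; split; [exact: normr_ge0|exact: xr].
have [Mb MbP] := cradius_summable (summable_div_radius bS) xr0.
apply: (@csums_cauchy_prod _ _ _ _ _ Mb K).
- by move=> N; under eq_bigr do rewrite normcM normcX nx.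
- move=> N; apply: le_trans (eK N); apply: ler_sum => n _.
  rewrite normcM normcX nx ler_wpM2l ?normc_ge0// lerXn2r ?nnegrE ?(ltW r0)//.
  exact: ltW.
- exact: bE.
- have -> : eta x%:C = eta (t%:C + (x - t)%:C) by rewrite -rmorphD/= addrC subrK.
  by apply: eE; rewrite nx (lt_trans xr).
Qed.

End power_expansion.

(** * Assembling the expansion *)

Section real_component.
Context {R : realType}.
Local Notation mu := (@lebesgue_measure R).

(** The differentiation and the expansion for a real-valued F; the theorem uses it for the
two components of f \o g. *)
Lemma ml_convolution_derive (alpha c a u t : R) (F : R -> R) (cf : nat -> R) M :
  0 < alpha < 1 -> a < t < u -> u - t <= t - a ->
  mu.-integrable `]a, u[ (EFin \o F) ->
  radius_ge cf (t - a) ->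
  (forall N, \sum_(0 <= n < N) `|cf n| * (t - a) ^+ n / n.+1%:R <= M) ->
  (forall x, a < x < u -> F x = psum cf (x - t)) ->
  exists V J, [/\ is_derive t 1 (fun T => \int[mu]_(x in `[a, T])
        (F x * mittag_leffler alpha (c * (T - x) `^ alpha))) (F t + V),
    forall m, (0 < m)%N -> series (fun n => cf n * (-1) ^+ n *
      ((t - a) `^ (n%:R + alpha * m%:R) / (n%:R + alpha * m%:R))) @ \oo --> (J m : R) &
    series (fun m => ml_kernel_coef alpha c m * J m) @ \oo --> V].
Proof.
move=> /andP[alpha0 alpha1] /andP[at_ tu] uta Fi cfr cfM FE.
have xr x : a < x < u -> `|x - t| < t - a.
  by move=> /andP[ax xu]; rewrite ltr_norml; apply/andP; split; lra.
have Fc x : a < x < u -> {for x, continuous F}.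
  move=> axu; have d := is_derive_psum_shift cfr (xr x axu).
  have /andP[ax xu] := axu.
  apply: (@is_derive_continuous _ _ _ (psum (pseries_diffs cf) (x - t))).
  apply: near_eq_is_derive d; near=> y; apply/esym/FE/andP; split.
    by near: y; exact: lt_nbhsr.
  by near: y; exact: lt_nbhsl.
have [C [C0 Ck]] := ml_kernel'_le c alpha0 (u - a).
have au : a < u by exact: lt_trans tu.
have Kd (s : R) : 0 < s -> is_derive s 1 (ml_kernel alpha c) (ml_kernel' alpha c s).
  by move=> s0; exact: is_derive_ml_kernel.
have kc (s : R) : 0 < s -> {for s, continuous (ml_kernel' alpha c)}.
  by move=> s0; exact: continuous_ml_kernel'.
have [|J [J1 J2]] := @volterra_conv_series _ alpha c a t M F cf alpha0 alpha1 at_ cfM.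
  move=> x /andP[ax xt]; have axu : a < x < u by rewrite ax (lt_trans xt tu).
  rewrite FE//; exact: (radius_ge_series cfr (xr x axu)).
exists (volterra_conv (ml_kernel' alpha c) F a t), J; split => //.
have H := volterra_derive alpha0 (ltW alpha1) C0 Kd kc (@ml_kernel_cvg0 R alpha c alpha0) Ck
  au (lexx (u - a)) Fi Fc (@ml_kernel0 R alpha c alpha0).
by apply: H; rewrite at_.
Unshelve. all: by end_near. Qed.

(** Both sides satisfy the same recurrence in n, since
Gamma(n + beta + 2) = (n + beta + 1) Gamma(n + beta + 1) for beta > 0. *)
Lemma gbinom_Gamma (beta : R) n : 0 < beta ->
  gbinom (- beta) n * n`!%:R / Gamma (n%:R + beta + 1) =
  (-1) ^+ n * (beta / (Gamma (beta + 1) * (n%:R + beta))).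
Proof.
move=> b0; rewrite /gbinom divfK ?pnatr_eq0 -?lt0n ?fact_gt0//.
have nb k : 0 < k%:R + beta by rewrite ltr_wpDl.
have G k : 0 < Gamma (k%:R + beta + 1) by apply: Gamma_gt0; rewrite ltW.
have Gb : 0 < Gamma (beta + 1) by apply: Gamma_gt0; rewrite ltW.
suff E : (\prod_(i < n) (- beta - i%:R)) * (Gamma (beta + 1) * (n%:R + beta)) =
    (-1) ^+ n * beta * Gamma (n%:R + beta + 1).
  have h1 := gt_eqF (G n); have h2 := gt_eqF Gb; have h3 := gt_eqF (nb n).
  apply: (mulIf (x := Gamma (n%:R + beta + 1))); first by rewrite h1.
  rewrite divfK ?h1//.
  apply: (mulIf (x := Gamma (beta + 1) * (n%:R + beta))); first by rewrite mulf_neq0 ?h2 ?h3.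
  rewrite E; field; by rewrite ?h2 ?h3.
elim: n => [|n IH]; first by rewrite big_ord0 expr0 !mul1r !add0r mulrC.
rewrite big_ord_recr/=.
have -> : Gamma (n.+1%:R + beta + 1) = (n%:R + beta + 1) * Gamma (n%:R + beta + 1).
  rewrite -GammaS; first by congr Gamma; rewrite -natr1; ring.
  by rewrite ltrDr.
have -> : (\prod_(i < n) (- beta - i%:R)) * (- beta - n%:R) * (Gamma (beta + 1) * (n.+1%:R + beta)) =
  - (n.+1%:R + beta) * ((\prod_(i < n) (- beta - i%:R)) * (Gamma (beta + 1) * (n%:R + beta))) by ring.
by rewrite IH -natr1 exprS; ring.
Qed.

End real_component.

Section csum_from.
Context {R : realType}.
Implicit Types (u : nat -> R[i]) (l : R[i]).

(** Padding with zeros turns a sum that starts at n0 into one that starts at 0. *)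
Lemma csum_from_csums n0 u l : csums (fun n => if (n0 <= n)%N then u n else 0) l ->
  csummable_from n0 u /\ csum_from n0 u = l.
Proof.
move=> /csumsP.
have -> : (fun N => \sum_(0 <= n < N) (if (n0 <= n)%N then u n else 0) : R[i]^o) =
    (fun N => \sum_(n0 <= n < N) u n : R[i]^o).
  apply/funext => N; rewrite [RHS](big_nat_widenl _ 0)//= -big_mkcond/=.
  by apply: eq_bigl => n; rewrite ?andbT.
move=> h; split; first by apply/cvg_ex; exists l.
by rewrite /csum_from; exact: cvg_lim h.
Qed.

End csum_from.

Section composition.
Context {R : realType}.
Implicit Types (c : nat -> R[i]) (F : R -> R[i]) (f : R -> R[i]) (g : R -> R).

Lemma cderiven_cpsum c r F t : 0 < r -> cradius_ge c r ->
  (\forall x \near t, F x = cpsum c (x - t)) ->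
  forall n, cderiven n F t = n`!%:R * c n.
Proof.
move=> r0 cr FE n; apply: complex_ext; rewrite ?Re_natM ?Im_natM /=.
  apply: (derive1n_psum r0 (cradius_ge_Re cr)).
  by apply: filterS FE => x ->.
apply: (derive1n_psum r0 (cradius_ge_Im cr)).
by apply: filterS FE => x ->.
Qed.

(** All P i would be 0, contradicting that their weighted sum is n > 0. *)
Lemma faa_di_bruno_coef0 g t n : (0 < n)%N -> faa_di_bruno_coef g t n 0 = 0.
Proof.
move=> n0; rewrite /faa_di_bruno_coef big_pred0// => P.
apply/negP => /andP[/eqP P0 /eqP Pn].
have Pi i : P i = 0%N :> nat.
  by apply/eqP; move/eqP: P0; rewrite sum_nat_eq0 => /forallP/(_ i).
by move: Pn n0; rewrite big1 => [<-//|i _]; rewrite Pi muln0.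
Qed.

Lemma cderiven_comp f g t n : (0 < n)%N -> csmooth_at f (g t) ->
  (forall k, \forall x \near t, derivable (derive1n k g) x 1) ->
  cderiven n (f \o g) t =
  \sum_(1 <= k < n.+1) cderiven k f (g t) * (faa_di_bruno_coef g t n k)%:C.
Proof.
move=> n0 fs gs.
have H (u : R -> R) : (forall k, \forall y \near g t, derivable (derive1n k u) y 1) ->
    derive1n n (u \o g) t =
    \sum_(1 <= k < n.+1) derive1n k u (g t) * faa_di_bruno_coef g t n k.
  move=> us; rewrite derive1n_comp// big_ltn//.
  by rewrite faa_di_bruno_coef0// mulr0 add0r.
apply: complex_ext; rewrite ?Re_sum ?Im_sum.
  under eq_bigr do rewrite ReMr.
  by apply: (H (fun y => complex.Re (f y))) => k; apply: filterS (fs k) => y [].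
under eq_bigr do rewrite ImMr.
by apply: (H (fun y => complex.Im (f y))) => k; apply: filterS (fs k) => y [].
Qed.

Lemma csums_real (u : nat -> R) (l : R) (z : R[i]) : series u @ \oo --> l ->
  csums (fun n => z * (u n)%:C) (z * l%:C).
Proof.
move=> ul; apply: csumsZ; split => //=.
rewrite (_ : series _ = cst 0); first exact: cvg_cst.
by apply/funext => N; rewrite /series/= big1.
Qed.

End composition.

Theorem mainTheorem12 (R : realType) (B : R -> R) (alpha a b t : R)
    (f : R -> R[i]) (g : R -> R)
    (lambda : R[i]) (eta : R[i] -> R[i]) (D : set R[i]^o)
    (hB : normalisation B)
    (halpha : 0 < alpha < 1)
    (ht : a < t < b)
    (hg : forall (n : nat) (x : R), a < x < b -> derivable (derive1n n g) x 1)
    (hf : csmooth_at f (g t))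
    (hL1 : cintegrable `]a, b[ (f \o g))
    (hlambda : -1 < complex.Re lambda)
    (hD : domain D)
    (haD : D a%:C)
    (heta : analytic_on D eta)
    (hform : forall x : R, a < x < b -> D x%:C ->
       f (g x) = rcpow x lambda * eta x%:C)
    (hdisc : [set z : R[i]^o | `|z - t%:C| <= (t - a)%:C] `<=` D)
    (hbranch : t - a <= `|t| \/ exists k : nat, lambda = k%:R) :
  let c := - alpha / (1 - alpha) in
  let term (m n : nat) : R[i] :=
    (c ^+ m * gbinom (- (m%:R * alpha)) n
       * (t - a) `^ (n%:R + m%:R * alpha)
       / Gamma (n%:R + m%:R * alpha + 1))%:C
    * \sum_(1 <= k < n.+1)
        cderiven k f (g t) * (faa_di_bruno_coef g t n k)%:C in
  [/\ cderivable (ABR_integral alpha a (f \o g)) t,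
      forall m : nat, csummable_from 1 (term m),
      csummable_from 0 (fun m => csum_from 1 (term m))
    & ABR B alpha a (f \o g) t =
      (B alpha / (1 - alpha))%:C *
        ((mittag_leffler alpha (c * (t - a) `^ alpha))%:C * f (g t)
         + csum_from 0 (fun m => csum_from 1 (term m)))].
Proof.
move=> c term.
have /andP[at_ tb] := ht; have /andP[alpha0 alpha1] := halpha.
pose r := t - a; have r0 : 0 < r by rewrite subr_gt0.
have loc z : normc z <= r -> exists c s, 0 < s /\ expands eta (t%:C + z) c s.
  move=> zr; have Dz : D (t%:C + z).
    by apply: hdisc; rewrite /= addrAC subrr add0r lecR.
  have [e [s [s0 es]]] := heta _ Dz; exists e, s; split => // h hs.
  apply/csumsP; have := es (t%:C + z + h); rewrite addrAC subrr add0r.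
  by apply; rewrite ltcR.
have [cf [cfS cfE]] := rcpow_analytic_expansion r0 hlambda hbranch loc.
have cfr := summable_div_radius cfS.
(* On ]a, u[ the function is both given by the formula and inside the disc of
   radius r around t. *)
pose u := Num.min b (t + r).
have tu : t < u by rewrite lt_min tb ltrDl.
have ub : u <= b by rewrite ge_min lexx.
have utr : u <= t + r by rewrite ge_min lexx orbT.
have FE x : a < x < u -> f (g x) = cpsum cf (x - t).
  move=> /andP[ax xu]; have xr : `|x - t| < r.
    by rewrite ltr_norml; apply/andP; split; move: utr; rewrite /r; lra.
  rewrite hform ?ax ?(lt_le_trans xu)//; first exact: cfE.
  by apply: hdisc; rewrite /= -rmorphB/= -[X in X <= _]/(_%:C) normc_real lecR ltW.
have atu : a < t < u by rewrite at_.
have near_au : \forall x \near t, a < x < u.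
  near=> x; apply/andP; split; near: x; [exact: lt_nbhsr|exact: lt_nbhsl].
have cf0 : f (g t) = cf 0%N.
  by rewrite (FE t atu) subrr /cpsum !psum0; case: (cf 0%N).
have deriv n : (0 < n)%N -> \sum_(1 <= k < n.+1)
    cderiven k f (g t) * (faa_di_bruno_coef g t n k)%:C = n`!%:R * cf n.
  move=> n0; rewrite -cderiven_comp//.
    by apply: (cderiven_cpsum r0 cfr); apply: filterS near_au => x; exact: FE.
  by move=> k; apply: filterS near_au => x /andP[ax xu]; apply: hg; rewrite ax (lt_le_trans xu).
have [M MP] := cfS.
have [iR iI] := hL1.
have part (p : R[i] -> R) : (forall z, `|p z| <= normc z) ->
    lebesgue_measure.-integrable `]a, b[ (EFin \o (fun y => p (f (g y)))) ->
    radius_ge (fun n => p (cf n)) r ->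
    (forall h, p (cpsum cf h) = psum (fun n => p (cf n)) h) ->
  exists V J, [/\ is_derive t 1 (fun T => \int[lebesgue_measure]_(x in `[a, T])
        (p (f (g x)) * mittag_leffler alpha (c * (T - x) `^ alpha))) (p (f (g t)) + V),
    forall m, (0 < m)%N -> series (fun n => p (cf n) * (-1) ^+ n *
      (r `^ (n%:R + alpha * m%:R) / (n%:R + alpha * m%:R))) @ \oo --> (J m : R) &
    series (fun m => ml_kernel_coef alpha c m * J m) @ \oo --> V].
  move=> pn pi pr pE.
  apply: (@ml_convolution_derive _ alpha c a u t (fun x => p (f (g x))) (fun n => p (cf n)) M) => //.
  - by move: utr; rewrite /r; lra.
  - by apply: integrableS pi => //; apply: subset_itvl; rewrite bnd_simp.
  - move=> N; apply: le_trans (MP N); apply: ler_sum => n _.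
    by rewrite ler_wpM2r// ler_wpM2r// exprn_ge0// ltW.
  - by move=> x axu; rewrite FE.
have [VR [JR [dR JRP VRP]]] := part _ (@Re_le_normc R) iR (cradius_ge_Re cfr) (fun h => erefl).
have [VI [JI [dI JIP VIP]]] := part _ (@Im_le_normc R) iI (cradius_ge_Im cfr) (fun h => erefl).
have ABRE : ABR_integral alpha a (f \o g) = (fun T =>
   (\int[lebesgue_measure]_(x in `[a, T])
        (complex.Re (f (g x)) * mittag_leffler alpha (c * (T - x) `^ alpha))) +i*
   (\int[lebesgue_measure]_(x in `[a, T])
        (complex.Im (f (g x)) * mittag_leffler alpha (c * (T - x) `^ alpha)))).
  apply/funext => T; rewrite /ABR_integral /cintegral.
  by congr (_ +i* _); apply: eq_Rintegral => x _; rewrite ?ReMr ?ImMr.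
pose V := VR +i* VI; pose J m := JR m +i* JI m.
pose E := mittag_leffler alpha (c * r `^ alpha).
pose e m := c ^+ m * ml_coef alpha m * r `^ (alpha * m%:R).
pose x m n := (-1) ^+ n * (r `^ (n%:R + alpha * m%:R) / (n%:R + alpha * m%:R)).
(* For m = 0 and n > 0 both sides are 0: the binomial coefficient on the left, the
   kernel coefficient on the right. *)
have coefE m n : (0 < n)%N ->
    c ^+ m * gbinom (- (m%:R * alpha)) n * r `^ (n%:R + m%:R * alpha)
      / Gamma (n%:R + m%:R * alpha + 1) * n`!%:R = ml_kernel_coef alpha c m * x m n.
  move=> n0; rewrite /ml_kernel_coef /x; case: m => [|m].
    rewrite mul0r oppr0 mulr0 mulr0 !mul0r /gbinom; case: n n0 => // n _.
    by rewrite big_ord_recl/= subr0 !mul0r mulr0 !mul0r.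
  have b0 : 0 < alpha * m.+1%:R by rewrite mulr_gt0.
  rewrite (mulrC _ alpha) /ml_coef; have h := gbinom_Gamma n b0.
  transitivity (c ^+ m.+1 * r `^ (n%:R + alpha * m.+1%:R) *
      (gbinom (- (alpha * m.+1%:R)) n * n`!%:R / Gamma (n%:R + alpha * m.+1%:R + 1))).
    move: (gbinom _ _) (r `^ _) ((Gamma _)^-1) (n`!%:R) (c ^+ _).
    by move=> p q v w z; ring.
  rewrite h invfM.
  move: (r `^ _) (_ ^+ n) ((Gamma _)^-1) ((n%:R + _)^-1) => p q v w; ring.
have termE m n : (0 < n)%N ->
    term m n = (ml_kernel_coef alpha c m)%:C * (cf n * (x m n)%:C).
  move=> n0; rewrite /term deriv//.
  have -> : (n`!%:R : R[i]) = (n`!%:R : R)%:C by rewrite rmorph_nat.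
  have real_factors (p q k y : R) (z : R[i]) :
      p * q = k * y -> p%:C * (q%:C * z) = k%:C * (z * y%:C).
    by move=> h; rewrite [z * _]mulrC !mulrA -!rmorphM h.
  exact/real_factors/coefE.
have k0 : ml_kernel_coef alpha c 0 = 0 by rewrite /ml_kernel_coef !mulr0 mul0r.
have csums0 : csums (fun=> 0 : R[i]) 0.
  by have := @csums_finite _ (fun=> 0 : R[i]) 0 (fun k _ => erefl); rewrite big_geq.
have csums1 (z : R[i]) : csums (fun n => if n == 0%N then z else 0) z.
  have := @csums_finite _ (fun n => if n == 0%N then z else 0) 1; rewrite big_nat1.
  by apply; case.
(* The sum over n >= 1 is the full sum minus its term n = 0, which is the m-th term of
   the Mittag-Leffler series times F(t). *)
have rows m : csums (fun n => if (1 <= n)%N then term m n else 0)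
    (if m == 0%N then 0 else (ml_kernel_coef alpha c m)%:C * J m - cf 0%N * (e m)%:C).
  case: (posnP m) => [->|m0].
    rewrite (_ : (fun n => _) = fun=> 0)//; apply/funext => n.
    by case: ifP => // n0; rewrite termE// k0 mul0r.
  have sJ : csums (fun n => cf n * (x m n)%:C) (J m).
    split.
      rewrite (_ : (fun n => _) = (fun n => complex.Re (cf n) * (-1) ^+ n *
        (r `^ (n%:R + alpha * m%:R) / (n%:R + alpha * m%:R)))); first exact: JRP.
      by apply/funext => n; rewrite ReMr /x !mulrA.
    rewrite (_ : (fun n => _) = (fun n => complex.Im (cf n) * (-1) ^+ n *
        (r `^ (n%:R + alpha * m%:R) / (n%:R + alpha * m%:R)))); first exact: JIP.
    by apply/funext => n; rewrite ImMr /x !mulrA.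
  have := csumsB (csumsZ (ml_kernel_coef alpha c m)%:C sJ) (csums1 (cf 0%N * (e m)%:C)).
  congr (csums _ _); apply/funext => -[|n]; last by rewrite subr0 termE.
  have mR : alpha * m%:R != 0 by rewrite gt_eqF// mulr_gt0// ltr0n.
  rewrite /= mulrCA -rmorphM -mulrBr -rmorphB/=.
  have -> : ml_kernel_coef alpha c m * x m 0 - e m = 0.
    rewrite /ml_kernel_coef /x /e expr0 mul1r add0r.
    move: (alpha * m%:R) mR => w w0.
    by move: (r `^ w) (c ^+ m) (ml_coef _ _) => p q v; field.
  by rewrite mulr0.
have rowsP m := csum_from_csums (rows m).
(* The removed terms start at m = 1, hence add up to (E - 1) F(t). *)
have cols : csums (fun m => csum_from 1 (term m)) (V - (cf 0%N * E%:C - cf 0%N)).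
  have sV : csums (fun m => (ml_kernel_coef alpha c m)%:C * J m) V.
    split.
      rewrite (_ : (fun n => _) = (fun m => ml_kernel_coef alpha c m * JR m)); first exact: VRP.
      by apply/funext => m; rewrite mulrC ReMr mulrC.
    rewrite (_ : (fun n => _) = (fun m => ml_kernel_coef alpha c m * JI m)); first exact: VIP.
    by apply/funext => m; rewrite mulrC ImMr mulrC.
  have sE := csums_real (cf 0%N) (ml_kernel_series (c := c) alpha0 (ltW r0)).
  have := csumsB sV (csumsB sE (csums1 (cf 0%N))).
  congr (csums _ _); apply/funext => m; have [_ ->] := rowsP m.
  case: (posnP m) => [->|m0]; last by rewrite subr0.
  by rewrite k0 mul0r ml_coef0// expr0 mulr0 powRr0 !mulr1 subrr subr0.
have [sum_ex sumE] := csum_from_csums (n0 := 0) cols.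
split.
- by rewrite ABRE; split; [case: dR|case: dI].
- by move=> m; have [] := rowsP m.
- exact: sum_ex.
- rewrite sumE /ABR; congr (_ * _); rewrite ABRE -/r -/E.
  have dRE : derive1 (fun T => \int[lebesgue_measure]_(x in `[a, T])
      (complex.Re (f (g x)) * mittag_leffler alpha (c * (T - x) `^ alpha))) t =
      complex.Re (f (g t)) + VR by rewrite derive1E (@derive_val _ _ _ _ _ _ _ dR).
  have dIE : derive1 (fun T => \int[lebesgue_measure]_(x in `[a, T])
      (complex.Im (f (g x)) * mittag_leffler alpha (c * (T - x) `^ alpha))) t =
      complex.Im (f (g t)) + VI by rewrite derive1E (@derive_val _ _ _ _ _ _ _ dI).
  transitivity (f (g t) + V).
    by apply: complex_ext; rewrite ?ReD ?ImD; [exact: dRE|exact: dIE].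
  by rewrite cf0 [E%:C * _]mulrC; ring.
Unshelve. all: by end_near. Qed.
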